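(* Let $n\ge 2$ and let $h:[n]\to[n]$ be an indecomposable Hessenberg function. Let $\mathsf{s}=\operatorname{diag}(1,0,\dots,0)$, $\mathsf{n}=E_{1n}$ and $\mathsf{s}_t=t\,\mathsf{s}+E_{1n}$. Then the flat degeneration $\mathcal{Y}_{\mathsf{s}_t,h}\to\operatorname{Spec}\mathbb{C}[t]$ of $\mathcal{Y}_{\mathsf{s},h}$ to $\mathcal{Y}_{\mathsf{n},h}$ yields a flat degeneration from each irreducible component of the semisimple matrix Hessenberg scheme $\mathcal{Y}_{\mathsf{s},h}$ to a unique irreducible component of the nilpotent matrix Hessenberg scheme $\mathcal{Y}_{\mathsf{n},h}$: for each irreducible component $\mathcal{Z}$ of $\mathcal{Y}_{\mathsf{s},h}$ there is a closed subscheme of $\mathcal{Y}_{\mathsf{s}_t,h}$, flat over $\operatorname{Spec}\mathbb{C}[t]$, with general fiber $\mathcal{Z}$ and special fiber an irreducible component $\mathcal{Z}_0$ of $\mathcal{Y}_{\mathsf{n},h}$, and $\mathcal{Z}\mapsto\mathcal{Z}_0$ is a bijection from the set of irreducible components of $\mathcal{Y}_{\mathsf{s},h}$ to the set of irreducible components of $\mathcal{Y}_{\mathsf{n},h}$. In particular, there is a bijection between the irreducible components of each minimal semisimple Hessenberg variety $Y_{\mathsf{x},h}$ and those of each minimal nilpotent Hessenberg variety $Y_{\mathsf{y},h}$ (where $\mathsf{x}$ is semisimple, $\mathsf{y}$ is nilpotent, and both lie in the minimal sheet).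
   Context: Let $[n]=\{1,\dots,n\}$. A Hessenberg function is a map $h:[n]\to[n]$ with $h(i)\le h(i+1)$ for $i<n$ and $h(i)\ge i$ for all $i$; it is indecomposable if $h(i)>i$ for all $i<n$. Let $\mathbf{z}=\{z_{ij}\mid 1\le i,j\le n\}$, $Z=(z_{ij})$, $d=\det Z$, and let $v_j=\sum_i z_{ij}e_i$ be the $j$-th column of $Z$. For a polynomial ring $R$ over $\mathbb{C}$ (here $R=\mathbb{C}$ or $R=\mathbb{C}[t]$) and $\mathsf{x}\in M_n(R)$: for each $i$ with $h(i)<n$ let $\mathcal{I}_{\mathsf{x},h,i}\subseteq R[\mathbf{z}]$ be the ideal generated by all $(h(i)+1)\times(h(i)+1)$ minors of the $n\times(i+h(i))$ matrix $[\mathsf{x}v_1\ \cdots\ \mathsf{x}v_i\ v_1\ \cdots\ v_{h(i)}]$, and $\mathcal{I}_{\mathsf{x},h,i}=0$ if $h(i)=n$. Put $\mathcal{I}_{\mathsf{x},h}=\sum_{i\in[n]}\mathcal{I}_{\mathsf{x},h,i}$ and let $\tilde{\mathcal{I}}_{\mathsf{x},h}=\{f\in R[\mathbf{z}]\mid d^kf\in\mathcal{I}_{\mathsf{x},h}\text{ for some }k\ge 0\}$. For $\mathsf{x}\in\mathfrak{gl}_n(\mathbb{C})$ the matrix Hessenberg scheme is $\mathcal{Y}_{\mathsf{x},h}=\operatorname{Spec}\mathbb{C}[\mathbf{z}]/\tilde{\mathcal{I}}_{\mathsf{x},h}$; for $\mathsf{x}_t\in M_n(\mathbb{C}[t])$,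 $\mathcal{Y}_{\mathsf{x}_t,h}=\operatorname{Spec}\mathbb{C}[t,\mathbf{z}]/\tilde{\mathcal{I}}_{\mathsf{x}_t,h}$ with its natural morphism to $\operatorname{Spec}\mathbb{C}[t]$. For a flat morphism to $\operatorname{Spec}\mathbb{C}[t]$, ''general fiber $\mathcal{Z}$'' means that the scheme-theoretic fiber over $\langle t-a\rangle$ is isomorphic to $\mathcal{Z}$ for every $a\ne 0$; the ''special fiber'' is the scheme-theoretic fiber over $\langle t\rangle$; such a morphism is called a flat degeneration from the general fiber to the special fiber. Irreducible components are given their reduced structure. The Hessenberg variety is $Y_{\mathsf{x},h}=\{V_\bullet\mid \mathsf{x}(V_i)\subseteq V_{h(i)}\text{ for all }i\}$ inside the variety $GL_n(\mathbb{C})/B$ of complete flags $V_\bullet$ in $\mathbb{C}^n$ ($B$ the upper triangular matrices). The minimal sheet consists of the matrices conjugate to $\operatorname{diag}(c_1,c_2,\dots,c_2)$ with $c_1\neq c_2$, or to $cI_n+E_{n-1,n}$, $c\in\mathbb{C}$; $E_{ij}$ is the matrix unit. *)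

(* Defs.v *)
From HB Require Import structures.
From mathcomp Require Import all_boot all_order all_algebra.
From mathcomp Require Import generic_quotient sesquilinear.
From mathcomp Require Import boolp classical_sets functions reals.
From mathcomp Require Import complex mpoly.

Set Implicit Arguments.
Unset Strict Implicit.
Unset Printing Implicit Defensive.

Import GRing.Theory.

Local Open Scope ring_scope.
Local Open Scope classical_set_scope.
Local Open Scope quotient_scope.

(* An ideal may be the whole ring and a quotient may be trivial (the empty
   scheme), unlike the proper ideals of [ring_quotient]. *)

#[local] Obligation Tactic := idtac.

Section Ideals.
Variable A : comPzRingType.

Record ideal := Ideal {
  ideal_set :> A -> Prop;
  ideal_0 : ideal_set 0;
  ideal_D : forall x y, ideal_set x -> ideal_set y -> ideal_set (x + y);
  ideal_M : forall a x, ideal_set x -> ideal_set (a * x) }.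

Implicit Types I J : ideal.

Definition ideal_le I J := forall x, I x -> J x.

Lemma ideal_eq I J : (forall x, I x <-> J x) -> I = J.
Proof.
case: I J => [I I0 ID IM] [J J0 JD JM] /= IJ.
have eIJ : I = J by apply/funext => x; apply/propext/IJ.
case: _ / eIJ in J0 JD JM IJ *.
by congr Ideal; exact: Prop_irrelevance.
Qed.

Lemma ideal_N I x : I x -> I (- x).
Proof. by move=> Ix; rewrite -mulN1r; exact: ideal_M. Qed.

Lemma ideal_B I x y : I x -> I y -> I (x - y).
Proof. by move=> Ix Iy; apply: ideal_D => //; exact: ideal_N. Qed.

Program Definition zero_ideal := @Ideal (fun x => x = 0) _ _ _.
Next Obligation. by []. Qed.
Next Obligation. by move=> x y -> ->; rewrite addr0. Qed.
Next Obligation. by move=> a x ->; rewrite mulr0. Qed.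

Program Definition gen_ideal (S : set A) :=
  @Ideal (fun x => forall I, (forall y, S y -> I y) -> I x) _ _ _.
Next Obligation. by move=> S I _; exact: ideal_0. Qed.
Next Obligation.
by move=> S x y Sx Sy I SI; apply: ideal_D; [exact: Sx|exact: Sy].
Qed.
Next Obligation. by move=> S a x Sx I SI; apply: ideal_M; exact: Sx. Qed.

Program Definition sum_ideal (T : finType) (I : T -> ideal) :=
  @Ideal (fun x => exists2 f : T -> A, (forall i, I i (f i))
                                       & x = \sum_i f i) _ _ _.
Next Obligation.
by move=> T I; exists (fun=> 0) => [i|]; [exact: ideal_0|rewrite big1].
Qed.
Next Obligation.
move=> T I _ _ [f If ->] [g Ig ->]; exists (fun i => f i + g i) => [i|].
  by apply: ideal_D.
by rewrite big_split.
Qed.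
Next Obligation.
move=> T I a _ [f If ->]; exists (fun i => a * f i) => [i|].
  by apply: ideal_M.
by rewrite mulr_sumr.
Qed.

Program Definition saturation (d : A) I :=
  @Ideal (fun x => exists k, I (d ^+ k * x)) _ _ _.
Next Obligation. by move=> d I; exists 0%N; rewrite mulr0; exact: ideal_0. Qed.
Next Obligation.
move=> d I x y [k Ix] [l Iy]; exists (k + l)%N; rewrite mulrDr exprD.
apply: ideal_D; last by rewrite -mulrA; exact: ideal_M.
by rewrite mulrAC mulrC; exact: ideal_M.
Qed.
Next Obligation.
by move=> d I a x [k Ix]; exists k; rewrite mulrCA; exact: ideal_M.
Qed.

Program Definition cap_ideal (F : set ideal) :=
  @Ideal (fun x => forall I, F I -> I x) _ _ _.
Next Obligation. by move=> F I _; exact: ideal_0. Qed.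
Next Obligation.
by move=> F x y Fx Fy I FI; apply: ideal_D; [exact: Fx|exact: Fy].
Qed.
Next Obligation. by move=> F a x Fx I FI; apply: ideal_M; exact: Fx. Qed.

End Ideals.

Section QuotientRing.
Variables (A : comPzRingType) (I : ideal A).

Definition ideal_equiv : rel A := fun x y => `[< I (x - y) >].

Lemma ideal_equiv_is_equiv : equiv_class_of ideal_equiv.
Proof.
split=> [x|x y|y x z].
- by apply/asboolP; rewrite subrr; exact: ideal_0.
- apply: asbool_equiv_eq; rewrite -[x - y]opprB.
  by split=> [/ideal_N|/ideal_N]; rewrite ?opprK.
- move=> /asboolP Ixy /asboolP Iyz; apply/asboolP.
  by rewrite -[x](subrK y) -addrA; exact: ideal_D.
Qed.

Canonical ideal_equiv_rel := EquivRelPack ideal_equiv_is_equiv.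
Canonical ideal_equiv_encModRel := defaultEncModRel ideal_equiv.

Definition quot := {eq_quot ideal_equiv}.

HB.instance Definition _ : EqQuotient A ideal_equiv quot := EqQuotient.on quot.
HB.instance Definition _ := Choice.on quot.

Lemma quotP x y : \pi_quot x = \pi_quot y <-> I (x - y).
Proof.
split=> [/eqP|Ixy]; first by rewrite piE => /asboolP.
by apply/eqP; rewrite piE; exact/asboolP.
Qed.

Lemma quot_repr x : I (repr (\pi_quot x) - x).
Proof. by apply/quotP; rewrite reprK. Qed.

Definition quot_zero : quot := \pi_quot 0.
Definition quot_one : quot := \pi_quot 1.
Definition quot_opp (u : quot) : quot := \pi_quot (- repr u).
Definition quot_add (u v : quot) : quot := \pi_quot (repr u + repr v).
Definition quot_mul (u v : quot) : quot := \pi_quot (repr u * repr v).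

Lemma pi_quot_opp x : quot_opp (\pi_quot x) = \pi_quot (- x).
Proof. by apply/quotP; rewrite -opprD; apply/ideal_N/quot_repr. Qed.

Lemma pi_quot_add x y :
  quot_add (\pi_quot x) (\pi_quot y) = \pi_quot (x + y).
Proof.
by apply/quotP; rewrite opprD addrACA; apply: ideal_D; exact: quot_repr.
Qed.

Lemma pi_quot_mul x y :
  quot_mul (\pi_quot x) (\pi_quot y) = \pi_quot (x * y).
Proof.
apply/quotP; set x' := repr _; set y' := repr _.
rewrite -[x' * y'](subrK (x' * y)) -addrA -mulrBr -mulrBl.
by apply: ideal_D; [|rewrite mulrC]; apply/ideal_M/quot_repr.
Qed.

Let pi_surj (u : quot) : exists x, u = \pi_quot x.
Proof. by exists (repr u); rewrite reprK. Qed.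

Fact quot_addA : associative quot_add.
Proof.
move=> u v w; have [[[x ->] [y ->]] [z ->]] := (pi_surj u, pi_surj v, pi_surj w).
by rewrite !pi_quot_add addrA.
Qed.

Fact quot_addC : commutative quot_add.
Proof. by move=> u v; rewrite /quot_add addrC. Qed.

Fact quot_add0 : left_id quot_zero quot_add.
Proof. by move=> u; have [x ->] := pi_surj u; rewrite pi_quot_add add0r. Qed.

Fact quot_addN : left_inverse quot_zero quot_opp quot_add.
Proof.
by move=> u; have [x ->] := pi_surj u; rewrite pi_quot_opp pi_quot_add addNr.
Qed.

HB.instance Definition _ :=
  GRing.isZmodule.Build quot quot_addA quot_addC quot_add0 quot_addN.

Lemma quotD x y : \pi_quot (x + y) = \pi_quot x + \pi_quot y.
Proof. exact/esym/pi_quot_add. Qed.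

Fact quot_mulA : associative quot_mul.
Proof.
move=> u v w; have [[[x ->] [y ->]] [z ->]] := (pi_surj u, pi_surj v, pi_surj w).
by rewrite !pi_quot_mul mulrA.
Qed.

Fact quot_mulC : commutative quot_mul.
Proof. by move=> u v; rewrite /quot_mul mulrC. Qed.

Fact quot_mul1 : left_id quot_one quot_mul.
Proof. by move=> u; have [x ->] := pi_surj u; rewrite pi_quot_mul mul1r. Qed.

Fact quot_mulD : left_distributive quot_mul +%R.
Proof.
move=> u v w; have [[[x ->] [y ->]] [z ->]] := (pi_surj u, pi_surj v, pi_surj w).
by rewrite -quotD !pi_quot_mul -quotD mulrDl.
Qed.

HB.instance Definition _ :=
  GRing.Zmodule_isComPzRing.Build quot
    quot_mulA quot_mulC quot_mul1 quot_mulD.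

Lemma quotM x y : \pi_quot (x * y) = \pi_quot x * \pi_quot y.
Proof. exact/esym/pi_quot_mul. Qed.

Lemma quot1 : \pi_quot 1 = 1.
Proof. by []. Qed.

End QuotientRing.

Section QuotientModule.
Variables (K : comNzRingType) (A : comAlgType K) (I : ideal A).

Definition quot_scale (c : K) (u : quot I) : quot I :=
  \pi_(quot I) (c *: repr u).

Lemma pi_quot_scale c x :
  quot_scale c (\pi_(quot I) x) = \pi_(quot I) (c *: x).
Proof.
apply/quotP; rewrite -scalerBr -mulr_algl.
exact/ideal_M/quot_repr.
Qed.

Let pi_surj (u : quot I) : exists x, u = \pi_(quot I) x.
Proof. by exists (repr u); rewrite reprK. Qed.

Fact quot_scaleA c d u :
  quot_scale c (quot_scale d u) = quot_scale (c * d) u.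
Proof. by have [x ->] := pi_surj u; rewrite !pi_quot_scale scalerA. Qed.

Fact quot_scale1 : left_id 1 quot_scale.
Proof. by move=> u; have [x ->] := pi_surj u; rewrite pi_quot_scale scale1r. Qed.

Fact quot_scaleDr : right_distributive quot_scale +%R.
Proof.
move=> c u v; have [[x ->] [y ->]] := (pi_surj u, pi_surj v).
by rewrite -quotD !pi_quot_scale -quotD scalerDr.
Qed.

Fact quot_scaleDl u : {morph quot_scale^~ u : c d / c + d}.
Proof.
move=> c d; have [x ->] := pi_surj u.
by rewrite !pi_quot_scale -quotD scalerDl.
Qed.

HB.instance Definition _ := GRing.Zmodule_isLmodule.Build K (quot I)
  quot_scaleA quot_scale1 quot_scaleDr quot_scaleDl.

Lemma quotZ c x : \pi_(quot I) (c *: x) = c *: \pi_(quot I) x.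
Proof. exact/esym/pi_quot_scale. Qed.

End QuotientModule.

Definition quot_alg_iso (K : comNzRingType) (A B : comAlgType K)
    (I : ideal A) (J : ideal B) :=
  exists2 f : {rmorphism quot I -> quot J}, scalable f & bijective f.

(* The element [\sum_(x <- s) x.1 (x) x.2] of the tensor product of M and N is
   zero: by the universal property, every bilinear map sends [s] to zero. *)
Definition tensor_eq0 (K : comNzRingType) (M N : lmodType K)
    (s : seq (M * N)) :=
  forall (P : lmodType K) (b : {bilinear M -> N -> P}),
    \sum_(x <- s) b x.1 x.2 = 0.

(* Tensoring with N preserves injectivity of linear maps. *)
Definition flat (K : comNzRingType) (N : lmodType K) :=
  forall (M M' : lmodType K) (f : {linear M -> M'}), injective f ->
  forall s : seq (M * N),
    tensor_eq0 [seq (f x.1, x.2) | x <- s] -> tensor_eq0 s.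

(* The topology of the ambient space T is given by its closed sets; Y carries
   the subspace topology. *)
Section Irreducible.
Variables (T : Type) (closed : set (set T)).

Definition irreducible (Z : set T) :=
  Z !=set0 /\ forall A B, closed A -> closed B ->
    Z `<=` A `|` B -> Z `<=` A \/ Z `<=` B.

Definition irr_components (Y : set T) : set (set T) :=
  [set Z | [/\ Z `<=` Y, irreducible Z &
    forall Z', Z' `<=` Y -> irreducible Z' -> Z `<=` Z' -> Z' = Z]].

End Irreducible.

Section Spectrum.
Variable A : comPzRingType.

Record spec := Spec {
  spec_ideal :> ideal A;
  spec_proper : ~ spec_ideal 1;
  spec_prime : forall a b,
    spec_ideal (a * b) -> spec_ideal a \/ spec_ideal b }.

Definition zero_locus (S : set A) : set spec := [set p | forall x, S x -> p x].

Definition spec_closed : set (set spec) := [set Z | exists S, Z = zero_locus S].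

(* The reduced closed subscheme structure on the closure of Z. *)
Definition vanishing (Z : set spec) : ideal A :=
  cap_ideal [set I | exists2 p, Z p & I = spec_ideal p].

End Spectrum.

(* Indices start at 0, so that [h i] stands for h(i+1) - 1. A closed subscheme
   of the affine space of n x n matrices over K (K = C or C[t]) is given by
   its ideal in [{mpoly K[n * n]}], the variable z_ij being the one of index
   [mxvec_index i j]. *)

Definition hessenberg n (h : 'I_n -> 'I_n) :=
  {homo h : i j / (i <= j)%N} /\ forall i : 'I_n, (i <= h i)%N.

Definition indecomposable n (h : 'I_n -> 'I_n) :=
  forall i : 'I_n, (i.+1 < n)%N -> (i < h i)%N.

Definition minors (A : comPzRingType) p q k (M : 'M[A]_(p, q)) : set A :=
  [set m | exists (f : 'I_k -> 'I_p) (g : 'I_k -> 'I_q),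
    [/\ {homo f : a b / (a < b)%N}, {homo g : a b / (a < b)%N}
      & m = \det (mxsub f g M)]].

Section HessenbergScheme.
Variables (K : comNzRingType) (n : nat).

Definition generic_mx : 'M[{mpoly K[n * n]}]_n :=
  \matrix_(i, j) 'X_(mxvec_index i j).

Variables (x : 'M[K]_n) (h : 'I_n -> 'I_n).

(* The matrix [x v_1 ... x v_i v_1 ... v_h(i)]. *)
Definition hess_mx (i : 'I_n) : 'M[{mpoly K[n * n]}]_(n, i.+1 + (h i).+1) :=
  row_mx
    (colsub (widen_ord (ltn_ord i)) (map_mx (@mpolyC _ _) x *m generic_mx))
    (colsub (widen_ord (ltn_ord (h i))) generic_mx).

Definition hess_ideal_at (i : 'I_n) : ideal {mpoly K[n * n]} :=
  if ((h i).+1 < n)%N then gen_ideal (minors (h i).+2 (hess_mx i))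
  else zero_ideal _.

Definition hess_ideal : ideal {mpoly K[n * n]} := sum_ideal hess_ideal_at.

Definition hess_scheme : ideal {mpoly K[n * n]} :=
  saturation (\det generic_mx) hess_ideal.

End HessenbergScheme.

Section Degeneration.
Variables (C : fieldType) (N : nat).

(* The fiber of Spec C[t][z]/W over <t - a> is Spec C[z]/(W evaluated at
   t = a), because C[t][z]/W (x) C[t]/<t - a> = C[t][z]/(W + <t - a>). *)
Program Definition fiber (a : C) (W : ideal {mpoly {poly C}[N]}) :
    ideal {mpoly C[N]} :=
  @Ideal _ (fun f => exists2 F, W F & f = map_mpoly (horner_eval a) F) _ _ _.
Next Obligation. by move=> a W; exists 0; [exact: ideal_0|rewrite raddf0]. Qed.
Next Obligation.
move=> a W _ _ [F WF ->] [G WG ->]; exists (F + G); first exact: ideal_D.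
by rewrite raddfD.
Qed.
Next Obligation.
move=> a W g _ [F WF ->]; exists (map_mpoly polyC g * F); first exact: ideal_M.
rewrite rmorphM; congr (_ * _); apply/mpolyP => m.
by rewrite !mcoeff_map_mpoly /= horner_evalE hornerC.
Qed.

(* General fibers are only compared up to isomorphism over C; the special fiber
   is identified as a closed subscheme of affine space. *)
Definition flat_degeneration (W : ideal {mpoly {poly C}[N]})
    (general special : ideal {mpoly C[N]}) :=
  [/\ flat (quot W),
      forall a, a != 0 -> quot_alg_iso (fiber a W) general
    & fiber 0 W = special].

End Degeneration.

Section HessenbergVariety.
Variables (C : fieldType) (n : nat).

(* The subspaces V_1, ..., V_n, those of index 0, ..., n - 1 here. *)
Record flag := Flag {
  flag_space :> 'I_n -> {vspace 'cV[C]_n};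
  flag_dim : forall i, \dim (flag_space i) = i.+1;
  flag_sub : forall i j : 'I_n, (i <= j)%N ->
    (flag_space i <= flag_space j)%VS }.

(* F is the flag of the coset gB. *)
Definition flag_of_mx (g : 'M[C]_n) (F : flag) :=
  forall i, F i = <<[seq col j g | j : 'I_n <- enum 'I_n & (j <= i)%N]>>%VS.

(* The quotient topology along GL_n -> GL_n/B: the preimage in GL_n is the zero
   locus in GL_n of a set S of polynomials in the matrix entries. *)
Definition flag_closed : set (set flag) :=
  [set X | exists S : set {mpoly C[n * n]},
    forall g F, g \in unitmx -> flag_of_mx g F ->
      X F <-> (forall f, S f -> f.@[mxvec g 0] = 0)].

Definition hess_variety (x : 'M[C]_n) (h : 'I_n -> 'I_n) : set flag :=
  [set F : flag | forall i, (linfun (mulmx x) @: F i <= F (h i))%VS].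

(* The matrix unit E_ab, for 1 <= a, b <= n. *)
Definition mx_unit (a b : nat) : 'M[C]_n :=
  \matrix_(i, j) ((i.+1 == a) && (j.+1 == b))%:R.

Definition diag_first (c1 c2 : C) : 'M[C]_n :=
  diag_mx (\row_j if j == 0 :> nat then c1 else c2).

Definition minimal_sheet (x : 'M[C]_n) :=
  (exists c1 c2, c1 != c2 /\ x ~_{in unitmx} diag_first c1 c2) \/
  (exists c, x ~_{in unitmx} c%:M + mx_unit n.-1 n).

Definition nilpotent_mx (x : 'M[C]_n) := exists k : nat, x ^+ k = 0.

End HessenbergVariety.

(* Main.v *)
(* For x = ts + E_1n only the first row of xZ is nonzero, with entries
   l_c = t z_1c + z_nc, so I_(x,h) is generated by the products l_c m with c <= i
   and m an (h(i) x h(i))-minor of the first h(i) columns of Z without its first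
   row. The ideals of the components are the ideals J_i generated by the l_c, c < i,
   and those minors, for i the least element of a fiber of h on [1, n-1].

   J_i vanishes where l_1 = ... = l_(i-1) = 0 and some combination of the first
   h(i) columns is a multiple of e_1. Solving these conditions for z_n1, ...,
   z_n(i-1) and for the column h(i) parametrizes this locus by an affine space,
   hence yields a ring morphism p_i into a polynomial ring, and ker p_i is prime.
   For a suitable lexicographic order the leading coefficients of the l_c and of
   the minors are 1. If the leading monomial of f is divisible neither by one of
   the z_nc, c < i, nor by the diagonal of a minor, there is a point of the locus,
   over a field of rational functions, at which f does not vanish: the leading
   term of f survives. So the generators are a Groebner basis of ker p_i, and
   J_i = ker p_i; likewise I_(x,h) is the intersection of the ker p_i, and it is
   saturated as p_i(d) is nonzero. Over C[t] the leading coefficients 1 make the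
   quotients free, hence flat, over C[t].

   The generators specialize at t = a to the generators for ts + E_1n with t = a,
   and for a nonzero the row operation z_1 |-> a z_1 + z_n identifies these with
   the generators for s, so the families J_i over C[t] are the degenerations.
   An element of the minimal sheet which is semisimple or nilpotent is, up to
   conjugation, scaling and translation by scalars, s + E_1n or E_1n; the same
   parametrizations show that the flags gB with g in the locus of J_i are the
   components of the Hessenberg variety. *)
Require Import Defs.
From HB Require Import structures.
From mathcomp Require Import all_boot all_order all_algebra.
From mathcomp Require Import fingroup perm generic_quotient sesquilinear.
From mathcomp Require Import boolp classical_sets functions reals.
From mathcomp Require Import complex mpoly.

Set Implicit Arguments.
Unset Strict Implicit.
Unset Printing Implicit Defensive.

Import Order.TTheory GRing.Theory.
Local Open Scope ring_scope.
Local Open Scope classical_set_scope.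
Local Open Scope quotient_scope.

#[local] Obligation Tactic := idtac.

(** * Ideals, quotients and flatness *)

Section Ideals.
Variables A B : comPzRingType.

Lemma gen_ideal_sub (S : set A) x : S x -> gen_ideal S x.
Proof. by move=> Sx I SI; exact: SI. Qed.

Lemma gen_ideal_le (S : set A) (I : ideal A) :
  (forall x, S x -> I x) -> ideal_le (gen_ideal S) I.
Proof. by move=> SI x; apply. Qed.

Lemma ideal_sum (T : Type) (r : seq T) (P : pred T) (F : T -> A) (I : ideal A) :
  (forall i, P i -> I (F i)) -> I (\sum_(i <- r | P i) F i).
Proof.
by move=> IF; elim/big_ind: _ => //; [exact: ideal_0|exact: ideal_D].
Qed.

Program Definition comap (f : {rmorphism A -> B}) (J : ideal B) : ideal A :=
  @Ideal _ (fun x => J (f x)) _ _ _.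
Next Obligation. by move=> f J /=; rewrite rmorph0; exact: ideal_0. Qed.
Next Obligation. by move=> f J x y /=; rewrite rmorphD; exact: ideal_D. Qed.
Next Obligation. by move=> f J a x /=; rewrite rmorphM; exact: ideal_M. Qed.

(** The point [p] lies in its own zero locus and is the smallest prime there. *)
Lemma vanishing_prime (p : spec A) :
  vanishing (zero_locus (spec_ideal p)) = p.
Proof.
apply: ideal_eq => x; split=> [/(_ p)|px _ [q pq ->]]; last exact: pq.
by apply; exists p.
Qed.

Lemma zero_locusU (S T : set A) :
  zero_locus S `|` zero_locus T
  = zero_locus [set x | exists2 y, S y & exists2 z, T z & x = y * z].
Proof.
apply/seteqP; split=> p /=.
  case=> [pS|pT] _ [y Sy [z Tz ->]].
    by rewrite mulrC; apply: ideal_M; exact: pS.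
  by apply: ideal_M; exact: pT.
move=> pST; have [pS|/existsNP[y /not_implyP[Sy npy]]] :=
  pselect (forall y, S y -> p y); [by left|right=> z Tz].
by have [//|//] := @spec_prime _ p y z (pST _ (ex_intro2 _ _ y Sy
  (ex_intro2 _ _ z Tz erefl))).
Qed.

End Ideals.

Section QuotientIso.
Variables (K : comNzRingType) (A B : comAlgType K).
Variables (f : {rmorphism A -> B}) (g : B -> A).
Hypotheses (fZ : scalable f) (gK : cancel g f).
Variables (I : ideal A) (J : ideal B).
Hypothesis IJ : forall x, I x <-> J (f x).

Let phi (u : quot I) : quot J := \pi_(quot J) (f (repr u)).

Let phi_pi x : phi (\pi_(quot I) x) = \pi_(quot J) (f x).
Proof.
by rewrite /phi; apply/Defs.quotP; move: (quot_repr I x) => /IJ; rewrite rmorphB.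
Qed.

Let pi_surj (u : quot I) : exists x, u = \pi_(quot I) x.
Proof. by exists (repr u); rewrite reprK. Qed.

Fact phi_is_zmod_morphism : zmod_morphism phi.
Proof.
move=> u v; have [[x ->] [y ->]] := (pi_surj u, pi_surj v).
have piB (C : comPzRingType) (L : ideal C) (a b : C) :
    \pi_(quot L) (a - b) = \pi_(quot L) a - \pi_(quot L) b.
  by apply/eqP; rewrite eq_sym subr_eq -quotD subrK.
by rewrite -piB !phi_pi rmorphB piB.
Qed.

Fact phi_is_monoid_morphism : monoid_morphism phi.
Proof.
split=> [|u v].
  by rewrite -quot1 phi_pi rmorph1.
have [[x ->] [y ->]] := (pi_surj u, pi_surj v).
by rewrite -quotM !phi_pi rmorphM quotM.
Qed.

(** By [gK] the morphism [f] is onto, and by [IJ] the preimage of [J] is exactly [I], so the induced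
    morphism is bijective. The map [g] only supplies representatives for the inverse. *)
Lemma quot_alg_isoP : quot_alg_iso I J.
Proof.
pose fA := GRing.isZmodMorphism.Build _ _ phi phi_is_zmod_morphism.
pose fM := GRing.isMonoidMorphism.Build _ _ phi phi_is_monoid_morphism.
pose F : {rmorphism quot I -> quot J} := HB.pack phi fA fM.
exists F => [c u|].
  have [x ->] := pi_surj u.
  by rewrite -quotZ /F /= !phi_pi fZ quotZ.
exists (fun v => \pi_(quot I) (g (repr v))) => [u|v]; rewrite /F /=.
  have [x ->] := pi_surj u; rewrite phi_pi; apply/Defs.quotP/IJ.
  rewrite rmorphB gK; exact: quot_repr.
by rewrite phi_pi gK reprK.
Qed.

End QuotientIso.

Section Flatness.
Variable K : comNzRingType.

(* A module with a (possibly infinite) dual basis is projective, hence flat. *)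
Lemma dual_basis_flat (N : lmodType K) (T : Type) (E : nat -> seq T)
    (e : T -> N) (c : T -> {linear N -> K^o}) :
  (forall x, exists d0, forall d, (d0 <= d)%N ->
     x = \sum_(i <- E d) (c i x : K) *: e i) -> flat N.
Proof.
move=> basis M M' f f_inj s s0 P b.
(* The map [(m, x) |-> c_i(x) m] is bilinear, so it kills the tensor over [M']; injectivity of [f]
   brings the relation back to [M]. *)
have coord0 i : \sum_(x <- s) (c i x.2 : K) *: x.1 = 0.
  apply: f_inj; rewrite raddf0 raddf_sum.
  pose b' (m : M') (x : N) : M' := (c i x : K) *: m.
  have b'P : bilinear_for *:%R *:%R b'.
    split=> [x k m m'|m k x x'] /=; rewrite /b'.
      by rewrite scalerDr !scalerA mulrC.
    by rewrite linearP scalerDl -scalerA.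
  pose B := bilinear_isBilinear.Build K _ _ _ _ _ b' b'P.
  pose b1 : {bilinear M' -> N -> M'} := HB.pack b' B.
  have := s0 M' b1; rewrite big_map; apply: etrans; apply: eq_bigr => x _ /=.
  by rewrite linearZ.
(* One truncation [d] serves all terms of the finite list [s]. *)
have [d sE] : exists d, forall P' (F : M * N -> N -> P'),
    [seq F x x.2 | x <- s]
    = [seq F x (\sum_(i <- E d) (c i x.2 : K) *: e i) | x <- s].
  suff [d0 sd0] : exists d0, forall d, (d0 <= d)%N -> forall P' (F : M * N -> N -> P'),
    [seq F x x.2 | x <- s]
    = [seq F x (\sum_(i <- E d) (c i x.2 : K) *: e i) | x <- s].
    by exists d0 => P' F; exact: sd0.
  elim: (s) => [|x s' [d0 IH]]; first by exists 0%N.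
  have [d1 xd1] := basis x.2; exists (maxn d0 d1) => d.
  rewrite geq_max => /andP[d0d d1d] P' F /=.
  by rewrite (IH _ d0d) -(xd1 _ d1d).
have -> : \sum_(x <- s) b x.1 x.2
        = \sum_(x <- s) b x.1 (\sum_(i <- E d) (c i x.2 : K) *: e i).
  by move: (sE _ (fun x y => b x.1 y)) => /(congr1 (fun r => \sum_(y <- r) y));
    rewrite !big_map.
under eq_bigr do rewrite linear_sumr.
rewrite exchange_big; apply: big1 => i _ /=.
transitivity (b (\sum_(x <- s) (c i x.2 : K) *: x.1) (e i)).
  by rewrite linear_sumlz; apply: eq_bigr => x _; rewrite linearZr_LR linearZl_LR.
by rewrite coord0 linear0l.
Qed.

End Flatness.

(** [N'] is a retract of [N]: a bilinear map on [M * N'] is pulled back along [f], and [f (g x) = x]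
    recovers its values. *)
Lemma flat_iso (K : comNzRingType) (N N' : lmodType K)
    (f : {linear N -> N'}) (g : {linear N' -> N}) :
  cancel g f -> flat N -> flat N'.
Proof.
move=> gK flatN M M' phi phi_inj s s0.
have s0' : tensor_eq0 [seq (x.1, g x.2) | x <- s].
  apply: (flatN M M' phi) => // P b; rewrite big_map big_map /=.
  pose b' (m : M') (x : N') : P := b m (g x).
  have b'P : bilinear_for *:%R *:%R b'.
    split=> [x k m m'|m k x x'] /=; rewrite /b'.
      by rewrite linearDl linearZl_LR.
    by rewrite linearP linearPr.
  pose B := bilinear_isBilinear.Build K _ _ _ _ _ b' b'P.
  pose b1 : {bilinear M' -> N' -> P} := HB.pack b' B.
  by have := s0 P b1; rewrite big_map.
move=> P b; pose b' (m : M) (x : N) : P := b m (f x).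
have b'P : bilinear_for *:%R *:%R b'.
  split=> [x k m m'|m k x x'] /=; rewrite /b'.
    by rewrite linearDl linearZl_LR.
  by rewrite linearP linearPr.
pose B := bilinear_isBilinear.Build K _ _ _ _ _ b' b'P.
pose b1 : {bilinear M -> N -> P} := HB.pack b' B.
by have := s0' P b1; rewrite big_map /= /b'; under eq_bigr do rewrite gK.
Qed.

Lemma flat_quot_iso (K : comNzRingType) (A B : comAlgType K)
    (I : ideal A) (J : ideal B) :
  quot_alg_iso I J -> flat (quot I) -> flat (quot J).
Proof.
move=> [f fZ [g fK gK]].
have gB : zmod_morphism g by move=> u v; apply: (can_inj fK); rewrite rmorphB !gK.
have gZ : scalable g by move=> c u; apply: (can_inj fK); rewrite fZ !gK.
pose f' : {linear quot I -> quot J} :=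
  HB.pack (f : quot I -> quot J) (GRing.isZmodMorphism.Build _ _ f (rmorphB f))
    (GRing.isScalable.Build K _ _ _ f fZ).
pose g' : {linear quot J -> quot I} :=
  HB.pack g (GRing.isZmodMorphism.Build _ _ g gB)
    (GRing.isScalable.Build K _ _ _ g gZ).
exact: (@flat_iso K _ _ f' g').
Qed.

(** * Groebner bases with leading coefficients 1 *)

Section Groebner.
Variables (K : comNzRingType) (N : nat).
Implicit Types (I P : ideal {mpoly K[N]}) (f g : {mpoly K[N]}).

(** Only monic elements count: over a ring such as C[t] these are the ones by which one can always
    divide. *)
Definition lead_of I (m : 'X_{1..N}) :=
  exists g, [/\ I g, mleadc g = 1 & mlead g = m].

Lemma lead_ofS I m m' : lead_of I m -> (m <= m')%MM -> lead_of I m'.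
Proof.
move=> [g [Ig g1 <-]] gm'; exists ('X_[m' - mlead g] * g).
have nz : mleadc ('X_[m' - mlead g] : {mpoly K[N]}) * mleadc g != 0.
  by rewrite mleadXm mcoeffX eqxx mul1r g1 oner_eq0.
split; first exact: ideal_M.
- by rewrite mleadcM_proper // mleadXm mcoeffX eqxx g1 mul1r.
- by rewrite mleadM_proper // mleadXm submK.
Qed.

Lemma lead_ofM I f g : I (f * g) -> mleadc f = 1 -> mleadc g = 1 ->
  lead_of I (mlead f + mlead g)%MM.
Proof.
move=> Ifg f1 g1; have nz : mleadc f * mleadc g != 0 by rewrite f1 g1 mulr1 oner_eq0.
by exists (f * g); rewrite mleadcM_proper ?mleadM_proper // f1 g1 mulr1.
Qed.

Lemma mlead_subZ f g : f != 0 -> mlead g = mlead f -> mleadc g = 1 ->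
  let f' := f - mleadc f *: g in
  f' = 0 \/ (mlead f' < mlead f)%O.
Proof.
move=> f0 gf g1 f'; have [->|f'0] := eqVneq f' 0; [by left|right].
rewrite lt_neqAle; apply/andP; split.
  apply: contraNneq f'0 => e; rewrite -mleadc_eq0 e mcoeffB mcoeffZ -gf g1.
  by rewrite mulr1 gf subrr.
apply: le_trans (mleadB_le _ _) _; rewrite leUx lexx /= -gf.
exact: mleadZ_le.
Qed.

Definition groebner I := forall f, I f -> f != 0 -> lead_of I (mlead f).

(** Induction on the leading monomial: subtracting a multiple of a monic element of [I] with the
    same leading monomial stays in [P] and lowers it. *)
Lemma ideal_le_lead I P : ideal_le I P ->
  (forall f, P f -> f != 0 -> lead_of I (mlead f)) -> ideal_le P I.
Proof.
move=> IP leadP; elim/mleadrect => f IH Pf.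
have [->|f0] := eqVneq f 0; first exact: ideal_0.
have [g [Ig g1 gf]] := leadP f Pf f0.
have Icg : I (mleadc f *: g) by rewrite -mul_mpolyC; exact: ideal_M.
rewrite -[f](subrK (mleadc f *: g)); apply: ideal_D => //.
have [->|lt] := mlead_subZ f0 gf g1; first exact: ideal_0.
by apply: IH => //; apply: ideal_B => //; exact: IP.
Qed.

Lemma groebner_lead I P : ideal_le I P ->
  (forall f, P f -> f != 0 -> lead_of I (mlead f)) -> groebner I.
Proof. by move=> IP leadP f If; apply: leadP; exact: IP. Qed.

Definition standard I f := forall m, m \in msupp f -> ~ lead_of I m.

Lemma standard0 I : standard I 0.
Proof. by move=> m; rewrite msupp0. Qed.

Lemma standardD I f g : standard I f -> standard I g -> standard I (f + g).
Proof.
by move=> sf sg m /msuppD_le; rewrite mem_cat => /orP[/sf|/sg].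
Qed.

Lemma standardZ I c f : standard I f -> standard I (c *: f).
Proof. by move=> sf m /msuppZ_le /sf. Qed.

Lemma normal_formP I f : exists r, standard I r /\ I (f - r).
Proof.
elim/mleadrect: f => f IH.
have [->|f0] := eqVneq f 0.
  by exists 0; rewrite subr0; split; [exact: standard0|exact: ideal_0].
have [[g [Ig g1 gf]]|nlead] := pselect (lead_of I (mlead f)).
  have Icg : I (mleadc f *: g) by rewrite -mul_mpolyC; exact: ideal_M.
  have [e|/IH[r [sr Ir]]] := mlead_subZ f0 gf g1.
    exists 0; split; first exact: standard0.
    by move/eqP: e; rewrite subr_eq0 subr0 => /eqP->.
  exists r; split => //.
  by rewrite -[f](subrK (mleadc f *: g)) addrAC; exact: ideal_D.
(* No monic element of [I] has this leading monomial, so the leading term itself goes into the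
   remainder. *)
pose g : {mpoly K[N]} := 'X_[mlead f].
have sg : standard I (mleadc f *: g).
  by apply: standardZ => m; rewrite msuppX inE => /eqP->.
have gf : mlead g = mlead f by rewrite mleadXm.
have g1 : mleadc g = 1 by rewrite mleadXm mcoeffX eqxx.
have [e|/IH[r [sr Ir]]] := mlead_subZ f0 gf g1.
  by exists (mleadc f *: g); rewrite e; split=> //; exact: ideal_0.
exists (r + mleadc f *: g); split; first exact: standardD.
by rewrite opprD addrCA addrC.
Qed.

Definition normal_form I f := projT1 (cid (normal_formP I f)).

Lemma normal_form_standard I f : standard I (normal_form I f).
Proof. by rewrite /normal_form; case: cid => r []. Qed.

Lemma normal_form_congr I f : I (f - normal_form I f).
Proof. by rewrite /normal_form; case: cid => r []. Qed.

(** The difference of two remainders is standard and lies in [I]; if it were nonzero, its leading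
    monomial would contradict [groebner]. *)
Lemma normal_form_uniq I f r : groebner I ->
  standard I r -> I (f - r) -> normal_form I f = r.
Proof.
move=> gbI sr Ir; apply/eqP; rewrite -subr_eq0; apply: contraT => d0.
have Id : I (normal_form I f - r).
  have := ideal_B Ir (normal_form_congr I f).
  by rewrite opprB addrC addrA subrK.
have sd : standard I (normal_form I f - r).
  apply: standardD; first exact: normal_form_standard.
  by rewrite -scaleN1r; exact: standardZ.
by case: (sd _ (mlead_supp d0)); exact: gbI.
Qed.

Section Coordinates.
Variables (I : ideal {mpoly K[N]}) (gbI : groebner I).

Lemma normal_formP_linear c f g :
  normal_form I (c *: f + g) = c *: normal_form I f + normal_form I g.
Proof.
apply: normal_form_uniq => //.
  apply: standardD; last exact: normal_form_standard.
  exact/standardZ/normal_form_standard.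
rewrite opprD addrACA -scalerBr; apply: ideal_D; last exact: normal_form_congr.
rewrite -mul_mpolyC; exact/ideal_M/normal_form_congr.
Qed.

Lemma normal_form_eq f g : I (f - g) -> normal_form I f = normal_form I g.
Proof.
move=> Ifg; apply: normal_form_uniq => //; first exact: normal_form_standard.
by rewrite -[f](subrK g) -addrA; apply: ideal_D => //; exact: normal_form_congr.
Qed.

Definition quot_coord (m : 'X_{1..N}) (u : quot I) : K^o :=
  (normal_form I (repr u))@_m.

Fact quot_coord_is_linear m : linear (quot_coord m).
Proof.
move=> c u v; rewrite /quot_coord.
rewrite (normal_form_eq (g := c *: repr u + repr v)); last first.
  by apply/Defs.quotP; rewrite reprK quotD quotZ !reprK.
by rewrite normal_formP_linear mcoeffD mcoeffZ.
Qed.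

End Coordinates.

(** The standard monomials form a basis of the quotient, with the coefficients of the normal form as
    coordinates. The family used here runs through all monomials; those that are not standard get
    coordinate 0. *)
Lemma groebner_flat I : groebner I -> flat (quot I).
Proof.
move=> gbI.
pose c (m : 'X_{1..N}) : {linear quot I -> K^o} :=
  HB.pack (quot_coord m) (GRing.isLinear.Build K (quot I) K^o _
    (quot_coord m) (quot_coord_is_linear gbI m)).
refine (@dual_basis_flat K (quot I) _
  (fun d => [seq bmnm m | m : 'X_{1..N < d}])
  (fun m => \pi_(quot I) 'X_[m]) c _).
move=> u; exists (msize (normal_form I (repr u))) => d sd.
rewrite big_image /= -[LHS]reprK.
transitivity (\pi_(quot I) (normal_form I (repr u))).
  by apply/Defs.quotP; exact: normal_form_congr.
rewrite {1}(mpolywE sd); elim/big_rec2: _ => [|m x y _ <-]; first by [].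
by rewrite quotD quotZ.
Qed.

End Groebner.

(** * Change of the monomial order by an automorphism *)

Section Transport.
Variables (K : comNzRingType) (N : nat).
Variables (s u : {rmorphism {mpoly K[N]} -> {mpoly K[N]}}).
Hypotheses (sK : cancel s u) (uK : cancel u s) (uZ : scalable u).

(** The Groebner basis argument is applied to [comap u I], the image of [I] under [s], and its
    conclusions are carried back. *)
Lemma transport_lead (I P : ideal {mpoly K[N]}) : ideal_le I P ->
  (forall f, P f -> f != 0 -> lead_of (comap u I) (mlead (s f))) ->
  ideal_le P I /\ flat (quot I).
Proof.
move=> IP leadP.
have lead g : comap u P g -> g != 0 -> lead_of (comap u I) (mlead g).
  by move=> Pg g0; rewrite -(uK g); apply: leadP; rewrite // -(rmorph0 u) (can_eq uK).
have IP' : ideal_le (comap u I) (comap u P) by move=> g /IP.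
split=> [f Pf|].
  by rewrite -(sK f); apply: (ideal_le_lead IP' lead); rewrite /= sK.
have fl := groebner_flat (groebner_lead IP' lead).
apply: flat_quot_iso fl.
by apply: (quot_alg_isoP uZ sK) => x.
Qed.

Lemma transport_lead_of (I : ideal {mpoly K[N]}) f : I f -> mleadc (s f) = 1 ->
  lead_of (comap u I) (mlead (s f)).
Proof. by move=> If f1; exists (s f); split; rewrite //= sK. Qed.

Lemma transport_lead_ofM (I : ideal {mpoly K[N]}) f g : I (f * g) ->
  mleadc (s f) = 1 -> mleadc (s g) = 1 ->
  lead_of (comap u I) (mlead (s f) + mlead (s g))%MM.
Proof. by move=> Ifg f1 g1; apply: lead_ofM => //=; rewrite rmorphM !sK. Qed.

End Transport.

(** * Irreducible components *)

Section Components.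
Variables (T : Type) (closed : set (set T)).
Hypothesis closed0 : closed set0.
Hypothesis closedU : forall A B, closed A -> closed B -> closed (A `|` B).

Lemma irreducible_bigcup (I : eqType) (r : seq I) (X : I -> set T) Z :
  (forall i, closed (X i)) -> irreducible closed Z ->
  Z `<=` (fun t => exists2 i, i \in r & X i t) -> exists2 i, i \in r & Z `<=` X i.
Proof.
move=> cX [[t Zt] irrZ]; elim: r => [Zr|i r IH]; first by have [j] := Zr t Zt.
have cr : closed (fun t => exists2 i, i \in r & X i t).
  elim: (r) => [|j s IHs]; first by rewrite [X in closed X](_ : _ = set0) //
    -subset0 => u [].
  rewrite [X in closed X](_ : _ = X j `|` (fun t => exists2 i, i \in s & X i t)).
    exact: closedU.
  apply/seteqP; split=> u /=.
    by case=> k; rewrite inE => /predU1P[->|ks] ?; [left|right; exists k].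
  by case=> [?|[k ks ?]]; [exists j|exists k] => //; rewrite inE ?eqxx ?ks ?orbT.
move=> Zir; have := irrZ _ _ (cX i) cr; case.
- move=> u /Zir[k]; rewrite inE => /predU1P[->|kr] ?; first by left.
  by right; exists k.
- by exists i; rewrite ?inE ?eqxx.
- by move=> /IH[k kr Zk]; exists k; rewrite // inE kr orbT.
Qed.

(** An irreducible subset of [Y] lies in one of finitely many closed sets [X i], so a maximal one is
    some [X i]; as there are no inclusions among these, each of them is maximal. *)
Lemma irr_components_cover (I : finType) (S : pred I) (X : I -> set T) Y :
  (forall i, closed (X i)) -> (forall i, S i -> irreducible closed (X i)) ->
  (forall t, Y t <-> exists2 i, S i & X i t) ->
  (forall i j, S i -> S j -> X i `<=` X j -> i = j) ->
  irr_components closed Y = X @` [set` S].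
Proof.
move=> cX irrX YX Xinj.
have subY Z : Z `<=` Y -> irreducible closed Z -> exists2 i, S i & Z `<=` X i.
  move=> ZY /(irreducible_bigcup (r := enum S) cX) [t /ZY /YX[i Si Xi]|i].
    by exists i; rewrite ?mem_enum.
  by rewrite mem_enum; exists i.
have XY i : S i -> X i `<=` Y by move=> Si t Xt; apply/YX; exists i.
apply/seteqP; split=> Z.
  move=> [ZY irrZ maxZ]; have [i Si Zi] := subY Z ZY irrZ.
  by exists i => //; apply: maxZ => //; [exact: XY|exact: irrX].
move=> [i Si <-]; split; [exact: XY|exact: irrX|].
move=> Z' Z'Y irrZ' XZ'; have [j Sj Z'j] := subY Z' Z'Y irrZ'.
have ij : i = j by apply: Xinj => //; exact: subset_trans XZ' Z'j.
by apply/seteqP; split=> //; rewrite ij.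
Qed.

End Components.

Lemma image_set_bij (I T U : Type) (S : set I) (f : I -> T) (g : I -> U)
    (A : set T) (B : set U) :
  A = f @` S -> B = g @` S -> set_inj S f -> set_inj S g -> S !=set0 ->
  exists Phi : T -> U,
    [/\ set_bij A B Phi, forall i, S i -> Phi (f i) = g i
      & forall a, A a -> exists2 i, S i & a = f i].
Proof.
move=> -> -> finj ginj [i0 Si0].
(* Outside [A] the value is arbitrary; [g i0] is taken. *)
pose Phi a := if pselect (exists2 i, S i & f i = a) is left e
  then g (projT1 (cid2 e)) else g i0.
have PhiE i : S i -> Phi (f i) = g i.
  move=> Si; rewrite /Phi; case: pselect => [e|[]]; last by exists i.
  by case: cid2 => j Sj /= fji; congr g; apply: finj; rewrite ?inE.
exists Phi; split=> //; last by move=> _ [i Si <-]; exists i.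
split.
- by move=> _ [i Si <-]; exists i; rewrite ?PhiE.
- move=> _ _ /set_mem[i Si <-] /set_mem[j Sj <-]; rewrite !PhiE // => gij.
  by congr f; apply: ginj; rewrite ?inE.
- by move=> _ [i Si <-]; exists (f i); [exists i|rewrite PhiE].
Qed.

Section SpecComponents.
Variable A : comPzRingType.

Lemma zero_locus_irreducible (p : spec A) :
  irreducible (@spec_closed A) (zero_locus (spec_ideal p)).
Proof.
split; first by exists p.
move=> _ _ [S ->] [T ->] /(_ p)[//|pS|pT].
  by left=> q pq x /pS /pq.
by right=> q pq x /pT /pq.
Qed.

Lemma spec_closed0 : @spec_closed A set0.
Proof.
exists [set 1]; apply/esym/seteqP; split=> // p /(_ 1 erefl).
exact: spec_proper.
Qed.

Lemma spec_closedU (X Y : set (spec A)) :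
  spec_closed X -> spec_closed Y -> spec_closed (X `|` Y).
Proof. by move=> [S ->] [T ->]; rewrite zero_locusU; eexists. Qed.

Lemma irr_components_zero_locus (I : finType) (S : pred I) (p : I -> spec A)
    (J : ideal A) :
  (forall i, S i -> ideal_le J (p i)) ->
  (forall q : spec A, ideal_le J q -> exists2 i, S i & ideal_le (p i) q) ->
  (forall i j, S i -> S j -> ideal_le (p j) (p i) -> i = j) ->
  irr_components (@spec_closed A) (zero_locus J)
  = (fun i => zero_locus (p i)) @` [set` S].
Proof.
move=> Jp pJ pinj; apply: irr_components_cover.
- exact: spec_closed0.
- exact: spec_closedU.
- by move=> i; eexists.
- by move=> i _; exact: zero_locus_irreducible.
- move=> q; split=> [/pJ[i Si piq]|[i Si piq] x /(Jp i Si)]; last exact: piq.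
  by exists i.
- by move=> i j Si Sj /(_ (p i)) pij; apply: pinj => //; exact: pij.
Qed.

End SpecComponents.

(** * Evaluation of polynomials at matrices *)

Lemma mpoly_rmorph_eq (K : comNzRingType) (N : nat) (B : nzRingType)
    (F G : {rmorphism {mpoly K[N]} -> B}) :
  (forall c, F c%:MP = G c%:MP) -> (forall k, F 'X_k = G 'X_k) -> F =1 G.
Proof.
move=> FGc FGX f; rewrite (mpolyE f) !rmorph_sum; apply: eq_bigr => m _.
rewrite -mul_mpolyC !rmorphM FGc; congr (_ * _).
rewrite (mpolyXE_id _ m) !rmorph_prod; apply: eq_bigr => k _.
by rewrite !rmorphXn FGX.
Qed.

Section EvalMatrix.
Variables (K : comNzRingType) (n : nat).
Implicit Types f : {mpoly K[n * n]}.

Section Def.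
Variables (B : comNzRingType) (c : {rmorphism K -> B}) (M : 'M[B]_n).

Definition evmx : {mpoly K[n * n]} -> B := mmap c (fun k => mxvec M 0 k).

HB.instance Definition _ := GRing.RMorphism.copy evmx
  (mmap c (fun k => mxvec M 0 k)).

Lemma evmxC a : evmx a%:MP = c a.
Proof. exact: mmapC. Qed.

Lemma evmxZ a f : evmx (a *: f) = c a * evmx f.
Proof. exact: mmapZ. Qed.

Lemma evmx_generic : map_mx evmx (generic_mx K n) = M.
Proof.
by apply/matrixP => i j; rewrite !mxE /evmx mmapX mmap1U mxvecE.
Qed.

Lemma evmxX i j : evmx 'X_(mxvec_index i j) = M i j.
Proof. by rewrite -evmx_generic !mxE. Qed.

End Def.

Lemma evmx_uniq (B : comNzRingType) (c : {rmorphism K -> B}) (M : 'M[B]_n)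
    (F : {rmorphism {mpoly K[n * n]} -> B}) :
  (forall a, F a%:MP = c a) -> map_mx F (generic_mx K n) = M ->
  F =1 evmx c M.
Proof.
move=> Fc FM; apply: mpoly_rmorph_eq => [a|k]; first by rewrite Fc; exact/esym/evmxC.
case/mxvec_indexP: k => i j; apply: etrans (esym (evmxX c M i j)).
by rewrite -FM !mxE.
Qed.

Lemma evmx_comp (B C : comNzRingType) (c : {rmorphism K -> B}) (M : 'M[B]_n)
    (g : {rmorphism B -> C}) (d : {rmorphism K -> C}) f :
  g \o c =1 d -> g (evmx c M f) = evmx d (map_mx g M) f.
Proof.
move=> gcd; apply: (evmx_uniq (F := g \o evmx c M)) => [a|].
  by rewrite /= evmxC -gcd.
by rewrite map_mx_comp evmx_generic.
Qed.

Lemma evmx_meval (M : 'M[K]_n) f : evmx idfun M f = f.@[mxvec M 0].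
Proof. by []. Qed.

End EvalMatrix.

(** * Points of the components over rational functions *)

Section FractionLead.
Variables (K : idomainType) (N : nat).
Local Notation R := {mpoly K[N]}.
Local Notation F := {fraction R}.
Local Notation "x %:Fr" := (@tofrac R x) (at level 2).
Implicit Types (x y : F) (m : 'X_{1..N}) (c d : K).

(* The rational function [x] has leading monomial at most [m], and [c] is its
   coefficient at [m]. *)
Definition frac_lead x m c := exists a b : R,
  [/\ b != 0, x * b%:Fr = a%:Fr, (mlead a <= (m + mlead b)%MM)%O
    & a@_(m + mlead b) = c * mleadc b].

Lemma frac_lead_poly (a : R) m : (mlead a <= m)%O -> frac_lead a%:Fr m a@_m.
Proof.
move=> am; exists a, 1; rewrite oner_eq0 mleadc1 mlead1 addm0 !mulr1.
by split; rewrite // ?tofrac1 ?mulr1.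
Qed.

Lemma frac_leadD x y m c d :
  frac_lead x m c -> frac_lead y m d -> frac_lead (x + y) m (c + d).
Proof.
move=> [a [b [b0 xb lb cb]]] [a' [b' [b'0 yb lb' cb']]].
have mb : mlead (b * b') = (mlead b + mlead b')%MM by rewrite mleadM.
have mA : (m + mlead (b * b') = m + mlead b + mlead b')%MM by rewrite mb addmA.
have mA' : (m + mlead (b * b') = m + mlead b' + mlead b)%MM.
  by rewrite mA -!addmA [(mlead b + _)%MM]addmC.
exists (a * b' + a' * b), (b * b'); split.
- by rewrite mulf_neq0.
- rewrite tofracD !tofracM -xb -yb mulrDl mulrA; congr (_ + _).
  by rewrite mulrA mulrAC.
- apply: le_trans (mleadD_le _ _) _; rewrite leUx; apply/andP; split.
    by apply: le_trans (mleadM_le _ _) _; rewrite mA lem_add.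
  by apply: le_trans (mleadM_le _ _) _; rewrite mA' lem_add.
- rewrite mcoeffD {1}mA mA' (mleadcMW lb (lexx _)) (mleadcMW lb' (lexx _)).
  rewrite cb cb' mb mleadcM mulrDl !mulrA.
  by congr (_ + _); rewrite mulrAC.
Qed.

Lemma frac_leadM x y m m' c d :
  frac_lead x m c -> frac_lead y m' d -> frac_lead (x * y) (m + m')%MM (c * d).
Proof.
move=> [a [b [b0 xb lb cb]]] [a' [b' [b'0 yb lb' cb']]].
have mb : mlead (b * b') = (mlead b + mlead b')%MM by rewrite mleadM.
have mA : (m + m' + mlead (b * b') = m + mlead b + (m' + mlead b'))%MM.
  by rewrite mb !addmA; congr (_ + _)%MM; rewrite -!addmA [(m' + _)%MM]addmC.
exists (a * a'), (b * b'); split.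
- by rewrite mulf_neq0.
- by rewrite !tofracM -xb -yb mulrACA.
- by rewrite mA; apply: le_trans (mleadM_le _ _) _; rewrite lem_add.
- by rewrite mA (mleadcMW lb lb') cb cb' mb mleadcM mulrACA.
Qed.

Lemma frac_lead_lt x m m' c : frac_lead x m c -> (m < m')%O -> frac_lead x m' 0.
Proof.
move=> [a [b [b0 xb lb cb]]] mm'; exists a, b.
have lt : (mlead a < (m' + mlead b)%MM)%O.
  by apply: le_lt_trans lb _; rewrite ltmc_add2l.
by split=> //; [exact: ltW|rewrite mul0r mcoeff_gt_mlead].
Qed.

Lemma frac_lead0 m c : frac_lead 0 m c -> c = 0.
Proof.
move=> [a [b [b0]]]; rewrite mul0r => /esym/eqP; rewrite tofrac_eq0 => /eqP->.
rewrite mcoeff0 => _ /esym/eqP; rewrite mulf_eq0 mleadc_eq0 (negPf b0) orbF.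
by move/eqP.
Qed.

Lemma frac_leadX x m c k : frac_lead x m c -> frac_lead (x ^+ k) (m *+ k)%MM (c ^+ k).
Proof.
move=> xm; elim: k => [|k IH].
  by rewrite mulm0n !expr0; have := @frac_lead_poly 1 0%MM; rewrite mlead1 tofrac1
    mcoeff1 eqxx; apply.
by rewrite mulmS !exprS; exact: frac_leadM.
Qed.

(** If each variable is replaced by a function whose leading monomial is at most that variable,
    every term of [g] keeps its monomial as an upper bound. So only the leading term contributes at
    [mlead g], and its coefficient is multiplied by powers of the [c k] of the variables occurring
    in it. *)
Lemma frac_lead_mmap (g : R) (s : 'I_N -> F) (c : 'I_N -> K) : g != 0 ->
  (forall k, frac_lead (s k) U_(k)%MM (c k)) ->
  (forall k, mlead g k != 0%N -> c k != 0) ->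
  mmap (@tofrac R \o @mpolyC N K) s g != 0.
Proof.
move=> g0 sc c0.
have lead1 m : frac_lead (mmap1 s m) m (\prod_k c k ^+ m k).
  rewrite {2}[m]multinomUE_id /mmap1.
  elim/big_rec3: _ => [|k x m' y _ IH].
    by have := @frac_lead_poly 1 0%MM; rewrite mlead1 tofrac1 mcoeff1 eqxx; apply.
  by apply: frac_leadM => //; exact: frac_leadX.
have leadT m : frac_lead ((@tofrac R \o @mpolyC N K) g@_m * mmap1 s m) m
    (g@_m * \prod_k c k ^+ m k).
  rewrite -[X in frac_lead _ X]add0m; apply: frac_leadM => //.
  have := @frac_lead_poly (g@_m)%:MP 0%MM; rewrite mleadC mcoeffC eqxx mulr1; apply.
  exact: lexx.
suff : frac_lead (mmap (@tofrac R \o @mpolyC N K) s g) (mlead g)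
    (mleadc g * \prod_k c k ^+ mlead g k).
  move=> fl; apply/eqP => e; move: fl; rewrite e => /frac_lead0/eqP.
  rewrite mulf_eq0 mleadc_eq0 (negPf g0) /=; apply/negP/prodf_neq0 => k _.
  by have [->|/c0 ck] := eqVneq (mlead g k) 0%N; rewrite ?expr0 ?oner_eq0 ?expf_neq0.
have low m : m \in msupp g -> m != mlead g ->
    frac_lead ((@tofrac R \o @mpolyC N K) g@_m * mmap1 s m) (mlead g) 0.
  move=> mg ne; apply: frac_lead_lt (leadT m) _.
  by rewrite lt_neqAle ne msupp_le_mlead.
rewrite /mmap (bigD1_seq (mlead g)) ?mlead_supp ?msupp_uniq //=.
rewrite -[X in frac_lead _ _ X]addr0; apply: frac_leadD; first exact: leadT.
rewrite big_seq_cond; elim/big_rec: _ => [|m x /andP[mg ne] IH].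
  have := @frac_lead_poly 0 (mlead g); rewrite mlead0 le0x tofrac0 mcoeff0.
  by apply.
by rewrite -[X in frac_lead _ _ X]addr0; apply: frac_leadD => //; exact: low.
Qed.

End FractionLead.

(** * Diagonals in 0-1 matrices and the order of the variables *)

Lemma sorted_ltn_succ (a : seq nat) : sorted ltn [seq x.+1 | x <- a] = sorted ltn a.
Proof. by rewrite sorted_map. Qed.

Lemma sorted_ltn_cons0 (a : seq nat) :
  sorted ltn (0%N :: [seq x.+1 | x <- a]) = sorted ltn a.
Proof.
rewrite -[RHS]sorted_ltn_succ /=; case: a => //= x a.
Qed.

Lemma size_sorted_ltn (a : seq nat) N :
  sorted ltn a -> all (fun x => x < N)%N a -> (size a <= N)%N.
Proof.
move=> sa /allP aN; rewrite -(size_iota 0 N); apply: uniq_leq_size.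
  by apply: sorted_uniq sa; [exact: ltn_trans|exact: ltnn].
by move=> x /aN; rewrite mem_iota.
Qed.

(* A 0-1 matrix [s] with [N] rows and no [1]'s in the positions of a diagonal
   [(c_0, 0), ..., (c_q, q)], [c_0 < ... < c_q], is covered by [q] full rows
   and one zero in each other row. *)
Lemma avoid_diagonal (s : nat -> nat -> bool) (N q : nat) : (q <= N)%N ->
  (forall c : seq nat, sorted ltn c -> all (fun x => x < N)%N c ->
     size c = q.+1 -> ~ forall l, (l < q.+1)%N -> s (nth 0%N c l) l) ->
  exists a : seq nat, [/\ sorted ltn a, all (fun x => x < N)%N a, size a = q
    & forall r, (r < N)%N -> r \notin a ->
        ~~ s r (count (fun x => x < r)%N a)].
Proof.
elim: N s q => [|N IH] s q.
  by rewrite leqn0 => /eqP-> _; exists [::]; split.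
(* Row 0 is prepended to a solution for the other [N] rows; [b] tells whether it is among the full
   rows, in which case the columns move by one as well. *)
have shift (t : nat -> nat -> bool) (a : seq nat) (b : bool) :
    (forall r, (r < N)%N -> r \notin a ->
       ~~ t r.+1 (b + count (fun x => x < r)%N a)%N) -> b || ~~ t 0%N 0%N ->
    forall r, (r < N.+1)%N -> r \notin nseq b 0%N ++ [seq x.+1 | x <- a] ->
       ~~ t r (count (fun x => x < r)%N (nseq b 0%N ++ [seq x.+1 | x <- a])).
  move=> ta t0 [_|r rN]; rewrite mem_cat negb_or count_cat => /andP[b0 ra].
    move: b0 t0; case: b {ta} => //= _; rewrite count_map.
    by rewrite (eq_count (a2 := pred0)) ?count_pred0.
  rewrite mem_map in ra; last exact: succn_inj.
  by rewrite count_nseq mul1n count_map; exact: ta.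
(* If the entry (0, 0) vanishes, row 0 can be left out of [a]: its prescribed zero is the one in
   column 0. *)
have diag0 : (q <= N)%N -> (forall c : seq nat, sorted ltn c ->
      all (fun x => x < N.+1)%N c -> size c = q.+1 ->
      ~ forall l, (l < q.+1)%N -> s (nth 0%N c l) l) ->
    ~~ s 0%N 0%N -> exists a : seq nat, [/\ sorted ltn a,
      all (fun x => x < N.+1)%N a, size a = q & forall r, (r < N.+1)%N ->
      r \notin a -> ~~ s r (count (fun x => x < r)%N a)].
  move=> qN nodiag s00.
  have [c sc cN szc diag|a [sa aN sza as_]] := IH (fun r j => s r.+1 j) q qN.
    apply: (nodiag [seq x.+1 | x <- c]); rewrite ?sorted_ltn_succ ?all_map ?size_map //.
    by move=> l lq; rewrite (nth_map 0%N) ?szc //; exact: diag.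
  exists [seq x.+1 | x <- a]; rewrite sorted_ltn_succ all_map size_map; split=> //.
  exact: (shift s a false).
case: q diag0 => [|q] diag0 qN nodiag.
  apply: diag0 => //; apply/negP => s00.
  by apply: (nodiag [:: 0%N]) => // -[|].
have [s00|s00] := boolP (s 0%N 0%N || (q == N)); last first.
  move: s00; rewrite negb_or => /andP[s00 qN']; apply: diag0 => //.
  by rewrite ltn_neqAle qN'.
(* Now row 0 is taken as a full row, and row 0 and column 0 are deleted. If [s 0 0] holds, a
   diagonal of the rest would extend by (0, 0); if [q = N], too few rows are left for a diagonal. *)
have [c sc cN szc diag|a [sa aN sza as_]] := IH (fun r j => s r.+1 j.+1) q qN.
  case/orP: s00 => [s00|/eqP qN'].
    apply: (nodiag (0%N :: [seq x.+1 | x <- c])).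
    - by rewrite sorted_ltn_cons0.
    - by rewrite /= all_map.
    - by rewrite /= size_map szc.
    - by move=> [|l] //= lq; rewrite (nth_map 0%N) ?szc //; exact: diag.
  by have := size_sorted_ltn sc cN; rewrite szc qN' ltnn.
exists (0%N :: [seq x.+1 | x <- a]); split.
- by rewrite sorted_ltn_cons0.
- by rewrite /= all_map.
- by rewrite /= size_map sza.
- exact: (shift s a true).
Qed.

Section VariableOrder.
Variable n' : nat.
Local Notation n := n'.+2.
Implicit Types (r s c j : nat).

Fact var_proof (s c : 'I_n) : (s * n + c < n * n)%N.
Proof.
by apply: leq_trans (_ : s.+1 * n <= _)%N; rewrite ?leq_mul2r ?ltn_ord ?orbT //
  mulSn addnC ltn_add2r.
Qed.

(* Row-major numbering: since ['X_0] is the largest variable, the diagonal term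
   of a minor is its leading term. *)
Definition var (s c : 'I_n) : 'I_(n * n) := Ordinal (var_proof s c).

Definition varU s c : 'X_{1.. n * n} := U_(var (inord s) (inord c))%MM.

Lemma var_lt (s s' c c' : 'I_n) :
  (var s c < var s' c')%N = (s < s')%N || (s == s') && (c < c')%N.
Proof.
rewrite /=; case: (ltngtP s s') => [lt|lt|/val_inj ->]; last first.
- by rewrite ltn_add2l eqxx.
- have [e|_] := eqVneq s s'; first by rewrite e ltnn in lt.
  apply/negbTE; rewrite -leqNgt.
  apply: leq_trans (_ : s'.+1 * n <= _)%N.
    by rewrite mulSn addnC leq_add2r ltnW.
  by rewrite (leq_trans _ (leq_addr _ _)) // leq_mul2r lt orbT.
- apply: leq_trans (_ : s.+1 * n <= _)%N; first by rewrite mulSn addnC ltn_add2r.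
  by rewrite (leq_trans _ (leq_addr _ _)) // leq_mul2r lt orbT.
Qed.

Lemma var_inj (s s' c c' : 'I_n) : var s c = var s' c' -> s = s' /\ c = c'.
Proof.
move=> e; have := var_lt s s' c c'; have := var_lt s' s c' c.
rewrite e ltnn => /esym/negbT; rewrite negb_or -leqNgt => /andP[s1 c1].
move/esym/negbT; rewrite negb_or -leqNgt => /andP[s2 c2].
have es : s = s' by apply/val_inj/eqP; rewrite eqn_leq s1 s2.
move: c1 c2; rewrite es eqxx /= -!leqNgt => c1 c2.
by split=> //; apply/val_inj/eqP; rewrite eqn_leq c1 c2.
Qed.

Lemma var_eq (s s' c c' : 'I_n) :
  (var s c == var s' c') = (s == s') && (c == c').
Proof. by apply/eqP/andP => [/var_inj[-> ->]//|[/eqP-> /eqP->]]. Qed.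

Lemma varP (k : 'I_(n * n)) : {sc : 'I_n * 'I_n | k = var sc.1 sc.2}.
Proof.
have kn : (k %/ n < n)%N by rewrite ltn_divLR.
have rn : (k %% n < n)%N by rewrite ltn_mod.
by exists (Ordinal kn, Ordinal rn); apply/val_inj; rewrite /= -divn_eq.
Qed.

Definition unvar (k : 'I_(n * n)) : 'I_n * 'I_n := projT1 (varP k).

Lemma unvarK k : var (unvar k).1 (unvar k).2 = k.
Proof. by rewrite /unvar; case: varP => sc /= ->. Qed.

Lemma varK (s c : 'I_n) : unvar (var s c) = (s, c).
Proof.
have /var_inj[] := unvarK (var s c).
by case: (unvar _) => a b /= -> ->.
Qed.

(** The degrees agree, and the largest of the four variables, the one at [(b, c)], occurs on the
    right only. *)
Lemma U_exchange b r c c' : (b < r)%N -> (r < n)%N -> (c < c')%N -> (c' < n)%N ->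
  ((varU b c' + varU r c)%MM < (varU b c + varU r c')%MM)%O.
Proof.
move=> br rn cc cn; have bn := ltn_trans br rn; have cn' := ltn_trans cc cn.
apply/ltmcP; first by rewrite !mdegD !mdeg1.
exists (var (inord b) (inord c)) => [k|].
  rewrite -(unvarK k); case: (unvar k) => s d {k}.
  rewrite !mnmDE !mnm1E var_lt !var_eq /= => lt.
  have ne (r' c1 : nat) : (b <= r')%N -> (r' < n)%N -> (c1 < n)%N ->
      (b == r') ==> (c <= c1)%N ->
      ((inord r' : 'I_n) == s) && ((inord c1 : 'I_n) == d) = false.
    move=> br' r'n c1n cc1; apply/negbTE/negP => /andP[/eqP es /eqP ed].
    move: lt; rewrite -es -ed -(inj_eq val_inj) /= !inordK //.
    rewrite [(r' < b)%N]ltnNge br' /= eq_sym => /andP[/eqP e]; move: cc1.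
    by rewrite e eqxx /= ltnNge => ->.
  by rewrite !ne ?eqxx ?(ltn_eqF br) ?(ltnW br) ?leqnn ?(ltnW cc).
rewrite !mnmDE !mnm1E !var_eq !eqxx /= -!(inj_eq val_inj) /= !inordK //.
by rewrite (gtn_eqF br) (gtn_eqF cc).
Qed.

End VariableOrder.

Lemma nth_lt_count (a : seq nat) l r : sorted ltn a -> (l < size a)%N ->
  (nth 0%N a l < r)%N = (l < count (fun x => x < r)%N a)%N.
Proof.
elim: a l => // x a IH l /= xa; have sa := path_sorted xa.
have [xr|rx] := ltnP x r; first by case: l => [|l] //= la; rewrite ltnS -IH.
rewrite add0n (eq_in_count (a2 := pred0)) => [|y ya]; last first.
  have /allP/(_ y ya) xy := order_path_min ltn_trans xa.
  by rewrite ltnNge (leq_trans rx) // ltnW.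
rewrite count_pred0.
case: l => [|l] /= la; rewrite ltn0; apply/negbTE; rewrite -leqNgt //.
have /allP/(_ _ (mem_nth 0%N la)) xy := order_path_min ltn_trans xa.
by rewrite (leq_trans rx) // ltnW.
Qed.

(** * A point over rational functions at which a given leading term survives *)

Section DiagonalPoint.
Variables (K : idomainType) (n' : nat) (tau : K).
Local Notation n := n'.+2.
Local Notation R := {mpoly K[n * n]}.
Local Notation F := {fraction R}.
Local Notation "x %:F" := (@tofrac R x).
Local Notation U := (@varU n').

Section Weights.
Variables (q : nat) (a : seq nat).
Hypotheses (qn : (q < n)%N) (sa : sorted ltn a) (an : all (fun x => x < n'.+1)%N a).
Hypothesis (sza : size a = q).

Let k r := count (fun x => x < r)%N a.

(** The diagonal monomial of the minor on the rows [a] and the columns [0, ..., q] other than [j].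
    By Cramer's rule these minors, with alternating signs, form the linear relation between the
    columns in the rows [a]; the weights used below are their leading terms. *)
Definition mu j : 'X_{1.. n * n} :=
  (\sum_(l < q) U (nth 0%N a l) (l + (j <= l)))%MM.

Lemma mu_step j : (j < q)%N ->
  (mu j + U (nth 0%N a j) j = mu j.+1 + U (nth 0%N a j) j.+1)%MM.
Proof.
move=> jq; rewrite /mu (bigD1 (Ordinal jq)) //= [in RHS](bigD1 (Ordinal jq)) //=.
rewrite leqnn ltnn addn1 addn0.
rewrite addmC -[RHS]addmA; congr (_ + _)%MM; rewrite addmC; congr (_ + _)%MM.
apply: eq_bigr => l; rewrite -(inj_eq val_inj) /= => lj.
by rewrite (leq_eqVlt j) eq_sym (negPf lj).
Qed.

(** The monomial of [w_j X_(r, j)]. From [j] to [j + 1] it increases if [a_j < r], is unchanged if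
    [a_j = r] and decreases if [a_j > r]. So it is maximal at [k r], and for [r] in [a] also at
    [k r + 1]. *)
Definition nu r j := (mu j + U r j)%MM.

(** Multiplication by the variable at [(a_j, j)] leaves a common factor and the two products
    compared in [U_exchange]. *)
Let nu_stepE r j : (j < q)%N ->
  (nu r j + U (nth 0%N a j) j = mu j.+1 + (U (nth 0%N a j) j.+1 + U r j))%MM /\
  (nu r j.+1 + U (nth 0%N a j) j = mu j.+1 + (U (nth 0%N a j) j + U r j.+1))%MM.
Proof.
move=> jq; split; rewrite /nu; last by rewrite -!addmA [(U r _ + _)%MM]addmC.
by rewrite -addmA [(U r j + _)%MM]addmC addmA mu_step // -addmA.
Qed.

Lemma nu_inc r j : (r < n)%N -> (j < q)%N -> (nth 0%N a j < r)%N -> (nu r j < nu r j.+1)%O.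
Proof.
move=> rn jq jr; rewrite -(ltmc_add2l _ _ (U (nth 0%N a j) j)).
have [-> ->] := nu_stepE r jq; rewrite ltmc_add2r.
by apply: U_exchange => //; exact: leq_ltn_trans qn.
Qed.

Lemma nu_dec r j : (j < q)%N -> (r < nth 0%N a j)%N -> (nu r j.+1 < nu r j)%O.
Proof.
move=> jq jr; rewrite -(ltmc_add2l _ _ (U (nth 0%N a j) j)).
have [-> ->] := nu_stepE r jq; rewrite ltmc_add2r addmC [X in (_ < X)%O]addmC.
apply: U_exchange => //; last exact: leq_ltn_trans qn.
by apply: leq_trans (_ : n'.+1 <= _)%N => //; apply: (allP an); rewrite mem_nth ?sza.
Qed.

Lemma nu_below r j : (r < n)%N -> (j < k r)%N -> (nu r j < nu r (k r))%O.
Proof.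
move=> rn; rewrite -{1}/(k r).
have kq : (k r <= q)%N by rewrite -sza count_size.
suff H m : (j < m)%N -> (m <= k r)%N -> (nu r j < nu r m)%O by move=> /H; exact.
elim: m => // m IH; rewrite ltnS leq_eqVlt => jm mk.
have lt : (nu r m < nu r m.+1)%O.
  apply: nu_inc => //; first exact: leq_trans kq.
  by rewrite nth_lt_count // sza (leq_trans mk kq).
case/predU1P: jm => [-> //|jm]; apply: lt_trans lt.
by apply: IH => //; exact: ltnW.
Qed.

Lemma nu_above r m j : (forall l, (m <= l < q)%N -> (r < nth 0%N a l)%N) ->
  (m < j <= q)%N -> (nu r j < nu r m)%O.
Proof.
move=> ra; elim: j => // j IH; rewrite ltnS => /andP[mj jq].
have lt : (nu r j.+1 < nu r j)%O by apply: nu_dec => //; apply: ra; rewrite mj.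
move: mj; rewrite leq_eqVlt => /predU1P[-> //|mj]; apply: lt_trans lt _.
by apply: IH; rewrite mj ltnW.
Qed.

Lemma nu_nonpivot r j : (r < n)%N -> r \notin a -> (j <= q)%N -> j != k r ->
  (nu r j < nu r (k r))%O.
Proof.
move=> rn ra jq; rewrite neq_ltn => /orP[|kj]; first exact: nu_below.
apply: nu_above => [l /andP[kl lq]|]; last by rewrite kj.
rewrite ltn_neqAle leqNgt nth_lt_count ?sza // -leqNgt kl andbT.
by apply: contraNneq ra => ->; rewrite mem_nth // sza.
Qed.

Lemma nth_pivot r : r \in a -> (k r < q)%N /\ nth 0%N a (k r) = r.
Proof.
move=> ra; have ir : (index r a < size a)%N by rewrite index_mem.
suff -> : k r = index r a by rewrite nth_index // -{1}sza.
apply/eqP; rewrite eqn_leq leqNgt -nth_lt_count // nth_index // ltnn /=.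
rewrite leqNgt; apply/negP => lt.
have := nth_lt_count r sa (ltn_trans lt ir); rewrite -/(k r) ltnn -{2}(nth_index 0%N ra).
by rewrite (sorted_ltn_nth ltn_trans) // inE // (ltn_trans lt).
Qed.

Lemma nu_pivot r j : (r < n)%N -> r \in a -> (j <= q)%N -> j != k r ->
  j != (k r).+1 -> (nu r j < nu r (k r))%O.
Proof.
move=> rn ra jq; have [kq ak] := nth_pivot ra.
rewrite neq_ltn => /orP[jk _|kj jk']; first exact: nu_below.
have jk : ((k r).+1 < j)%N by rewrite ltn_neqAle eq_sym jk'.
have -> : nu r (k r) = nu r (k r).+1 by rewrite /nu -{2}ak mu_step // ak.
apply: nu_above; last by rewrite jk.
move=> l /andP[kl lq]; rewrite -{1}ak.
by apply: (sorted_ltn_nth ltn_trans) => //; rewrite inE sza.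
Qed.

End Weights.

(* [T] is the generic matrix, with the entries [(n', c)], [c < p], and the entries
   [(s, k s)] solved for, where [k s] counts the elements of [a] below [s]. The
   weights [w_j = (-1)^j X^(mu_j)] are such that the term [w_(k s) X_(s, k s)]
   dominates its row; in the rows [s] of [a] it is cancelled by the next term, so
   that [T_(s, k s)] can keep [X_(s, k s)] as leading term. In the other rows the
   variable [X_(s, k s)] does not occur in the leading monomial of [g]. *)
Lemma diagonal_point (g : R) (p q : nat) : (p < q)%N -> (q < n)%N -> g != 0 ->
  (forall c, (c < p)%N -> mlead g (var (inord n') (inord c)) = 0%N) ->
  (forall c : seq nat, sorted ltn c -> all (fun x => x < n'.+1)%N c ->
     size c = q.+1 -> ~ forall l, (l < q.+1)%N ->
     mlead g (var (inord (nth 0%N c l)) (inord l)) != 0%N) ->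
  exists (T : nat -> nat -> F) (w : nat -> F),
    [/\ mmap (@tofrac R \o @mpolyC _ K) (fun k => T (unvar k).1 (unvar k).2) g != 0,
        forall c, (c < p)%N -> T n' c = - (tau%:MP : R)%:F * T n'.+1 c,
        forall s, (s < n'.+1)%N -> \sum_(j < q.+1) w j * T s j = 0
      & w q != 0].
Proof.
move=> pq qn g0 yg nodiag.
have [a [sa an sza az]] := avoid_diagonal (N := n'.+1) (q := q)
  (s := fun r l => mlead g (var (inord r) (inord l)) != 0%N) qn nodiag.
pose k s := count (fun x => x < s)%N a.
have kq s : (k s <= q)%N by rewrite -sza count_size.
pose X s c : R := 'X_(var (inord s) (inord c)).
(* Row [n'] stands for the last row of the matrix and row [n'.+1] for the first one; the entries
   with [c < p] make the forms [ell] vanish. *)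
pose base s c : R := if (s == n') && (c < p)%N then - tau *: X n'.+1 c else X s c.
pose wp j : R := (-1) ^+ j *: 'X_[mu q a j].
have wpE j : mlead (wp j) = mu q a j /\ mleadc (wp j) = (-1) ^+ j.
  have e : mlead (wp j) = mu q a j by rewrite mleadZ ?signr_eq0 // mleadXm.
  by rewrite e /wp mcoeffZ mcoeffX eqxx mulr1.
have wp0 j : wp j != 0 by rewrite -mleadc_eq0 (wpE j).2 signr_eq0.
pose w j : F := (wp j)%:F.
have w0 j : w j != 0 by rewrite tofrac_eq0.
(* The terms of the relation in row [s] to be compensated by the entry [(s, k s)]: all but the
   dominant one and, for [s] in [a], the next one, which cancels it. *)
pose others s := \sum_(j < q.+1 | (j != k s :> nat) &&
   ~~ ((s \in a) && (j == (k s).+1 :> nat))) wp j * base s j.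
pose T s c : F := if (s < n'.+1)%N && (c == k s)
  then (if s \in a then (X s c)%:F else 0) - (others s)%:F / w c
  else (base s c)%:F.
have lead_base s c : (s < n)%N -> (c < n)%N -> (mlead (base s c) <= U s c)%O.
  move=> sn cn; rewrite /base; case: ifP => [/andP[/eqP-> _]|_]; last first.
    by rewrite mleadXm.
  apply: le_trans (mleadZ_le _ _) _; rewrite mleadXm; apply: ltW.
  apply/ltmcP; first by rewrite !mdeg1.
  exists (var (inord n') (inord c)) => [v|].
    rewrite -(unvarK v); case: (unvar v) => s' d {v}.
    rewrite !mnm1E var_lt !var_eq -!(inj_eq val_inj) /= !inordK //.
    case/orP=> [lt|/andP[/eqP-> lt]].
      by rewrite (gtn_eqF (ltn_trans lt (ltnSn _))) (gtn_eqF lt).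
    by rewrite (gtn_eqF (ltnSn _)) (gtn_eqF lt) !andbF.
  rewrite !mnm1E !var_eq -!(inj_eq val_inj) /= !inordK // !eqxx.
  by rewrite (gtn_eqF (ltnSn _)).
have aN s : s \in a -> (s < n'.+1)%N by move/(allP an).
have aq s l : s \in a -> (k s < l <= q)%N -> s = n' -> l = q.
  move=> sA /andP[kl lq] sn; have [kq' ak] := nth_pivot sa sza sA.
  apply/eqP; rewrite eqn_leq lq leqNgt; apply/negP => lq'.
  have : (nth 0%N a (k s) < nth 0%N a l)%N.
    by apply: (sorted_ltn_nth ltn_trans) => //; rewrite inE sza.
  rewrite ak sn ltnNge -ltnS; case/negP.
  by apply: (allP an); rewrite mem_nth ?sza.
(* If [n'] occurs in [a], it is the last element, so [k n'] is [q - 1] or [q]. Hence the entry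
   solved for in row [n'] is not one of the first [p]. *)
have kp : (p <= k n')%N.
  have [nA|nA] := boolP (n' \in a).
    rewrite -ltnS; apply: leq_trans pq _; rewrite leqNgt; apply/negP => kq'.
    by have := aq n' (k n').+1 nA; rewrite ltnSn ltnW // => /(_ isT erefl) e;
      rewrite e ltnn in kq'.
  suff -> : k n' = q by exact: ltnW.
  rewrite -sza; apply/eqP; rewrite -all_count; apply/allP => x xa.
  rewrite ltn_neqAle -ltnS aN // andbT; by apply: contraNneq nA => <-.
have lead_other s : (s < n'.+1)%N ->
    (mlead (others s) < (U s (k s) + mlead (wp (k s)))%MM)%O.
  move=> sn; rewrite (wpE (k s)).1 addmC /others.
  elim/big_ind: _ => [|x y xlt ylt|j /andP[jk jk']].
  - by rewrite mlead0 lt_mdeg_ltmc // mdeg0 mdegD mdeg1 addn1.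
  - by apply: le_lt_trans (mleadD_le _ _) _; rewrite ltUx xlt.
  apply: le_lt_trans (mleadM_le _ _) _; rewrite (wpE j).1.
  apply: (@le_lt_trans _ _ (nu q a s j)).
    rewrite lem_add // lead_base //; first exact: ltnW.
    by rewrite (leq_trans _ qn).
  have sn' : (s < n)%N by exact: ltnW.
  have jq : (j <= q)%N by rewrite -ltnS.
  have [sA|sA] := boolP (s \in a); last exact: nu_nonpivot.
  by rewrite sA in jk'; exact: nu_pivot.
exists T, w; split=> //.
- suff /choice[c cP] : forall v, exists c, frac_lead (T (unvar v).1 (unvar v).2) U_(v) c /\
      (mlead g v != 0%N -> c != 0).
    by apply: (frac_lead_mmap (c := c) g0) => v; case: (cP v).
  move=> v; rewrite -(unvarK v); case: (unvar v) => s c {v}; rewrite varK /=.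
  have -> : U_(var s c)%MM = U s c by rewrite /varU !inord_val.
  rewrite /T; case: ifP => [/andP[sn /eqP ck]|nk].
    have lo : frac_lead (- (others s)%:F / w c) (U s c) 0.
      exists (- others s), (wp c); split=> //.
      + by rewrite mulrVK ?unitfE ?w0 // tofracN.
      + by rewrite mleadN ltW // ck lead_other.
      + by rewrite mul0r mcoeffN ck mcoeff_gt_mlead ?oppr0 // lead_other.
    rewrite -mulNr; case: ifP => sA.
      exists 1; split; last by rewrite oner_eq0.
      rewrite -[1]addr0; apply: frac_leadD => //.
      have := @frac_lead_poly K _ (X s c) (U s c); rewrite mleadXm lexx mcoeffX eqxx.
      by apply.
    (* The coefficient 0 is harmless: by the choice of [a] this variable is absent from
       [mlead g]. *)
    exists 0; rewrite add0r; split=> //.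
    have := az s sn; rewrite sA => /(_ isT).
    by rewrite -/(k s) -ck !inord_val => /negP nb /nb.
  exists (base s c)@_(U s c); split.
    by apply: frac_lead_poly; exact: lead_base.
  rewrite /base; case: ifP => [/andP[/eqP sn cp]|_ _].
    have es : inord n' = s :> 'I_n by rewrite -[RHS]inord_val sn.
    by have := yg c cp; rewrite es inord_val => ->.
  by rewrite mcoeffX eqxx oner_eq0.
- move=> c cp; rewrite /T ltnn ltnSn /= /base eqxx cp (gtn_eqF (ltnSn _)) /=.
  by rewrite (ltn_eqF (leq_trans cp kp)) -mul_mpolyC tofracM mpolyCN tofracN.
- move=> s sn; have ks : (k s < q.+1)%N := kq s.
  rewrite (bigD1 (Ordinal ks)) //=.
  have -> : \sum_(j < q.+1 | j != Ordinal ks) w j * T s j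
          = (\sum_(j < q.+1 | j != k s :> nat) wp j * base s j)%:F.
    rewrite rmorph_sum; apply: eq_big => // j jk; rewrite [RHS]tofracM /T sn.
    by rewrite (negPf (jk : j != k s :> nat)).
  rewrite {1}/T sn eqxx /= mulrBr mulrCA divff // mulr1 -addrA.
  case: ifP => sA; last first.
    rewrite mulr0 add0r [others s](_ : _ = \sum_(j < q.+1 | j != k s :> nat) wp j * base s j).
      by rewrite addNr.
    by apply: eq_bigl => j; rewrite sA andbT.
  have [kq' ak] := nth_pivot sa sza sA.
  rewrite (bigD1 (Ordinal (kq' : (k s).+1 < q.+1)%N)) /=; last first.
    by rewrite (gtn_eqF (ltnSn _)).
  have -> : others s = \sum_(j < q.+1 | (j != k s :> nat) &&
      (j != Ordinal (kq' : (k s).+1 < q.+1)%N)) wp j * base s j.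
    by apply: eq_bigl => j; rewrite sA.
  rewrite tofracD [X in _ + X]addrCA addNr addr0.
  rewrite -tofracM -tofracD; apply/eqP; rewrite tofrac_eq0 /base.
  have -> : (s == n') && ((k s).+1 < p)%N = false.
    apply/negbTE; rewrite negb_and; have [sn'|//] := eqVneq s n'.
    by rewrite -leqNgt sn' (leq_trans kp).
  (* The two remaining terms have the same monomial and opposite signs. *)
  have e := mu_step a kq'; rewrite ak /varU in e.
  rewrite /wp -!scalerAl -!mpolyXD e.
  by rewrite exprS mulN1r scaleNr addrN.
Qed.

End DiagonalPoint.

(** * Leading terms of minors *)

Section DiagonalTerm.
Variables (K : comNzRingType) (n' : nat).
Local Notation n := n'.+2.
Local Notation R := {mpoly K[n * n]}.

Variables (k : nat) (c : seq nat).
Hypotheses (kn : (k <= n)%N) (sc : sorted ltn c) (cn : all (fun x => x < n)%N c).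
Hypothesis szc : size c = k.

Definition diag_mnm : 'X_{1.. n * n} := (\sum_(l < k) varU n' (nth 0%N c l) l)%MM.

Let mp (s : 'S_k) : 'X_{1.. n * n} := (\sum_(l < k) varU n' (nth 0%N c l) (s l))%MM.

(** Let [a] be the first index moved by [s]. The two monomials agree on all variables before the one
    at [(c_a, a)], which occurs in the diagonal only. *)
Let mp_lt s : s != 1%g -> (mp s < diag_mnm)%O.
Proof.
move=> s1; have [a sa amin] : exists2 a : 'I_k, s a != a &
    forall b : 'I_k, (b < a)%N -> s b = b.
  have [a0 sa0] : exists a, s a != a.
    apply/existsP; apply: contraNT s1 => /existsPn sid; apply/eqP/permP => a.
    by rewrite perm1; apply/eqP/negbNE/sid.
  have [a sa amin] := @arg_minnP _ a0 (fun a => s a != a) (fun a : 'I_k => val a) sa0.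
  exists a => // b ba.
  by apply/eqP; apply: contraTT ba => sb; rewrite -leqNgt amin.
have ge_a (b : 'I_k) : (a <= b)%N -> (a <= s b)%N.
  move=> ab; rewrite leqNgt; apply/negP => lt.
  by have := perm_inj (amin _ lt) => e; rewrite e ltnNge ab in lt.
have cN (b : 'I_k) : (nth 0%N c b < n)%N by apply: (allP cn); rewrite mem_nth ?szc.
have ltn_k (b : 'I_k) : (b < n)%N by apply: leq_trans kn.
have cmon (b : 'I_k) : (a < b)%N -> (nth 0%N c a < nth 0%N c b)%N.
  by move=> ab; apply: (sorted_ltn_nth ltn_trans) => //; rewrite inE szc.
apply/ltmcP; first by rewrite !mdeg_sum; apply: eq_bigr => l _; rewrite !mdeg1.
exists (var (inord (nth 0%N c a)) (inord a)) => [v|].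
  rewrite !mnm_sumE -(unvarK v); case: (unvar v) => x y {v} lt.
  apply: eq_bigr => b _; have [ba|ab] := ltnP b a; first by rewrite amin.
  have U0 (d : 'I_k) : (a <= d)%N -> varU n' (nth 0%N c b) d (var x y) = 0%N.
    move=> ad; rewrite mnm1E; apply/eqP; rewrite eqb0; apply/eqP => /var_inj[ex ey].
    move: lt; rewrite var_lt -ex -ey -(inj_eq val_inj) /= !inordK //.
    move: ab; rewrite leq_eqVlt => /predU1P[ab|/cmon ab].
      by rewrite -(val_inj ab) ltnn eqxx /= ltnNge ad.
    by rewrite (gtn_eqF ab) orbF ltnNge ltnW.
  by rewrite !U0 // ge_a.
rewrite !mnm_sumE (bigD1 a) //= [X in (_ < X)%N](bigD1 a) //=.
rewrite !mnm1E !var_eq !eqxx /= -!(inj_eq val_inj) /= !inordK //.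
rewrite (negbTE (sa : s a != a :> nat)) add0n add1n ltnS.
apply: leq_sum => b ba; have [ba'|ab] := ltnP b a; first by rewrite amin.
have lt : (a < b)%N by rewrite ltn_neqAle ab andbT eq_sym.
rewrite !mnm1E !var_eq -!(inj_eq val_inj) /= !inordK //.
by rewrite (gtn_eqF (cmon _ lt)).
Qed.

Definition diag_minor_mx : 'M[R]_k :=
  \matrix_(a, b) 'X_(var (inord (nth 0%N c a)) (inord b)).

Lemma mlead_det_diag : mlead (\det diag_minor_mx) = diag_mnm /\ mleadc (\det diag_minor_mx) = 1.
Proof.
have detE : \det diag_minor_mx = \sum_(s : 'S_k) (-1) ^+ s *: 'X_[mp s].
  apply: eq_bigr => s _; rewrite -mprodXE -mul_mpolyC rmorphXn rmorphN1; congr (_ * _).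
  by apply: eq_bigr => a _; rewrite mxE.
have mp1 : mp 1%g = diag_mnm by apply: eq_bigr => l _; rewrite perm1.
rewrite detE (bigD1 1%g) //= odd_perm1 expr0 scale1r mp1.
set r := \sum_(s | _) _.
have [r0|lt] : r = 0 \/ (mlead r < diag_mnm)%O.
  rewrite /r; elim/big_ind: _ => [|x y|s s1]; first by left.
    move=> [->|xlt] [->|ylt]; rewrite ?addr0 ?add0r; try by [left|right].
    by right; apply: le_lt_trans (mleadD_le _ _) _; rewrite ltUx xlt.
  right; apply: le_lt_trans (mleadZ_le _ _) _; rewrite mleadXm; exact: mp_lt.
  by rewrite r0 addr0 mleadXm mcoeffX eqxx.
rewrite mleadDl ?mleadXm // mcoeffD mcoeffX eqxx.
by rewrite [r@_ _]mcoeff_gt_mlead ?addr0.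
Qed.

End DiagonalTerm.

(** * The ideals of the components *)

Section ComponentIdeals.
Variable n' : nat.
Local Notation n := n'.+2.

Section Generators.
Variables (B : comNzRingType) (tau : B) (l : 'I_n -> B) (h : 'I_n -> 'I_n).
Variable Z : 'M[B]_n.

Definition ell (c : 'I_n) : B := tau * Z 0 c + Z ord_max c.

Definition nminor k : set B := [set m | exists f : 'I_k -> 'I_n,
  [/\ {homo f : a b / (a < b)%N}, forall a, (0 < f a)%N
    & m = \det (\matrix_(a, b) Z (f a) (inord b))]].

(** The forms [l] are a parameter: they are [ell] for the matrices [t s + E_1n] and the first row of
    [Z] for [s]. *)
Definition comp_gens (i : 'I_n) : set B :=
  [set x | (exists2 c : 'I_n, (c < i)%N & x = l c) \/ nminor (h i).+1 x].

Definition hess_gens : set B := [set x | exists i c : 'I_n,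
  (c <= i)%N /\ exists2 m, nminor (h i).+1 m & x = l c * m].

(* The weights [w] exhibit a multiple of [e_1] as a combination of the first [h i]
   columns; this replaces the vanishing of the minors. *)
Definition comp_point (i : 'I_n) (w : 'I_n -> B) :=
  [/\ forall c : 'I_n, (c < i)%N -> ell c = 0,
      forall r : 'I_n, (0 < r)%N -> \sum_c w c * Z r c = 0
    & forall c : 'I_n, (h i < c)%N -> w c = 0].

End Generators.

(** The rows are chosen among the [n - 1] rows other than the first. So no such minors exist where
    [h] takes its maximal value, in agreement with [hess_ideal_at]. *)
Lemma nminor_size (B : comNzRingType) (Z : 'M[B]_n) k m : nminor Z k m -> (k < n)%N.
Proof.
move=> [f [fi f0 _]].
have fS a : ((f a).-1 < n'.+1)%N by have := ltn_ord (f a); case: (val _) (f0 a).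
have /leq_card : injective (fun a => Ordinal (fS a)).
  move=> a b /(congr1 val) /= fab; apply/val_inj.
  have {}fab : f a = f b :> nat by rewrite -(prednK (f0 a)) fab prednK.
  by case: (ltngtP a b) => // /fi; rewrite fab ltnn.
by rewrite !card_ord.
Qed.

Lemma ell_map (B C : comNzRingType) (g : {rmorphism B -> C}) tau Z c :
  g (ell tau Z c) = ell (g tau) (map_mx g Z) c.
Proof. by rewrite /ell rmorphD rmorphM !mxE. Qed.

Lemma nminor_map (B C : comNzRingType) (g : {rmorphism B -> C}) Z k m :
  nminor Z k m -> nminor (map_mx g Z) k (g m).
Proof.
move=> [f [fi f0 ->]]; exists f; split=> //; rewrite -det_map_mx; congr (\det _).
by apply/matrixP => a b; rewrite !mxE.
Qed.

Lemma comp_gens_map (B C : comNzRingType) (g : {rmorphism B -> C}) l l' h Z i x :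
  (forall c, g (l c) = l' c) ->
  comp_gens l h Z i x -> comp_gens l' h (map_mx g Z) i (g x).
Proof.
move=> gl [[c ci ->]|xm]; first by left; exists c; rewrite ?gl.
by right; exact: nminor_map.
Qed.

Lemma hess_gens_map (B C : comNzRingType) (g : {rmorphism B -> C}) l l' h Z x :
  (forall c, g (l c) = l' c) ->
  hess_gens l h Z x -> hess_gens l' h (map_mx g Z) (g x).
Proof.
move=> gl [i [c [ci [m mi ->]]]]; exists i, c; split=> //.
by exists (g m); [exact: nminor_map|rewrite rmorphM gl].
Qed.

Section Vanishing.
Variables (B : idomainType) (tau : B) (h : 'I_n -> 'I_n) (Z : 'M[B]_n).
Hypothesis hess_h : hessenberg h.

(** As [h i < k], the weights live on the first [k] columns and give a linear relation between the
    columns of the minor. *)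
Lemma nminor0 i w k m : comp_point tau h Z i w -> (exists c, w c != 0) ->
  (h i < k)%N -> nminor Z k m -> m = 0.
Proof.
move=> [_ wZ w0] [c0 wc0] hk mm; have kn := ltnW (nminor_size mm).
case: mm => f [fi f0 ->].
apply/eqP; rewrite -det_tr; apply/det0P.
exists (\row_b w (inord b)).
  have ck : (c0 < k)%N.
    rewrite ltnNge; apply/negP => kc.
    by move: wc0; rewrite w0 ?eqxx // (leq_trans hk).
  apply: contra_neq wc0 => /rowP/(_ (Ordinal ck)).
  by rewrite !mxE /= inord_val.
apply/rowP => a; rewrite !mxE; under eq_bigr do rewrite !mxE.
have := wZ (f a) (f0 a); rewrite (bigID (fun c : 'I_n => (c < k)%N)) /=.
rewrite [X in _ + X]big1 ?addr0 => [|c]; last first.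
  by rewrite -leqNgt => kc; rewrite w0 ?mul0r // (leq_trans hk).
rewrite (big_ord_narrow kn) => e; rewrite -[RHS]e; apply: eq_bigr => b _.
by rewrite (_ : inord b = widen_ord kn b) //; apply/val_inj; rewrite /= inordK // (leq_trans _ kn).
Qed.

Lemma comp_gens0 i w : comp_point tau h Z i w -> (exists c, w c != 0) ->
  forall x, comp_gens (ell tau Z) h Z i x -> x = 0.
Proof.
move=> cp w0 x [[c ci ->]|]; first by case: cp => [-> //].
exact: (nminor0 cp w0).
Qed.

(** For a generator [l_c m] with [c <= i']: either [c < i] and [l_c] vanishes, or [i <= i'], hence
    [h i <= h i'] and the minor vanishes. *)
Lemma hess_gens0 i w : comp_point tau h Z i w -> (exists c, w c != 0) ->
  forall x, hess_gens (ell tau Z) h Z x -> x = 0.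
Proof.
move=> cp w0 x [i' [c [ci' [m mm ->]]]]; have [ci|ic] := ltnP c i.
  by case: cp => -> //; rewrite mul0r.
rewrite (nminor0 cp w0 _ mm) ?mulr0 // ltnS.
by apply: hess_h.1; exact: leq_trans ci'.
Qed.

End Vanishing.

End ComponentIdeals.

Section ComponentPrimes.
Variables (K : idomainType) (n' : nat).
Local Notation n := n'.+2.
Local Notation R := {mpoly K[n * n]}.
Local Notation X := (generic_mx K n).
Variables (tau : K) (h : 'I_n -> 'I_n).
Hypotheses (hess_h : hessenberg h) (indec_h : indecomposable h).
Local Notation tauP := (tau%:MP : R).

Lemma sum_ord_upto (V : nmodType) (j : 'I_n) (F : 'I_n -> V) :
  (forall c : 'I_n, (j < c)%N -> F c = 0) ->
  \sum_c F c = \sum_(c < n | (c < j)%N) F c + F j.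
Proof.
move=> F0; rewrite (bigID (fun c : 'I_n => (c < j)%N)) /=; congr (_ + _).
rewrite (bigD1 j) ?ltnn //= big1 ?addr0 // => c /andP[jc cj]; apply: F0.
by rewrite ltn_neqAle eq_sym leqNgt jc andbT.
Qed.

Definition base_mx (i : 'I_n) : 'M[R]_n := \matrix_(r, c)
  if (r == ord_max) && (c < i)%N then - tauP * X 0 c else X r c.

(* The variables of column [h i] below the first row, unused otherwise, serve
   as the coefficients of the linear relation between columns. *)
Definition param_mx (i : 'I_n) : 'M[R]_n := \matrix_(r, c)
  if (0 < r)%N && (c == h i)
  then \sum_(k < n | (k < h i)%N) X (inord k.+1) (h i) * base_mx i r k
  else base_mx i r c.

Definition param i : {rmorphism R -> R} := evmx (@mpolyC _ K) (param_mx i).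

Lemma paramE i f : param i f = evmx (@mpolyC _ K) (param_mx i) f.
Proof. by []. Qed.

Definition param_weight (i c : 'I_n) : R :=
  if (c < h i)%N then X (inord c.+1) (h i) else - (c == h i)%:R.

Lemma param_mx_point (i : 'I_n) : (i.+1 < n)%N ->
  comp_point tauP h (param_mx i) i (param_weight i).
Proof.
move=> i_n; have ih := indec_h i_n; split=> [c ci|r r0|c hc].
- have ch : c == h i = false by rewrite -val_eqE ltn_eqF // (ltn_trans ci).
  by rewrite /ell ![param_mx _ _ _]mxE ch /= ![base_mx _ _ _]mxE /= ci mulNr eqxx subrr.
- rewrite (sum_ord_upto (j := h i)) => [|c hc]; last first.
    by rewrite /param_weight ltnNge ltnW //= -val_eqE (gtn_eqF hc) oppr0 mul0r.
  rewrite /param_weight ltnn eqxx mulN1r [param_mx _ _ _]mxE r0 eqxx /=.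
  apply/eqP; rewrite subr_eq0; apply/eqP/eq_bigr => c ch.
  by rewrite ch [param_mx _ _ _]mxE r0 -[c == h i]val_eqE (ltn_eqF ch).
- by rewrite /param_weight ltnNge ltnW //= -val_eqE (gtn_eqF hc) oppr0.
Qed.

(** A point of the locus with [w (h i)] nonzero is a specialization of [param_mx i]: below the first
    row, its column [h i] is determined by the preceding columns and the normalized weights. *)
Lemma param_universal (i : 'I_n) (F : fieldType) (phi : {rmorphism K -> F}) (Z : 'M[F]_n) w :
  (i.+1 < n)%N -> comp_point (phi tau) h Z i w -> w (h i) != 0 ->
  forall f, param i f = 0 -> evmx phi Z f = 0.
Proof.
move=> i_n [ell0 wZ w0] wh f fi; have ih := indec_h i_n.
(* As in [param_mx], the coefficient of column [r - 1] is stored in row [r] of column [h i]. *)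
pose M : 'M[F]_n := \matrix_(r, c)
  if (0 < r)%N && (c == h i) then - w (inord r.-1) / w (h i) else Z r c.
suff <- : evmx phi M (param i f) = evmx phi Z f by rewrite fi rmorph0.
have ec : evmx phi M \o @mpolyC _ K =1 phi by move=> a /=; rewrite evmxC.
rewrite /param /= (evmx_comp _ _ ec).
congr (evmx _ _ f); apply/matrixP => r c.
have EX r' c' : evmx phi M (X r' c') = M r' c' by rewrite mxE evmxX.
have Eb r' c' : c' != h i -> evmx phi M (base_mx i r' c') = Z r' c'.
  move=> ch; rewrite mxE; case: ifP => [/andP[/eqP-> ci]|_].
    rewrite rmorphM rmorphN /= evmxC EX mxE /= mulNr; apply/eqP.
    by rewrite eq_sym -addr_eq0 addrC; apply/eqP; exact: ell0.
  by rewrite EX mxE (negPf ch) andbF.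
rewrite mxE [param_mx _ _ _]mxE; case: ifP => [/andP[r0 /eqP->]|rc]; last first.
  have [ch|ch] := eqVneq c (h i); last exact: Eb.
  move: rc; rewrite ch eqxx andbT => r0; rewrite [base_mx _ _ _]mxE.
  by rewrite [(h i < i)%N]ltnNge ltnW //= andbF EX mxE r0.
rewrite raddf_sum /=; have := wZ r r0.
rewrite (sum_ord_upto (j := h i)) => [e|k hk]; last by rewrite w0 ?mul0r.
move/eqP: e; rewrite addrC addr_eq0 => /eqP e; apply: (mulfI wh).
rewrite e mulr_sumr -sumrN.
apply: eq_bigr => k kh; rewrite rmorphM /= EX mxE eqxx andbT.
have kn : (k.+1 < n)%N by exact: leq_ltn_trans kh (ltn_ord _).
rewrite inordK //= inord_val Eb ?neq_ltn ?kh //.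
by rewrite mulrA mulrCA divff // mulr1 mulNr.
Qed.

Lemma param_gens (i : 'I_n) : (i.+1 < n)%N ->
  (forall x, comp_gens (ell tauP X) h X i x -> param i x = 0) /\
  (forall x, hess_gens (ell tauP X) h X x -> param i x = 0).
Proof.
move=> i_n; have pt := param_mx_point i_n.
have w0 : exists c, param_weight i c != 0.
  by exists (h i); rewrite /param_weight ltnn eqxx oppr_eq0 oner_eq0.
have EX : map_mx (param i) X = param_mx i by exact: evmx_generic.
have El c : param i (ell tauP X c) = ell tauP (param_mx i) c.
  by rewrite ell_map EX /param /= evmxC.
by split=> x; [move/(comp_gens_map El)|move/(hess_gens_map El)]; rewrite EX;
  [exact: comp_gens0 pt w0 _|exact: hess_gens0 pt w0 _].
Qed.

End ComponentPrimes.

(** * Leading monomials of the elements of the kernels *)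

Section LeadingTerms.
Variables (K : idomainType) (n' : nat).
Local Notation n := n'.+2.
Local Notation R := {mpoly K[n * n]}.
Local Notation X := (generic_mx K n).
Variables (tau : K) (h : 'I_n -> 'I_n).
Hypotheses (hess_h : hessenberg h) (indec_h : indecomposable h).
Local Notation tauP := (tau%:MP : R).

(* The rows are ordered with the first one last: the forms [ell] and the minors
   then have leading coefficient 1, whatever [tau]. *)
Definition rank_row (r : 'I_n) : nat := if val r is k.+1 then k else n'.+1.
Definition row_rank (s : nat) : 'I_n := if s == n'.+1 then 0 else inord s.+1.

Lemma rank_row_lt r : (rank_row r < n)%N.
Proof. by rewrite /rank_row; case: r => -[|k] //= /ltnW. Qed.

Lemma rank_rowK r : row_rank (rank_row r) = r.
Proof.
apply/val_inj; rewrite /row_rank /rank_row; case: r => -[|k] /= kn; first by rewrite eqxx.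
by rewrite ltn_eqF //= inordK.
Qed.

Lemma row_rankK s : (s < n)%N -> rank_row (row_rank s) = s.
Proof.
rewrite /row_rank /rank_row ltnS leq_eqVlt => /predU1P[->|sn]; first by rewrite eqxx.
by rewrite ltn_eqF //= inordK.
Qed.

(** Besides moving the first row to the end, this passes from the numbering [mxvec_index] of the
    variables to [var]. *)
Definition shift_mx : 'M[R]_n := \matrix_(r, c) 'X_(var (inord (rank_row r)) c).
Definition shift : {rmorphism R -> R} := evmx (@mpolyC _ K) shift_mx.
Definition unshift : {rmorphism R -> R} :=
  mmap (@mpolyC _ K) (fun v => X (row_rank (unvar v).1) (unvar v).2).

Lemma unshiftX s c : unshift 'X_(var s c) = X (row_rank s) c.
Proof. by rewrite /unshift /= mmapX mmap1U varK. Qed.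

Lemma shiftX r c : shift (X r c) = 'X_(var (inord (rank_row r)) c).
Proof. by rewrite mxE /shift /= evmxX mxE. Qed.

Lemma shiftC a : shift a%:MP = a%:MP.
Proof. by rewrite /shift /= evmxC. Qed.

Lemma shiftK : cancel shift unshift.
Proof.
apply: (mpoly_rmorph_eq (F := unshift \o shift) (G := idfun)) => [a|k] /=.
  by rewrite evmxC /unshift /= mmapC.
case/mxvec_indexP: k => r c; rewrite evmxX mxE unshiftX inordK ?rank_row_lt //.
by rewrite rank_rowK mxE.
Qed.

Lemma unshiftK : cancel unshift shift.
Proof.
apply: (mpoly_rmorph_eq (F := shift \o unshift) (G := idfun)) => [a|v] /=.
  by rewrite /unshift /= mmapC evmxC.
rewrite -(unvarK v); case: (unvar v) => s c /=.
by rewrite [mmap _ _ _]unshiftX shiftX row_rankK // inord_val.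
Qed.

Lemma unshiftZ : scalable unshift.
Proof. by move=> a f; rewrite /unshift /= mmapZ mul_mpolyC. Qed.

(** The leading monomial of [g] is divisible by the diagonal of a minor of the first [q] columns;
    the bound [n'.+1] excludes the row ranked last, which is the original first row. *)
Definition chain (g : R) (q : nat) (c : seq nat) :=
  [/\ sorted ltn c, all (fun x => x < n'.+1)%N c, size c = q
    & forall l, (l < q)%N -> mlead g (var (inord (nth 0%N c l)) (inord l)) != 0%N].

(** Otherwise [diagonal_point] with [p = i] and [q = h i] yields a point of the locus over the
    rational functions at which [f] does not vanish, contrary to [param_universal]. *)
Lemma lead_comp (i : 'I_n) f : (i.+1 < n)%N -> f != 0 -> param tau h i f = 0 ->
  (exists2 c, (c < i)%N & mlead (shift f) (var (inord n') (inord c)) != 0%N) \/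
  exists c, chain (shift f) (h i).+1 c.
Proof.
move=> i_n f0 fi; apply: contrapT => /not_orP[/forall2NP nol nochain].
have g0 : shift f != 0 by rewrite -(rmorph0 shift) (can_eq shiftK).
have [|c sc cn szc diag|T [w [Tg Ty Tw wq]]] :=
    diagonal_point tau (indec_h i_n) (ltn_ord (h i)) g0.
- by move=> c ci; have [//|/negP/negbNE/eqP] := nol c.
- by apply: nochain; exists c; split.
pose phi : {rmorphism K -> {fraction R}} := @tofrac R \o @mpolyC _ K.
pose Z : 'M[{fraction R}]_n := \matrix_(r, c) T (rank_row r) c.
pose w' (c : 'I_n) := if (c <= h i)%N then w c else 0.
case/eqP: Tg; transitivity (evmx phi Z f).
  pose T' : {rmorphism R -> {fraction R}} := mmap phi (fun k => T (unvar k).1 (unvar k).2).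
  apply: (evmx_uniq (F := T' \o shift)) => [a|]; first by rewrite /= evmxC /T' /= mmapC.
  apply/matrixP => r c; rewrite !mxE /= evmxX mxE /T' /= mmapX mmap1U varK /=.
  by rewrite inordK // rank_row_lt.
apply: (param_universal indec_h (w := w') i_n _ _ fi); last by rewrite /w' leqnn.
split=> [c ci|r r0|c hc]; last by rewrite /w' leqNgt hc.
- rewrite /ell !mxE /= Ty // mulNr.
  by rewrite /phi /= subrr.
- rewrite (sum_ord_upto (j := h i)) => [|c hc]; last by rewrite /w' leqNgt hc mul0r.
  have rn : (rank_row r < n'.+1)%N.
    by move: r0; rewrite /rank_row; case: (r) => -[].
  rewrite -[RHS](Tw _ rn) big_ord_recr /= /w' leqnn !mxE; congr (_ + _).
  rewrite (big_ord_narrow (ltnW (ltn_ord (h i)))); apply: eq_bigr => c _.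
  by rewrite !mxE /= ltnW.
Qed.

(** For the least [i] whose variable in the last row occurs in the leading monomial, the first
    alternative of [lead_comp] is excluded, so this variable and a chain occur together. *)
Lemma lead_hess f : f != 0 ->
  (forall i : 'I_n, (i.+1 < n)%N -> param tau h i f = 0) ->
  exists i : 'I_n, [/\ (i.+1 < n)%N,
    mlead (shift f) (var (inord n') i) != 0%N
    & exists c, chain (shift f) (h i).+1 c].
Proof.
move=> f0 fP.
have [/existsP[i0 i0P]|/existsPn noy] :=
    boolP [exists i : 'I_n, (i.+1 < n)%N && (mlead (shift f) (var (inord n') i) != 0%N)].
  have [i /andP[i_n iy] imin] := @arg_minnP _ i0 (fun i : 'I_n =>
    (i.+1 < n)%N && (mlead (shift f) (var (inord n') i) != 0%N)) (fun i => val i) i0P.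
  exists i; split=> //; case: (lead_comp i_n f0 (fP _ i_n)) => // -[c ci cy].
  have cn : (c < n)%N by exact: ltn_trans ci (ltn_ord i).
  have /imin : ((inord c : 'I_n).+1 < n)%N &&
      (mlead (shift f) (var (inord n') (inord c)) != 0%N).
    by rewrite cy inordK // andbT (leq_ltn_trans _ i_n) // ltnS ltnW.
  by rewrite /= inordK // leqNgt ci.
(* If there is no such [i], the index [n'] gives a contradiction: [h] is maximal there by
   indecomposability, and a chain would need [n] rows out of [n - 1]. *)
have i_n : ((inord n' : 'I_n).+1 < n)%N by rewrite inordK.
case: (lead_comp i_n f0 (fP _ i_n)) => [[c]|[c [sc cn szc _]]].
  rewrite inordK // => cn cy; have := noy (inord c).
  have cn' : (c < n)%N by rewrite ltnW // ltnS ltnW.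
  by rewrite cy inordK // andbT !ltnS ltnW.
have := size_sorted_ltn sc cn; rewrite szc; have := indec_h i_n.
by rewrite inordK // !ltnS => lt /(leq_trans lt); rewrite ltnn.
Qed.

End LeadingTerms.

#[global] Opaque shift unshift param.

Lemma mnm_sum_uniq_le (N : nat) (s : seq 'I_N) (m : 'X_{1..N}) :
  uniq s -> (forall v, v \in s -> m v != 0%N) ->
  ((\sum_(v <- s) U_(v))%MM <= m)%MM.
Proof.
move=> us sm; apply/mnm_lepP => v; rewrite mnm_sumE.
have -> : (\sum_(u <- s) (U_(u))%MM v = (v \in s))%N.
  rewrite -(count_uniq_mem v us) -sum1_count [RHS]big_mkcond /=.
  by apply: eq_bigr => u _; rewrite mnm1E; case: eqP.
by case: (boolP (v \in s)) => [/sm|//]; rewrite lt0n.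
Qed.

Lemma mnm1_lt (N : nat) (j k : 'I_N) : (j < k)%N -> (U_(k)%MM < U_(j)%MM)%O.
Proof.
move=> jk; apply/ltmcP; first by rewrite !mdeg1.
exists j => [l lj|]; rewrite !mnm1E ?eqxx.
  by rewrite -!val_eqE !gtn_eqF // (ltn_trans lj).
by rewrite -val_eqE gtn_eqF.
Qed.

Section ComponentGenerators.
Variables (K : idomainType) (n' : nat).
Local Notation n := n'.+2.
Local Notation R := {mpoly K[n * n]}.
Local Notation X := (generic_mx K n).
Variables (tau : K) (h : 'I_n -> 'I_n).
Hypotheses (hess_h : hessenberg h) (indec_h : indecomposable h).
Local Notation tauP := (tau%:MP : R).
Local Notation shift := (@shift K n').

(** In the new order the entry of the last row precedes that of the first, so the term with [tau] is
    never the leading one. *)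
Lemma mlead_shift_ell c : let l := shift (ell tauP X c) in
  mlead l = U_(var (inord n') c)%MM /\ mleadc l = 1.
Proof.
rewrite /= /ell rmorphD rmorphM !shiftX shiftC.
rewrite [rank_row ord_max](_ : _ = n') // [rank_row 0](_ : _ = n'.+1) //.
set y := 'X_(var (inord n') c); set x := _ * _.
have lt : (mlead x < mlead y)%O.
  rewrite /x mul_mpolyC; apply: le_lt_trans (mleadZ_le _ _) _; rewrite !mleadXm.
  by apply: mnm1_lt; rewrite var_lt !inordK // ltnSn.
by rewrite mleadDr // mcoeffD mcoeff_gt_mlead // add0r mleadXm mcoeffX eqxx.
Qed.

Lemma mlead_shift_minor c k : (k <= n)%N -> sorted ltn c ->
  all (fun x => x < n'.+1)%N c -> size c = k ->
  exists m, [/\ nminor X k m, mlead (shift m) = diag_mnm n' k c & mleadc (shift m) = 1].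
Proof.
move=> kn sc cn szc.
have cn' : all (fun x => x < n)%N c by apply: sub_all cn => x /ltnW.
have [lead leadc] := mlead_det_diag K kn sc cn' szc.
pose f (a : 'I_k) := row_rank n' (nth 0%N c a).
have ca (a : 'I_k) : (nth 0%N c a < n'.+1)%N by apply: (allP cn); rewrite mem_nth ?szc.
have fE a : f a = (nth 0%N c a).+1 :> nat.
  by rewrite /f /row_rank ltn_eqF // inordK // ltnS.
exists (\det (\matrix_(a, b) X (f a) (inord b))).
have -> : shift (\det (\matrix_(a, b) X (f a) (inord b))) = \det (diag_minor_mx K n' k c).
  rewrite -det_map_mx; congr (\det _); apply/matrixP => a b.
  rewrite [LHS]mxE [X in shift X]mxE shiftX row_rankK ?ltnS ?(ltnW (ca a)) //.
  by rewrite mxE.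
split=> //; exists f; split=> // [a b ab|a]; rewrite ?fE //.
by rewrite ltnS; apply: (sorted_ltn_nth ltn_trans) => //; rewrite inE szc.
Qed.

End ComponentGenerators.

Section ComponentKernels.
Variables (K : idomainType) (n' : nat).
Local Notation n := n'.+2.
Local Notation R := {mpoly K[n * n]}.
Local Notation X := (generic_mx K n).
Variables (tau : K) (h : 'I_n -> 'I_n).
Hypotheses (hess_h : hessenberg h) (indec_h : indecomposable h).
Local Notation tauP := (tau%:MP : R).
Local Notation shift := (@shift K n').
Local Notation unshift := (@unshift K n').

Lemma chain_diag_le (g : R) q c : (q <= n)%N -> chain g q c ->
  (diag_mnm n' q c <= mlead g)%MM.
Proof.
move=> qn [sc cn szc gc].
pose v (l : 'I_q) := var (inord (nth 0%N c l)) (inord l : 'I_n).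
have -> : diag_mnm n' q c = (\sum_(u <- [seq v l | l <- index_enum 'I_q]) U_(u))%MM.
  by rewrite big_map.
apply: mnm_sum_uniq_le => [|u /mapP[l _ ->]]; last exact: gc.
rewrite map_inj_uniq ?index_enum_uniq // => l l' /var_inj[_ e]; apply/val_inj.
by move: (congr1 val e); rewrite /= !inordK // (leq_trans _ qn).
Qed.

(** The variable at [(n', i)] is not on the diagonal: it could only stand there in column [i], and
    since [i < h i] the diagonal would continue to a row beyond the last admissible one. So the
    variables are distinct and their product divides. *)
Lemma chain_diag_ell_le (g : R) (i : 'I_n) c : (i < h i)%N -> chain g (h i).+1 c ->
  mlead g (var (inord n') i) != 0%N ->
  ((U_(var (inord n') i) + diag_mnm n' (h i).+1 c)%MM <= mlead g)%MM.
Proof.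
move=> ih [sc cn szc gc] gi.
pose v (l : 'I_(h i).+1) := var (inord (nth 0%N c l)) (inord l : 'I_n).
have hn : ((h i).+1 <= n)%N by [].
have ln (l : 'I_(h i).+1) : (l < n)%N by apply: leq_trans hn.
have -> : (U_(var (inord n') i) + diag_mnm n' (h i).+1 c)%MM =
    (\sum_(u <- var (inord n') i :: [seq v l | l <- index_enum 'I_(h i).+1]) U_(u))%MM.
  by rewrite big_cons big_map.
apply: mnm_sum_uniq_le => [|u]; last first.
  by rewrite inE => /predU1P[->//|/mapP[l _ ->]]; exact: gc.
rewrite /= map_inj_uniq ?index_enum_uniq ?andbT => [|l l' /var_inj[_ e]]; last first.
  by apply/val_inj; move: (congr1 val e); rewrite /= !inordK.
apply/mapP => -[l _ /var_inj[/(congr1 val) + /(congr1 val)]].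
rewrite /= !inordK // => [e1 e2|]; last first.
  by apply: leq_trans (_ : n'.+1 < n)%N => //; rewrite ltnS ltnW //;
    apply: (allP cn); rewrite mem_nth ?szc.
have lh : (l.+1 < (h i).+1)%N by rewrite ltnS -e2.
have : (nth 0%N c l < nth 0%N c l.+1)%N.
  by apply: (sorted_ltn_nth ltn_trans) => //; rewrite inE szc.
rewrite -e1 ltnNge -ltnS; case/negP.
by apply: (allP cn); rewrite mem_nth ?szc.
Qed.

Lemma lead_comp_gens (i : 'I_n) f : (i.+1 < n)%N -> f != 0 -> param tau h i f = 0 ->
  lead_of (comap unshift (gen_ideal (comp_gens (ell tauP X) h X i))) (mlead (shift f)).
Proof.
move=> i_n f0 fi; have [[c ci cy]|[c cc]] := lead_comp indec_h i_n f0 fi.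
  have cn : (c < n)%N by apply: ltn_trans ci _.
  have [lead leadc] := mlead_shift_ell tau (inord c : 'I_n).
  apply: (lead_ofS (m := U_(var (inord n') (inord c))%MM)).
    rewrite -lead; apply: (transport_lead_of (@shiftK K n')) => //.
    by apply: gen_ideal_sub; left; exists (inord c); rewrite ?inordK.
  have := @mnm_sum_uniq_le _ [:: var (inord n') (inord c)] (mlead (shift f)).
  by rewrite big_seq1; apply=> // v; rewrite inE => /eqP->.
have hn : ((h i).+1 <= n)%N by [].
have [sc cn szc _] := cc.
have [m [mm lead leadc]] := mlead_shift_minor K hn sc cn szc.
apply: lead_ofS (chain_diag_le hn cc); rewrite -lead.
apply: (transport_lead_of (@shiftK K n')) => //.
by apply: gen_ideal_sub; right.
Qed.

Lemma lead_hess_gens f : f != 0 ->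
  (forall i : 'I_n, (i.+1 < n)%N -> param tau h i f = 0) ->
  lead_of (comap unshift (gen_ideal (hess_gens (ell tauP X) h X))) (mlead (shift f)).
Proof.
move=> f0 fP; have [i [i_n iy [c cc]]] := lead_hess indec_h f0 fP.
have hn : ((h i).+1 <= n)%N by [].
have [sc cn szc _] := cc.
have [m [mm lead leadc]] := mlead_shift_minor K hn sc cn szc.
have [lead' leadc'] := mlead_shift_ell tau i.
apply: lead_ofS (chain_diag_ell_le (indec_h i_n) cc iy).
rewrite -lead -lead'; refine (transport_lead_ofM (@shiftK K n') _ leadc' leadc).
by apply: gen_ideal_sub; exists i, i; split=> //; exists m.
Qed.

Definition comp_ideal i : ideal R := gen_ideal (comp_gens (ell tauP X) h X i).

(** One inclusion is [param_gens]. The other one and flatness both hold because every leading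
    monomial of the kernel is that of a monic element of the ideal. *)
Lemma comp_idealP (i : 'I_n) : (i.+1 < n)%N ->
  (forall f, comp_ideal i f <-> param tau h i f = 0) /\ flat (quot (comp_ideal i)).
Proof.
move=> i_n.
have le : ideal_le (comp_ideal i) (comap (param tau h i) (zero_ideal _)).
  apply: gen_ideal_le => x gx; exact: (param_gens tau hess_h indec_h i_n).1.
have [le' fl] := transport_lead (@shiftK K n') (@unshiftK K n') (@unshiftZ K n')
  le (fun f Pf f0 => lead_comp_gens i_n f0 Pf).
by split=> // f; split=> [/le|/le'].
Qed.

Lemma hess_gensP :
  (forall f, gen_ideal (hess_gens (ell tauP X) h X) f <->
     forall i : 'I_n, (i.+1 < n)%N -> param tau h i f = 0)
  /\ flat (quot (gen_ideal (hess_gens (ell tauP X) h X))).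
Proof.
pose P := cap_ideal [set I | exists2 i : 'I_n, (i.+1 < n)%N &
  I = comap (param tau h i) (zero_ideal _)].
have PE f : P f <-> forall i : 'I_n, (i.+1 < n)%N -> param tau h i f = 0.
  split=> [Pf i i_n|fP _ [i i_n ->]]; last exact: fP.
  by apply: (Pf (comap (param tau h i) (zero_ideal _))); exists i.
have le : ideal_le (gen_ideal (hess_gens (ell tauP X) h X)) P.
  apply: gen_ideal_le => x gx; apply/PE => i i_n.
  exact: (param_gens tau hess_h indec_h i_n).2.
have [le' fl] := transport_lead (@shiftK K n') (@unshiftK K n') (@unshiftZ K n')
  le (fun f Pf f0 => lead_hess_gens f0 ((PE f).1 Pf)).
split=> // f; split=> [/le/PE|/PE/le'] //.
Qed.

End ComponentKernels.

(** The sequence [e] records that [F] is infinite. By induction the other variables are chosen so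
    that one coefficient in the last variable stays nonzero; then the last variable avoids finitely
    many roots. *)
Lemma mpoly_nonroot (F : idomainType) (e : nat -> F) N (f : {mpoly F[N]}) :
  injective e -> f != 0 -> exists v : 'I_N -> F, f.@[v] != 0.
Proof.
move=> e_inj; elim: N f => [|N IH] f f0.
  exists (fun=> 0); apply: contraNneq f0 => f00.
  have m0 (m : 'X_{1..0}) : m = 0%MM by apply/mnmP => -[].
  have fC : f = (f@_0%MM)%:MP.
    by apply/mpolyP => m; rewrite (m0 m) mcoeffC eqxx mulr1.
  by move: f00; rewrite {1}fC mevalC => f00; rewrite fC f00.
pose w (m : 'X_{1..N.+1}) : 'X_{1..N} := [multinom m (widen_ord (leqnSn N) i) | i < N].
have m0f := mlead_supp f0; set m0 := mlead f in m0f.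
(* This coefficient contains the monomial [w m0] with coefficient [f@_m0]. *)
have g0 : (muni f)`_(m0 ord_max) != 0.
  have fm0 : f@_m0 != 0 by rewrite mleadc_eq0.
  apply: contraNneq fm0 => /(congr1 (mcoeff (w m0))); rewrite mcoeff0 muniE.
  rewrite coef_sum raddf_sum (bigD1_seq m0) ?msupp_uniq //= big1 ?addr0 => [|m mm0].
    by rewrite coefZ coefXn eqxx mulr1 mcoeffZ mcoeffX eqxx mulr1 => ->.
  rewrite coefZ coefXn; case: eqP => [em|_]; last by rewrite mulr0 mcoeff0.
  rewrite mulr1 mcoeffZ mcoeffX; case: eqP => [ew|_]; last by rewrite mulr0.
  case/eqP: mm0; apply/mnmP => k; case: (unliftP ord_max k) => [l|] -> //.
  have := congr1 (fun m : 'X_{1..N} => m l) ew; rewrite !mnmE => el.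
  by rewrite (_ : lift ord_max l = widen_ord (leqnSn N) l) //; apply/val_inj;
    rewrite /= /bump leqNgt ltn_ord.
have [v vg] := IH _ g0.
have p0 : map_poly (meval v) (muni f) != 0.
  by apply: contraNneq vg => p0; rewrite -coef_map p0 coef0.
have [c pc] : exists c, (map_poly (meval v) (muni f)).[c] != 0.
  set p := map_poly _ _ in p0 *.
  apply: contrapT => /forallNP nor.
  have rP : all (root p) [seq e k | k <- iota 0 (size p)].
    by apply/allP => x _; rewrite /root; apply: contraT => px; case: (nor x px).
  have uP : uniq [seq e k | k <- iota 0 (size p)] by rewrite map_inj_uniq // iota_uniq.
  by have := max_poly_roots p0 rP uP; rewrite size_map size_iota ltnn.
exists (fun i => if unlift ord_max i is Some j then v j else c).
rewrite [f.@[_]](_ : _ = (map_poly (meval v) (muni f)).[c]) // muniE.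
rewrite raddf_sum /= horner_sum mevalE.
apply: eq_bigr => m _; rewrite -mul_polyC rmorphM /= map_polyC map_polyXn.
rewrite hornerM hornerC hornerXn /= mevalZ mevalX.
rewrite big_ord_recr /= unlift_none mulrA; congr (_ * _ * _).
apply: eq_bigr => k _; rewrite mnmE.
have -> : widen_ord (leqnSn N) k = lift ord_max k.
  by apply/val_inj; rewrite /= /bump leqNgt ltn_ord.
by rewrite liftK.
Qed.

(** * Primes over the Hessenberg ideal, test points and density of invertible points *)

Section ComponentPoints.
Variable n' : nat.
Local Notation n := n'.+2.
Variable h : 'I_n -> 'I_n.
Hypotheses (hess_h : hessenberg h) (indec_h : indecomposable h).

Lemma comp_point_map (B C : comNzRingType) (g : {rmorphism B -> C}) tau Z i w :
  comp_point tau h Z i w -> comp_point (g tau) h (map_mx g Z) i (g \o w).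
Proof.
move=> [l0 wZ w0]; split=> [c ci|r r0|c hc] /=.
- by rewrite -ell_map l0 // rmorph0.
- have := congr1 g (wZ r r0); rewrite rmorph0 raddf_sum /= => e; rewrite -[RHS]e.
  by apply: eq_bigr => c _; rewrite rmorphM mxE.
- by rewrite w0 ?rmorph0.
Qed.

(* The index set of the components: [i] is the least element of a fiber of [h]. *)
Definition comp_index (i : 'I_n) :=
  (i.+1 < n)%N && [forall j : 'I_n, (j < i)%N ==> (h j < h i)%N].

Lemma comp_index_lt i : comp_index i -> (i.+1 < n)%N.
Proof. by case/andP. Qed.

Lemma comp_index_below (i : 'I_n) : (i.+1 < n)%N ->
  exists j, [/\ comp_index j, (j <= i)%N & h j = h i].
Proof.
move=> i_n.
have [j hj jmin] := @arg_minnP _ i (fun j => h j == h i) (fun j : 'I_n => val j) (eqxx _).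
exists j; split; [|exact: jmin|exact/eqP].
rewrite /comp_index (leq_ltn_trans _ i_n) ?ltnS ?jmin //=.
apply/forallP => k; apply/implyP => kj; rewrite (eqP hj) ltn_neqAle.
have hk : (h k <= h i)%N by apply: hess_h.1; rewrite (leq_trans (ltnW kj)) ?jmin.
rewrite hk andbT; apply: contraTneq kj => /val_inj hk'.
by rewrite -leqNgt jmin // hk'.
Qed.

Lemma comp_index_exists : exists i, comp_index i.
Proof. by have [|i [ii _ _]] := @comp_index_below 0; [|exists i]. Qed.

(** Take the least [i] with [l_i] outside [q]: as [q] contains the products [l_i m], it contains the
    minors [m] by primality. Passing to the least index with the same value of [h] only drops
    generators. *)
Lemma prime_comp (B : comNzRingType) (q : spec B) (l : 'I_n -> B) Z :
  (forall x, hess_gens l h Z x -> q x) ->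
  exists2 i, comp_index i & forall x, comp_gens l h Z i x -> q x.
Proof.
move=> hq.
suff [i [i_n li mi]] : exists i : 'I_n, [/\ (i.+1 < n)%N,
    forall c : 'I_n, (c < i)%N -> q (l c) & forall m, nminor Z (h i).+1 m -> q m].
  have [j [jj ji hj]] := comp_index_below i_n; exists j => // x [[c cj ->]|].
    by apply: li; exact: leq_trans ji.
  by rewrite hj; exact: mi.
have [/existsP[c0 c0P]|/existsPn all_l] :=
  boolP [exists c : 'I_n, (c.+1 < n)%N && ~~ `[< q (l c) >]].
  have [i /andP[i_n /asboolPn li] imin] := @arg_minnP _ c0
    (fun c : 'I_n => (c.+1 < n)%N && ~~ `[< q (l c) >]) (fun c : 'I_n => val c) c0P.
  exists i; split=> // [c ci|m mm].
    apply: contrapT => nl; have := imin c.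
    rewrite (leq_ltn_trans ci (ltn_ord i)) /= leqNgt ci => /(_ _)/negP; apply=> //.
    exact/asboolPn.
  have /spec_prime[//|//] : q (l i * m) by apply: hq; exists i, i; split=> //; exists m.
(* If all these [l_c] lie in [q], the index [n'] works: [h] is maximal there, so there are no
   minors. *)
have i_n : ((inord n' : 'I_n).+1 < n)%N by rewrite inordK.
exists (inord n'); split=> // [c|m mm].
  rewrite inordK // => cn; have := all_l c; rewrite negb_and negbK.
  by rewrite ltnS ltnW //= => /asboolP.
have := indec_h i_n; rewrite inordK // => lt.
by have := nminor_size mm; rewrite !ltnS leqNgt lt.
Qed.

Section Witnesses.
Variables (K : idomainType) (tau : K).
Local Notation R := {mpoly K[n * n]}.
Local Notation X := (generic_mx K n).
Local Notation tauP := (tau%:MP : R).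

(** If column [h i] vanishes below the first row, it is itself a multiple of [e_1], and the weights
    select this single column. *)
Lemma param_witness (i : 'I_n) (F : fieldType) (phi : {rmorphism K -> F}) (Z : 'M[F]_n) f :
  (i.+1 < n)%N -> (forall c : 'I_n, (c < i)%N -> ell (phi tau) Z c = 0) ->
  (forall r : 'I_n, (0 < r)%N -> Z r (h i) = 0) ->
  evmx phi Z f != 0 -> param tau h i f != 0.
Proof.
move=> i_n lZ Z0; apply: contra_neq.
apply: (param_universal indec_h (w := fun c => (c == h i)%:R) i_n).
  split=> // [r r0|c hc]; last by rewrite -val_eqE (gtn_eqF hc).
  rewrite (bigD1 (h i)) //= eqxx mul1r Z0 // add0r big1 // => c /negPf->.
  by rewrite mul0r.
by rewrite eqxx oner_eq0.
Qed.

(** Its permutation matrix has [e_1] in column [h i] and the other unit vectors in increasing order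
    in the remaining columns. *)
Definition witness_perm (i : 'I_n) : 'S_n := lift_perm ord0 (h i) 1%g.

Lemma witness_perm_ell (i c : 'I_n) (F : comNzRingType) (a : F) :
  (i.+1 < n)%N -> (c < i)%N -> ell a (perm_mx (witness_perm i)) c = 0.
Proof.
move=> i_n ci; rewrite /ell !mxE lift_perm_id.
have -> : ord_max = lift ord0 (ord_max : 'I_n'.+1) by exact/val_inj.
rewrite lift_perm_lift perm1 -!val_eqE /= (gtn_eqF (ltn_trans ci (indec_h i_n))).
rewrite mulr0 add0r gtn_eqF // (leq_trans (leq_trans ci _) (leq_addl _ _)) //.
Qed.

Lemma witness_perm_col (i r : 'I_n) (F : comNzRingType) :
  (0 < r)%N -> perm_mx (witness_perm i) r (h i) = 0 :> F.
Proof.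
move=> r0; rewrite !mxE; case: (unliftP ord0 r) r0 => [k ->|->//] _.
by rewrite lift_perm_lift eq_sym (negPf (neq_lift _ _)).
Qed.

Local Notation tofr := (@tofrac K : {rmorphism K -> {fraction K}}).

Lemma param_det_neq0 (i : 'I_n) : (i.+1 < n)%N -> param tau h i (\det X) != 0.
Proof.
move=> i_n; apply: (@param_witness i _ tofr (perm_mx (witness_perm i))) => //.
- by move=> c ci; exact: witness_perm_ell.
- by move=> r r0; apply: witness_perm_col.
by rewrite -det_map_mx evmx_generic det_perm signr_eq0.
Qed.

Lemma param_ell_neq0 (i : 'I_n) : (i.+1 < n)%N -> param tau h i (ell tauP X i) != 0.
Proof.
move=> i_n.
apply: (@param_witness i _ tofr (delta_mx ord_max i)) => //.
- move=> c ci; rewrite /ell !mxE /= mulr0 add0r.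
  by rewrite -[c == i]val_eqE (ltn_eqF ci) andbF.
- by move=> r r0; rewrite mxE -[h i == i]val_eqE (gtn_eqF (indec_h i_n)) andbF.
by rewrite ell_map evmx_generic /ell !mxE /= mulr0 add0r !eqxx oner_eq0.
Qed.

Lemma param_minor_neq0 (i j : 'I_n) : (i.+1 < n)%N -> (h j < h i)%N ->
  exists2 m, nminor X (h j).+1 m & param tau h i m != 0.
Proof.
move=> i_n hji; have hn := ltn_ord (h i).
have ln (a : 'I_(h j).+1) : (a < h i)%N by exact: leq_ltn_trans (leq_ord a) hji.
have an (a : 'I_(h j).+1) : (a.+1 < n)%N by exact: leq_ltn_trans (ln a) hn.
have an' (a : 'I_(h j).+1) : (a < n'.+1)%N by exact: an.
have an'' (a : 'I_(h j).+1) : (a < n)%N by exact: ltnW (an a).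
exists (\det (\matrix_(a < (h j).+1, b < (h j).+1) X (inord a.+1) (inord b))).
  exists (fun a => inord a.+1); split=> // [a b ab|a]; rewrite !inordK //.
apply: (@param_witness i _ tofr (perm_mx (witness_perm i))) => //.
- by move=> c ci; exact: witness_perm_ell.
- by move=> r r0; apply: witness_perm_col.
rewrite -det_map_mx [map_mx _ _](_ : _ = 1%:M) ?det1 ?oner_eq0 //.
apply/matrixP => a b; rewrite !mxE /= evmxX !mxE.
have -> : inord a.+1 = lift ord0 (inord a : 'I_n'.+1).
  by apply/val_inj; rewrite /= !inordK.
by rewrite lift_perm_lift perm1 -!val_eqE /= !inordK // /bump leqNgt ln.
Qed.

(** If [i < j], the form [l_i] is a generator for [j] outside the kernel for [i]. If [j < i], then
    [h j < h i] as [i] is least in its fiber, and some minor generating for [j] is outside that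
    kernel. *)
Lemma comp_index_inj (i j : 'I_n) : comp_index i -> comp_index j ->
  (forall x, comp_gens (ell tauP X) h X j x -> param tau h i x = 0) -> i = j.
Proof.
move=> /andP[i_n /forallP imin] _ ji; apply/val_inj.
case: (ltngtP i j) => // [ij|ji'].
  by have /eqP := ji _ (or_introl (ex_intro2 _ _ i ij erefl));
    rewrite (negPf (param_ell_neq0 i_n)).
have := imin j; rewrite ji' /= => /(param_minor_neq0 i_n)[m mm /eqP[]].
by apply: ji; right.
Qed.

End Witnesses.

(** The image of [f] times the determinant under [param] is a nonzero polynomial; parameters at
    which it does not vanish give the point. *)
Lemma comp_dense_point (F : fieldType) (e : nat -> F) (tau : F) (i : 'I_n)
    (f : {mpoly F[n * n]}) :
  injective e -> (i.+1 < n)%N -> param tau h i f != 0 ->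
  exists Z : 'M[F]_n, exists w, [/\ Z \in unitmx, comp_point tau h Z i w,
    w (h i) != 0 & f.@[mxvec Z 0] != 0].
Proof.
move=> e_inj i_n fi.
have := mulf_neq0 fi (param_det_neq0 tau i_n).
rewrite -rmorphM => /(mpoly_nonroot e_inj)[v].
pose g : {rmorphism {mpoly F[n * n]} -> F} := meval v.
pose Z := map_mx g (param_mx tau h i).
have gE p : g (param tau h i p) = p.@[mxvec Z 0].
  have ec : g \o @mpolyC _ F =1 idfun by move=> a /=; rewrite /g /= mevalC.
  by rewrite -evmx_meval paramE; exact: (evmx_comp _ _ ec).
rewrite -/(g _) gE mevalM mulf_eq0 negb_or => /andP[fZ dZ].
exists Z, (g \o param_weight F h i); split=> //.
- rewrite unitmxE unitfE; move: dZ.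
  by rewrite -evmx_meval -det_map_mx evmx_generic.
- have := comp_point_map g (param_mx_point tau indec_h i_n).
  by rewrite /g /= mevalC.
- by rewrite /= /param_weight ltnn eqxx rmorphN1 oppr_eq0 oner_eq0.
Qed.

End ComponentPoints.

(** * The Hessenberg ideal of a matrix of rank one *)

Lemma increasing_leq (m : nat) (f : 'I_m -> nat) (a b : 'I_m) :
  {homo f : i j / (i < j)%N} -> (a <= b)%N -> (f a + (b - a) <= f b)%N.
Proof.
move=> fi; case: b => b bm /= ab; rewrite -(subnK ab) in bm *.
elim: (b - a)%N bm => [|k IH] bm; rewrite addnK.
  by rewrite addn0 (_ : Ordinal _ = a) //; exact/val_inj.
have bm' : (k + a < m)%N by apply: ltn_trans bm; rewrite addSn.
have := IH bm'; rewrite addnK addnS => /leq_ltn_trans; apply.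
by apply: fi; rewrite /= addSn.
Qed.

Lemma increasing_full (m a : nat) (f : 'I_m -> nat) (k : 'I_m) :
  {homo f : i j / (i < j)%N} -> (forall i, (a <= f i < a + m)%N) -> f k = (a + k)%N.
Proof.
move=> fi fam; case: m f k fi fam => [f []//|m] f k fi fam.
apply/eqP; rewrite eqn_leq; apply/andP; split.
  have le := increasing_leq fi (leq_ord k : (k <= @ord_max m)%N).
  have /andP[_ lt] := fam ord_max; have := leq_ltn_trans le lt.
  rewrite /= addnS ltnS => {}lt; rewrite -(leq_add2r (m - k)) -addnA.
  by rewrite (subnKC (leq_ord k)).
have := increasing_leq fi (leq0n k : (@ord0 m <= k)%N); rewrite subn0.
by apply: leq_trans; rewrite leq_add2r; case/andP: (fam ord0).
Qed.

Lemma det_first_col (B : comNzRingType) k (M : 'M[B]_k.+1) :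
  (forall r, r != 0 -> M r 0 = 0) ->
  \det M = M 0 0 * \det (\matrix_(a < k, b < k) M (lift 0 a) (lift 0 b)).
Proof.
move=> M0; rewrite (expand_det_col M 0) (bigD1 0) //= big1 ?addr0 => [|r r0].
  rewrite /cofactor expr0 mul1r; congr (_ * _); congr (\det _).
  by apply/matrixP => a b; rewrite !mxE.
by rewrite M0 ?mul0r.
Qed.

Lemma det_zero_col (B : comNzRingType) k (M : 'M[B]_k) c :
  (forall r, M r c = 0) -> \det M = 0.
Proof.
by move=> M0; rewrite (expand_det_col M c) big1 // => r _; rewrite M0 mul0r.
Qed.

Section RankOneIdeal.
Variables (K : comNzRingType) (n' : nat).
Local Notation n := n'.+2.
Local Notation R := {mpoly K[n * n]}.
Local Notation X := (generic_mx K n).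
Variables (x : 'M[K]_n) (h : 'I_n -> 'I_n) (l : 'I_n -> R).
Hypothesis xX : forall r c, (map_mx (@mpolyC _ K) x *m X) r c = if r == 0 then l c else 0.

Let hess_lshift i r c : hess_mx x h i r (lshift _ c) =
  if r == 0 then l (widen_ord (ltn_ord i) c) else 0.
Proof. by rewrite row_mxEl mxE xX. Qed.

Let hess_rshift i r c : hess_mx x h i r (rshift _ c) = X r (widen_ord (ltn_ord (h i)) c).
Proof. by rewrite row_mxEr mxE. Qed.

(** The minor is bordered by row 0 and by column [c] of the left block; expansion along that column
    gives the product. *)
Lemma hess_minor (i c : 'I_n) m : (c <= i)%N -> nminor X (h i).+1 m ->
  minors (h i).+2 (hess_mx x h i) (l c * m).
Proof.
move=> ci [f [fi f0 ->]].
pose f' (a : 'I_(h i).+2) := if unlift 0 a is Some b then f b else 0.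
pose g (a : 'I_(h i).+2) : 'I_(i.+1 + (h i).+1) :=
  if unlift 0 a is Some b then rshift i.+1 b else lshift _ (Ordinal (ci : (c < i.+1)%N)).
exists f', g; split.
- move=> a b; rewrite /f'; case: unliftP => [a'|] ->; case: unliftP => [b'|] -> //= ab.
  exact: fi.
- move=> a b; rewrite /g; case: unliftP => [a'|] ->; case: unliftP => [b'|] -> //= ab.
    by rewrite ltn_add2l.
  exact: leq_trans (leq_addr _ _).
rewrite [RHS]det_first_col => [|r r0]; last first.
  rewrite mxE /f' /g unlift_none hess_lshift.
  case: unliftP r0 => [b ->|->] //; rewrite ?eqxx // => _.
  by rewrite -val_eqE /= gtn_eqF.
rewrite mxE /f' /g unlift_none hess_lshift eqxx.
rewrite (_ : widen_ord _ _ = c); last exact/val_inj.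
apply: (congr1 (fun M => l c * \det M)).
apply/matrixP => a b; rewrite [LHS]mxE [RHS]mxE [RHS]mxE !liftK hess_rshift !mxE.
by congr 'X_(mxvec_index _ _); apply/val_inj; rewrite /= inordK // (leq_trans (ltn_ord b)).
Qed.

(** The right block has [(h i).+1] columns, so a minor of size [(h i).+2] uses a column of the left
    block, and these are multiples of [e_1]. With two of them it vanishes; with one, all columns of
    the right block are used and expansion along the first column gives the product. *)
Lemma minor_hess (i : 'I_n) m : minors (h i).+2 (hess_mx x h i) m ->
  m = 0 \/ exists2 c : 'I_n, (c <= i)%N & exists2 m', nminor X (h i).+1 m' & m = l c * m'.
Proof.
move=> [f [g [fi gi ->]]].
have fi' : {homo (fun a => f a : nat) : a b / (a < b)%N} by [].
have gi' : {homo (fun a => g a : nat) : a b / (a < b)%N} by [].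
have g0 : (g ord0 < i.+1)%N.
  have := increasing_leq gi' (leq0n _ : (@ord0 (h i).+1 <= ord_max)%N).
  rewrite subn0 /= => le; have := leq_ltn_trans le (ltn_ord _).
  by rewrite ltn_add2r.
pose c0 := Ordinal g0; have gc0 : g ord0 = lshift _ c0 by exact/val_inj.
have fpos r : r != 0 -> f r != 0.
  move=> r0; rewrite -val_eqE /= -lt0n.
  by apply: leq_ltn_trans (fi ord0 r _); rewrite // lt0n.
rewrite det_first_col => [|r r0]; last by rewrite mxE gc0 hess_lshift (negPf (fpos r r0)).
rewrite mxE gc0 hess_lshift; case: eqP => [f00|_]; last by left; rewrite mul0r.
have [g1|g1] := ltnP (g (lift ord0 ord0)) i.+1.
  left; rewrite (det_zero_col (c := 0)) ?mulr0 // => r; rewrite mxE mxE.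
  have -> : g (lift 0 0) = lshift _ (Ordinal g1) by exact/val_inj.
  by rewrite hess_lshift (negPf (fpos (lift 0 r) _)).
right; exists (widen_ord (ltn_ord i) c0); first by rewrite /= -ltnS.
have gE (b : 'I_(h i).+1) : g (lift 0 b) = rshift i.+1 b.
  apply/val_inj; rewrite /= (@increasing_full _ i.+1 (fun b : 'I_(h i).+1 => g (lift 0 b))) //.
    by move=> a a' aa'; apply: gi.
  move=> a; rewrite ltn_ord andbT; apply: leq_trans g1 _.
  have := increasing_leq gi' (_ : (lift ord0 (@ord0 (h i)) <= lift ord0 a)%N).
  by rewrite /= /bump !leq0n !add1n ltnS => /(_ isT); apply: leq_trans (leq_addr _ _).
eexists; last by reflexivity.
exists (fun a => f (lift 0 a)); split.
- by move=> a b ab; apply: fi.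
- by move=> a; rewrite lt0n; apply: (fpos (lift 0 a)).
congr (\det _); apply/matrixP => a b; rewrite [LHS]mxE [LHS]mxE gE hess_rshift !mxE.
by congr 'X_(mxvec_index _ _); apply/val_inj; rewrite /= inordK // (leq_trans (ltn_ord b)).
Qed.

Lemma hess_idealE : hess_ideal x h = gen_ideal (hess_gens l h X).
Proof.
apply: ideal_eq => f; split.
  move=> [F FI ->]; apply: ideal_sum => i _; move: (FI i); rewrite /hess_ideal_at.
  case: ifP => [_ Fi|_ ->]; last exact: ideal_0.
  apply: (Fi (gen_ideal (hess_gens l h X))) => y /minor_hess[->|[c ci [m mm ->]]].
    exact: ideal_0.
  by apply: gen_ideal_sub; exists i, c; split=> //; exists m.
apply: gen_ideal_le => _ [i [c [ci [m mm ->]]]].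
exists (fun j => if j == i then l c * m else 0) => [j|]; last first.
  by rewrite (bigD1 i) //= eqxx big1 ?addr0 // => j /negPf->.
rewrite /hess_ideal_at; case: eqP => [->|_]; last first.
  by case: ifP => _; [exact: ideal_0|].
rewrite (nminor_size mm); apply: gen_ideal_sub; exact: hess_minor.
Qed.

End RankOneIdeal.

(** * Degeneration of the schemes *)

Lemma gen_ideal_iso (A B : comPzRingType) (f : {rmorphism A -> B})
    (g : {rmorphism B -> A}) (S : set A) (T : set B) :
  cancel f g -> (forall x, S x -> T (f x)) -> (forall y, T y -> S (g y)) ->
  forall x, gen_ideal S x <-> gen_ideal T (f x).
Proof.
move=> fK fS gT x; split=> [Sx|Tx].
  have le : ideal_le (gen_ideal S) (comap f (gen_ideal T)).
    by apply: gen_ideal_le => y /fS /gen_ideal_sub.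
  exact: le.
have le : ideal_le (gen_ideal T) (comap g (gen_ideal S)).
  by apply: gen_ideal_le => y /gT /gen_ideal_sub.
by have := le _ Tx; rewrite /= fK.
Qed.

Lemma rmorph_expM_eq0 (A : comPzRingType) (B : idomainType) (g : {rmorphism A -> B}) a b k :
  g a != 0 -> g (a ^+ k * b) = 0 -> g b = 0.
Proof.
move=> ga /eqP; rewrite rmorphM rmorphXn mulf_eq0 => /orP[|/eqP//].
by rewrite expf_eq0 (negPf ga) andbF.
Qed.

Lemma rmorph_compE (A B D : comPzRingType) (f : {rmorphism B -> D})
    (g : {rmorphism A -> B}) x : (f \o g : {rmorphism A -> D}) x = f (g x).
Proof. by []. Qed.

Section KernelSpec.
Variables (A : comPzRingType) (B : idomainType) (g : {rmorphism A -> B}).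

Fact kernel_proper : ~ comap g (zero_ideal B) 1.
Proof. by rewrite /= rmorph1 => /eqP; rewrite oner_eq0. Qed.

Fact kernel_prime a b : comap g (zero_ideal B) (a * b) ->
  comap g (zero_ideal B) a \/ comap g (zero_ideal B) b.
Proof. by rewrite /= rmorphM => /eqP; rewrite mulf_eq0 => /orP[]/eqP; [left|right]. Qed.

Definition kernel_spec : spec A := Spec kernel_proper kernel_prime.

Lemma kernel_specE x : kernel_spec x <-> g x = 0.
Proof. by []. Qed.

End KernelSpec.

Section SheetMatrix.
Variable n' : nat.
Local Notation n := n'.+2.

(* [tau s + E_1n]. *)
Definition sheet_mx (K : comNzRingType) (tau : K) : 'M[K]_n := \matrix_(r, c)
  if r == 0 then tau * (c == 0)%:R + (c == ord_max)%:R else 0.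

Lemma sheet_mx0 (C : fieldType) : mx_unit C n 1 n = sheet_mx 0.
Proof.
apply/matrixP => r c; rewrite !mxE mul0r add0r eqSS.
by rewrite -[r == 0]val_eqE; case: (val r == 0%N).
Qed.

Lemma sheet_mxX (C : fieldType) :
  'X *: map_mx polyC (diag_first n 1 0) + map_mx polyC (mx_unit C n 1 n)
  = sheet_mx 'X.
Proof.
apply/matrixP => r c; rewrite sheet_mx0 !mxE.
have [->|r0] := eqVneq r 0.
  rewrite mul0r add0r eqxx eq_sym; congr (_ * _ + _); last by case: eqP.
  by case: (c == 0).
case: ifP => [/eqP e|_]; last by rewrite mul0rn polyC0 mulr0 addr0.
by case/eqP: r0; apply/val_inj.
Qed.

Section Ideals.
Variables (K : comNzRingType) (h : 'I_n -> 'I_n).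
Local Notation X := (generic_mx K n).

Lemma sheet_mx_ell (tau : K) r c : (map_mx (@mpolyC _ K) (sheet_mx tau) *m X) r c =
  if r == 0 then ell tau%:MP X c else 0.
Proof.
rewrite mxE; case: eqP => [->|/eqP r0]; last first.
  by rewrite big1 // => k _; rewrite !mxE (negPf r0) mpolyC0 mul0r.
rewrite (bigD1 0) //= (bigD1 ord_max) //= big1 ?addr0 => [|k /andP[k0 km]].
  by rewrite /ell !mxE !eqxx /= mulr1 mulr0 add0r addr0 mpolyC1 mul1r.
by rewrite !mxE eqxx (negPf k0) (negPf km) mulr0 addr0 mpolyC0 mul0r.
Qed.

Lemma hess_ideal_sheet tau :
  hess_ideal (sheet_mx tau) h = gen_ideal (hess_gens (ell tau%:MP X) h X).
Proof. by apply: hess_idealE => r c; exact: sheet_mx_ell. Qed.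

End Ideals.

Lemma hess_ideal_diag (C : fieldType) (h : 'I_n -> 'I_n) :
  hess_ideal (diag_first n (1 : C) 0) h
  = gen_ideal (hess_gens (generic_mx C n 0) h (generic_mx C n)).
Proof.
apply: hess_idealE => r c; rewrite mxE (bigD1 r) //= big1 ?addr0 => [|k kr].
  rewrite !mxE eqxx mulr1n -val_eqE; case: eqP => [r0|_]; last by rewrite mpolyC0 mul0r.
  by rewrite mpolyC1 mul1r; congr 'X_(mxvec_index _ _); exact/val_inj.
by rewrite !mxE [r == k]eq_sym (negPf kr) mulr0n mpolyC0 mul0r.
Qed.

Section Saturation.
Variables (K : idomainType) (h : 'I_n -> 'I_n) (tau : K).
Hypotheses (hess_h : hessenberg h) (indec_h : indecomposable h).
Local Notation X := (generic_mx K n).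

(** The ideal is an intersection of kernels of morphisms into a domain, none of which kills the
    determinant. *)
Lemma hess_scheme_sheet :
  hess_scheme (sheet_mx tau) h = gen_ideal (hess_gens (ell tau%:MP X) h X).
Proof.
apply: ideal_eq => f; rewrite /hess_scheme hess_ideal_sheet; split=> [[k]|If]; last first.
  by exists 0%N; rewrite expr0 mul1r.
have [E _] := hess_gensP tau hess_h indec_h.
move/E => kf; apply/E => i i_n.
exact: rmorph_expM_eq0 (param_det_neq0 indec_h tau i_n) (kf i i_n).
Qed.

End Saturation.

End SheetMatrix.

Section Degeneration.
Variables (C : fieldType) (n' : nat).
Local Notation n := n'.+2.
Variable h : 'I_n -> 'I_n.
Hypotheses (hess_h : hessenberg h) (indec_h : indecomposable h).
Local Notation X := (generic_mx C n).
Local Notation Xt := (generic_mx {poly C} n).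
Local Notation R := {mpoly C[n * n]}.

Section Fiber.
Variable a : C.

Definition at_t : {rmorphism {mpoly {poly C}[n * n]} -> R} := map_mpoly (horner_eval a).

Lemma fiber_gen (S : set {mpoly {poly C}[n * n]}) (T : set R) :
  (forall x, S x -> T (at_t x)) -> (forall y, T y -> exists2 x, S x & y = at_t x) ->
  fiber a (gen_ideal S) = gen_ideal T.
Proof.
move=> ST TS; apply: ideal_eq => f; split=> [[F SF ->]|Tf].
  have le : ideal_le (gen_ideal S) (comap at_t (gen_ideal T)).
    by apply: gen_ideal_le => x /ST /gen_ideal_sub.
  exact: le.
apply: (Tf (fiber a (gen_ideal S))) => y /TS[x Sx ->].
by exists x => //; exact: gen_ideal_sub.
Qed.

Lemma at_t_generic : map_mx at_t Xt = X.
Proof. by apply/matrixP => r c; rewrite !mxE /at_t /= map_mpolyX. Qed.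

Lemma at_t_ell c : at_t (ell 'X%:MP Xt c) = ell a%:MP X c.
Proof.
rewrite ell_map at_t_generic; congr (ell _ _ _).
by rewrite /at_t /= map_mpolyC /= horner_evalE hornerX.
Qed.

Lemma nminor_at_t k m : nminor X k m -> exists2 m', nminor Xt k m' & m = at_t m'.
Proof.
move=> [f [fi f0 ->]]; exists (\det (\matrix_(b < k, b' < k) Xt (f b) (inord b'))).
  by exists f.
rewrite -det_map_mx; congr (\det _); apply/matrixP => b b'.
by rewrite mxE [RHS]mxE [in RHS]mxE -at_t_generic [LHS]mxE.
Qed.

Lemma fiber_hess : fiber a (gen_ideal (hess_gens (ell 'X%:MP Xt) h Xt))
  = gen_ideal (hess_gens (ell a%:MP X) h X).
Proof.
apply: fiber_gen => [x /(hess_gens_map at_t_ell)|_ [i [c [ci [m mm ->]]]]].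
  by rewrite at_t_generic.
have [m' mm' ->] := nminor_at_t mm; exists (ell 'X%:MP Xt c * m').
  by exists i, c; split=> //; exists m'.
by rewrite rmorphM at_t_ell.
Qed.

Lemma fiber_comp i : fiber a (gen_ideal (comp_gens (ell 'X%:MP Xt) h Xt i))
  = gen_ideal (comp_gens (ell a%:MP X) h X i).
Proof.
apply: fiber_gen => [x /(comp_gens_map at_t_ell)|x [[c ci ->]|mm]].
- by rewrite at_t_generic.
- by exists (ell 'X%:MP Xt c); [left; exists c|rewrite at_t_ell].
- by have [m' mm' ->] := nminor_at_t mm; exists m' => //; right.
Qed.

End Fiber.

Section Twist.
Variable a : C.
Hypothesis a0 : a != 0.

(* The row operation [z_1 |-> a z_1 + z_n] carries [s] to [s_a]. *)
Definition twist_mx : 'M[R]_n := \matrix_(r, c) if r == 0 then ell a%:MP X c else X r c.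
Definition untwist_mx : 'M[R]_n := \matrix_(r, c)
  if r == 0 then a^-1%:MP * (X 0 c - X ord_max c) else X r c.
Definition twist : {rmorphism R -> R} := evmx (@mpolyC _ C) twist_mx.
Definition untwist : {rmorphism R -> R} := evmx (@mpolyC _ C) untwist_mx.

Lemma map_twist : map_mx twist X = twist_mx.
Proof. exact: evmx_generic. Qed.

Lemma map_untwist : map_mx untwist X = untwist_mx.
Proof. exact: evmx_generic. Qed.

Lemma twistX r c : twist (X r c) = twist_mx r c.
Proof. by rewrite -map_twist [RHS]mxE. Qed.

Lemma untwistX r c : untwist (X r c) = untwist_mx r c.
Proof. by rewrite -map_untwist [RHS]mxE. Qed.

Lemma twist_ell c : twist (X 0 c) = ell a%:MP X c.
Proof. by rewrite twistX mxE. Qed.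

Lemma untwist_ell c : untwist (ell a%:MP X c) = X 0 c.
Proof.
rewrite /ell rmorphD rmorphM /= !untwistX evmxC !mxE /=.
by rewrite mulrA -mpolyCM divff // mpolyC1 mul1r subrK.
Qed.

Lemma twistK : cancel twist untwist.
Proof.
apply: (mpoly_rmorph_eq (F := untwist \o twist) (G := idfun)) => [b|k] /=.
  by rewrite !evmxC.
case/mxvec_indexP: k => r c; rewrite evmxX [twist_mx _ _]mxE.
have [->|r0] := eqVneq r 0; first by rewrite [evmx _ _ _]untwist_ell mxE.
by rewrite [evmx _ _ _]untwistX mxE (negPf r0) mxE.
Qed.

Lemma untwistK : cancel untwist twist.
Proof.
apply: (mpoly_rmorph_eq (F := twist \o untwist) (G := idfun)) => [b|k] /=.
  by rewrite !evmxC.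
case/mxvec_indexP: k => r c; rewrite evmxX [untwist_mx _ _]mxE.
have [->|r0] := eqVneq r 0; last by rewrite [evmx _ _ _]twistX mxE (negPf r0) mxE.
rewrite rmorphM rmorphB /= evmxC [evmx _ _ (X 0 c)]twist_ell.
rewrite [evmx _ _ (X ord_max c)]twistX [twist_mx _ _]mxE /= /ell addrK.
by rewrite mulrA -mpolyCM mulVf // mpolyC1 mul1r mxE.
Qed.

Lemma untwistZ : scalable untwist.
Proof. by move=> b f; rewrite /untwist /= evmxZ mul_mpolyC. Qed.

Lemma nminor_row (Z Z' : 'M[R]_n) k m : (forall r c, r != 0 -> Z r c = Z' r c) ->
  nminor Z k m -> nminor Z' k m.
Proof.
move=> ZZ' [f [fi f0 ->]]; exists f; split=> //; congr (\det _).
by apply/matrixP => b b'; rewrite !mxE ZZ' // -val_eqE -lt0n f0.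
Qed.

Lemma twist_nminor k m : nminor X k m -> nminor X k (twist m).
Proof.
move/(nminor_map twist); rewrite map_twist.
by apply: nminor_row => r c r0; rewrite mxE (negPf r0).
Qed.

Lemma untwist_nminor k m : nminor X k m -> nminor X k (untwist m).
Proof.
move/(nminor_map untwist); rewrite map_untwist.
by apply: nminor_row => r c r0; rewrite mxE (negPf r0).
Qed.

Lemma twist_hess f : gen_ideal (hess_gens (X 0) h X) f <->
  gen_ideal (hess_gens (ell a%:MP X) h X) (twist f).
Proof.
apply: (gen_ideal_iso twistK) => _ [i [c [ci [m mm ->]]]]; exists i, c; split=> //.
  by exists (twist m); [exact: twist_nminor|rewrite rmorphM twist_ell].
by exists (untwist m); [exact: untwist_nminor|rewrite rmorphM untwist_ell].
Qed.

Lemma twist_comp i f : gen_ideal (comp_gens (X 0) h X i) f <->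
  gen_ideal (comp_gens (ell a%:MP X) h X i) (twist f).
Proof.
apply: (gen_ideal_iso twistK) => x [[c ci ->]|mm].
- by left; exists c; rewrite ?twist_ell.
- by right; exact: twist_nminor.
- by left; exists c; rewrite ?untwist_ell.
- by right; exact: untwist_nminor.
Qed.

Lemma twist_iso (S T : ideal R) : (forall f, S f <-> T (twist f)) -> quot_alg_iso T S.
Proof.
move=> ST; apply: (quot_alg_isoP untwistZ twistK) => x.
by rewrite ST untwistK.
Qed.

End Twist.

End Degeneration.

#[global] Opaque twist untwist.

(** * Irreducible components of the schemes *)

Section SchemeComponents.
Variables (C : fieldType) (n' : nat).
Local Notation n := n'.+2.
Variable h : 'I_n -> 'I_n.
Hypotheses (hess_h : hessenberg h) (indec_h : indecomposable h).
Local Notation X := (generic_mx C n).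
Local Notation R := {mpoly C[n * n]}.
Local Notation s := (diag_first n (1 : C) 0).

(** For [a = 1] the twist is left multiplication by a unipotent matrix. *)
Lemma det_twist : twist n' (1 : C) (\det X) = \det X.
Proof.
pose P : 'M[C]_n := 1%:M + delta_mx 0 ord_max.
have -> : twist n' 1 (\det X) = \det (map_mx (@mpolyC _ C) P *m X).
  rewrite -det_map_mx map_twist; congr (\det _); apply/matrixP => r c.
  rewrite [LHS]mxE [RHS]mxE.
  have PE k : map_mx (@mpolyC _ C) P r k
      = ((r == k)%:R + ((r == 0) && (k == ord_max))%:R)%:MP by rewrite !mxE.
  have [r0|r0] := eqVneq r 0.
    rewrite (bigD1 0) //= (bigD1 ord_max) //= big1 ?addr0 => [|k /andP[k0 km]].
      by rewrite !PE r0 !eqxx /= addr0 add0r mpolyC1 /ell !mul1r.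
    by rewrite PE r0 eq_sym (negPf k0) (negPf km) andbF addr0 mpolyC0 mul0r.
  rewrite (bigD1 r) //= big1 ?addr0 => [|k kr].
    by rewrite PE eqxx (negPf r0) addr0 mpolyC1 mul1r.
  by rewrite PE eq_sym (negPf kr) (negPf r0) addr0 mpolyC0 mul0r.
have detP : \det P = 1.
  rewrite -det_tr det_trig.
    rewrite big1 // => k _; rewrite !mxE eqxx -[RHS]addr0; congr (_ + _).
    by case: eqP => [->|].
  apply/is_trig_mxP => i j ij; rewrite !mxE -!val_eqE (gtn_eqF ij) /=.
  by rewrite gtn_eqF ?add0r // (leq_ltn_trans _ ij).
by rewrite det_mulmx det_map_mx detP rmorph1 mul1r.
Qed.

(** The locus for [s] is parametrized through that for [s + E_1n], by the twist with [a = 1]. *)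
Definition param_diag i : {rmorphism R -> R} := param 1 h i \o twist n' 1.

Lemma param_diagE i x : param_diag i x = param 1 h i (twist n' 1 x).
Proof. exact: rmorph_compE. Qed.

Opaque param_diag.

Lemma hess_scheme_diag : hess_scheme s h = gen_ideal (hess_gens (X 0) h X).
Proof.
have one0 : 1 != 0 :> C by exact: oner_neq0.
apply: ideal_eq => f; rewrite /hess_scheme hess_ideal_diag; split=> [[k]|If]; last first.
  by exists 0%N; rewrite expr0 mul1r.
move=> If; have kf := (twist_hess h one0 (\det X ^+ k * f)).1 If.
apply/(proj2 (twist_hess h one0 f)).
have [E _] := hess_gensP (1 : C) hess_h indec_h.
apply/(proj2 (E _)) => i i_n.
have d0 : param_diag i (\det X) != 0.
  rewrite param_diagE; apply: (eq_ind_r (fun y => param (1 : C) h i y != 0)) det_twist.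
  exact: param_det_neq0.
have fk : param_diag i (\det X ^+ k * f) = 0.
  by rewrite param_diagE; exact: (E _).1 kf i i_n.
by have := rmorph_expM_eq0 d0 fk; rewrite param_diagE.
Qed.

Lemma hess_scheme_degeneration :
  flat_degeneration (hess_scheme (sheet_mx n' 'X) h) (hess_scheme s h)
    (hess_scheme (sheet_mx n' (0 : C)) h).
Proof.
rewrite [X in flat_degeneration X _ _](hess_scheme_sheet ('X : {poly C}) hess_h indec_h).
rewrite [X in flat_degeneration _ X _]hess_scheme_diag.
rewrite [X in flat_degeneration _ _ X](hess_scheme_sheet (0 : C) hess_h indec_h).
split; last exact: fiber_hess.
  exact: (hess_gensP 'X hess_h indec_h).2.
move=> a a0; rewrite fiber_hess; apply: (twist_iso a0) => f; exact: twist_hess.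
Qed.

(* The ideal of the closure of the locus where [l] vanishes on the first [i]
   columns and [e_1] lies in the span of the first [h i] columns. *)
Definition comp_spec (tau : C) i : spec R := kernel_spec (param tau h i).
Definition comp_spec_diag i : spec R := kernel_spec (param_diag i).

Lemma comp_specE tau i : comp_index h i ->
  comp_spec tau i = gen_ideal (comp_gens (ell tau%:MP X) h X i) :> ideal R.
Proof.
move=> /comp_index_lt i_n; apply: ideal_eq => f.
by rewrite ((comp_idealP tau hess_h indec_h i_n).1 f).
Qed.

Lemma comp_spec_diagE i : comp_index h i ->
  comp_spec_diag i = gen_ideal (comp_gens (X 0) h X i) :> ideal R.
Proof.
move=> /comp_index_lt i_n; apply: ideal_eq => f.
have tw := twist_comp h (oner_neq0 C) i f.
have E := (comp_idealP (1 : C) hess_h indec_h i_n).1 (twist n' 1 f).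
split=> [/kernel_specE|/tw.1/E.1 e]; last by apply/kernel_specE; rewrite param_diagE.
by rewrite param_diagE => /E.2/tw.2.
Qed.

Lemma comp_spec_inj tau i j : comp_index h i -> comp_index h j ->
  ideal_le (comp_spec tau j) (comp_spec tau i) -> i = j.
Proof.
move=> ii jj le; apply: (comp_index_inj indec_h (tau := tau) ii jj) => x xj.
have xj' : comp_spec tau j x by rewrite comp_specE //; exact: gen_ideal_sub.
exact: le x xj'.
Qed.

Lemma comp_spec_diag_inj i j : comp_index h i -> comp_index h j ->
  ideal_le (comp_spec_diag j) (comp_spec_diag i) -> i = j.
Proof.
have one0 : 1 != 0 :> C by exact: oner_neq0.
move=> ii jj le; apply: (comp_index_inj indec_h (tau := (1 : C)) ii jj) => x xj.
have u : twist n' 1 (untwist n' 1 x) = x := untwistK one0 x.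
have xj' : comp_spec_diag j (untwist n' 1 x).
  rewrite comp_spec_diagE //; apply/(proj2 (twist_comp h one0 j _)).
  by apply: gen_ideal_sub; exact: (eq_ind_r (fun y => comp_gens _ h X j y) xj u).
have := (kernel_specE _ _).1 (le _ xj'); rewrite param_diagE => e.
exact: (eq_ind _ (fun y => param (1 : C) h i y = 0) e _ u).
Qed.

Lemma irr_components_sheet tau :
  irr_components (@spec_closed _) (zero_locus (hess_scheme (sheet_mx n' tau) h))
  = (fun i => zero_locus (comp_spec tau i)) @` [set` comp_index h].
Proof.
rewrite (hess_scheme_sheet tau hess_h indec_h); apply: irr_components_zero_locus.
- move=> i /comp_index_lt i_n x /=.
  by move=> If; exact: ((hess_gensP tau hess_h indec_h).1 x).1 If _ i_n.
- move=> q Iq; have [|i ii qi] := @prime_comp n' h hess_h indec_h _ q (ell tau%:MP X) X.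
    by move=> x /gen_ideal_sub /Iq.
  by exists i => //; rewrite comp_specE //; exact: gen_ideal_le.
- exact: comp_spec_inj.
Qed.

Lemma irr_components_diag :
  irr_components (@spec_closed _) (zero_locus (hess_scheme s h))
  = (fun i => zero_locus (comp_spec_diag i)) @` [set` comp_index h].
Proof.
have one0 : 1 != 0 :> C by exact: oner_neq0.
rewrite hess_scheme_diag; apply: irr_components_zero_locus.
- move=> i /comp_index_lt i_n x If; apply/kernel_specE; rewrite param_diagE.
  exact: ((hess_gensP (1 : C) hess_h indec_h).1 _).1 ((twist_hess h one0 x).1 If) _ i_n.
- move=> q Iq; have [|i ii qi] := @prime_comp n' h hess_h indec_h _ q (X 0) X.
    by move=> x /gen_ideal_sub /Iq.
  by exists i => //; rewrite comp_spec_diagE //; exact: gen_ideal_le.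
- exact: comp_spec_diag_inj.
Qed.

Lemma zero_locus_spec_inj (A : comPzRingType) (p q : spec A) :
  zero_locus p = zero_locus q -> ideal_le p q.
Proof. by move=> pq; have : zero_locus p q by rewrite pq. Qed.

Lemma scheme_components_bij :
  exists Phi : set (spec R) -> set (spec R),
    set_bij
      (irr_components (@spec_closed _) (zero_locus (hess_scheme s h)))
      (irr_components (@spec_closed _) (zero_locus (hess_scheme (sheet_mx n' 0) h))) Phi /\
    (forall Z, irr_components (@spec_closed _) (zero_locus (hess_scheme s h)) Z ->
       exists2 W : ideal {mpoly {poly C}[n * n]},
         ideal_le (hess_scheme (sheet_mx n' 'X) h) W
       & flat_degeneration W (vanishing Z) (vanishing (Phi Z))).
Proof.
have one0 : 1 != 0 :> C by exact: oner_neq0.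
have inj_diag : set_inj [set` comp_index h] (fun i => zero_locus (comp_spec_diag i)).
  move=> i j; rewrite !inE => ii jj /esym/zero_locus_spec_inj.
  exact: comp_spec_diag_inj.
have inj_nilp : set_inj [set` comp_index h] (fun i => zero_locus (comp_spec 0 i)).
  move=> i j; rewrite !inE => ii jj /esym/zero_locus_spec_inj.
  exact: comp_spec_inj.
have ne : [set` comp_index h] !=set0.
  by have [i ii] := comp_index_exists hess_h; exists i; exact: ii.
have [Phi [bij PhiE surj]] :=
  image_set_bij irr_components_diag (irr_components_sheet 0) inj_diag inj_nilp ne.
exists Phi; split=> // _ /surj[i ii ->].
have i_n := comp_index_lt ii.
have [compE compflat] := comp_idealP ('X : {poly C}) hess_h indec_h i_n.
exists (gen_ideal (comp_gens (ell 'X%:MP (generic_mx {poly C} n)) h (generic_mx {poly C} n) i)).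
  rewrite (hess_scheme_sheet ('X : {poly C}) hess_h indec_h) => x.
  by move/(hess_gensP ('X : {poly C}) hess_h indec_h).1 => /(_ i i_n) /compE.
have vD : vanishing (zero_locus (comp_spec_diag i)) = gen_ideal (comp_gens (X 0) h X i).
  by rewrite vanishing_prime; exact: comp_spec_diagE.
have vN : vanishing (Phi (zero_locus (comp_spec_diag i)))
    = gen_ideal (comp_gens (ell 0%:MP X) h X i).
  by rewrite (PhiE i ii) vanishing_prime; exact: comp_specE.
apply: (eq_ind_r (fun y => flat_degeneration _ y _)) vD.
apply: (eq_ind_r (fun y => flat_degeneration _ _ y)) vN.
split=> //; last exact: fiber_comp.
move=> a a0; apply: (eq_ind_r (fun y => quot_alg_iso y _)) (fiber_comp h a i).
apply: (twist_iso a0) => f; exact: twist_comp.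
Qed.

End SchemeComponents.

(** * Hessenberg varieties *)

Section Flags.
Variables (C : fieldType) (n : nat).
Implicit Types (g : 'M[C]_n) (F : flag C n) (v : 'cV[C]_n) (i j c : 'I_n).

Lemma mulmx_col_sum g v : g *m v = \sum_j v j 0 *: col j g.
Proof.
apply/matrixP => r k; rewrite ord1 summxE mxE; apply: eq_bigr => j _.
by rewrite !mxE mulrC.
Qed.

Lemma invmx_col g i j : g \in unitmx -> (invmx g *m col j g) i 0 = (i == j)%:R.
Proof. by move=> gu; rewrite colE mulmxA mulVmx // mul1mx mxE eqxx andbT. Qed.

Lemma span_cols_coord g (s : seq 'I_n) v c : g \in unitmx ->
  v \in <<[seq col j g | j <- s]>>%VS -> c \notin s -> (invmx g *m v) c 0 = 0.
Proof.
move=> gu; elim: s v => [v|j s IH v] /=.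
  by rewrite span_nil memv0 => /eqP->; rewrite mulmx0 mxE.
rewrite span_cons => /memv_addP[_ /vlineP[k ->] [v' /IH v's ->]].
rewrite inE negb_or => /andP[cj cs].
by rewrite mulmxDr -scalemxAr mxE v's // addr0 mxE invmx_col // (negPf cj) mulr0.
Qed.

Lemma free_cols g (s : seq 'I_n) : g \in unitmx -> uniq s ->
  free [seq col j g | j <- s].
Proof.
move=> gu; elim: s => [|j s IH] /=; first by rewrite nil_free.
case/andP=> js us; rewrite free_cons IH // andbT; apply/negP => /span_cols_coord.
by move=> /(_ _ gu js)/eqP; rewrite invmx_col // eqxx oner_eq0.
Qed.

Let upto i := [seq j : 'I_n <- enum 'I_n | (j <= i)%N].

Lemma mem_upto i j : (j \in upto i) = (j <= i)%N.
Proof. by rewrite mem_filter mem_enum andbT. Qed.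

Lemma size_upto i : size (upto i) = i.+1.
Proof.
have le : (i < n)%N := ltn_ord i.
rewrite size_filter -sum1_count big_enum_cond /=.
rewrite (eq_bigl (fun j : 'I_n => (j < i.+1)%N)) // (big_ord_narrow le) sum_nat_const.
by rewrite card_ord muln1.
Qed.

Lemma dim_span_cols g i : g \in unitmx ->
  \dim <<[seq col j g | j <- upto i]>> = i.+1.
Proof.
move=> gu; have /eqP -> : free [seq col j g | j <- upto i].
  by apply: free_cols => //; rewrite filter_uniq // enum_uniq.
by rewrite size_map size_upto.
Qed.

Lemma flag_of_unitmx g : g \in unitmx -> exists F, flag_of_mx g F.
Proof.
move=> gu.
have sub i j : (i <= j)%N ->
    (<<[seq col k g | k <- upto i]>> <= <<[seq col k g | k <- upto j]>>)%VS.
  move=> ij; apply: sub_span => _ /mapP[k ki ->]; apply: map_f.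
  by rewrite mem_upto (leq_trans _ ij) // -mem_upto.
by exists (Flag (fun i => dim_span_cols i gu) sub).
Qed.

Lemma mem_flag_of_mx g F i v : g \in unitmx -> flag_of_mx g F ->
  v \in F i <-> forall c, (i < c)%N -> (invmx g *m v) c 0 = 0.
Proof.
move=> gu gF; rewrite gF -/(upto i); split=> [vi c ic|v0].
  by apply: span_cols_coord vi _ => //; rewrite mem_upto -ltnNge.
rewrite -[v](mulKVmx gu) mulmx_col_sum; apply: memv_suml => c _.
have [ci|ic] := leqP c i; last by rewrite v0 // scale0r mem0v.
by apply: memvZ; apply: memv_span; apply: map_f; rewrite mem_upto.
Qed.

(** Column [i] is a vector of [F i] outside the preceding subspace. *)
Lemma flag_of_mx_exists F : exists2 g, g \in unitmx & flag_of_mx g F.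
Proof.
have pick i : exists v (W : {vspace 'cV[C]_n}), [/\ v \in F i, v \notin W
    & forall j, (j < i)%N -> (F j <= W)%VS].
  have [W [dW FW]] : exists W : {vspace 'cV[C]_n},
      \dim W = i /\ forall j, (j < i)%N -> (F j <= W)%VS.
    case: i => [[|k] k_n] /=; first by exists 0%VS; rewrite dimv0.
    exists (F (Ordinal (ltnW k_n))); split=> [|j jk]; first by rewrite flag_dim.
    exact: flag_sub.
  have /subvPn[v vF vW] : ~~ (F i <= W)%VS.
    by apply/negP => /dimvS; rewrite flag_dim dW ltnn.
  by exists v, W.
have [v] := choice pick; move=> /choice[W vW].
pose g : 'M[C]_n := \matrix_(r, c) v c r 0.
have gE c : col c g = v c by apply/matrixP => r k; rewrite ord1 !mxE.
have gu : g \in unitmx.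
  rewrite unitmxE unitfE -det_tr; apply/det0P => -[w w0 /(congr1 trmx)].
  rewrite trmx_mul trmxK trmx0 mulmx_col_sum => sum0.
  have [c0 wc0] : exists c, w 0 c != 0.
    apply/existsP; apply: contraNT w0; rewrite negb_exists => /forallP w0.
    by apply/eqP/rowP => c; rewrite mxE; apply/eqP; have := w0 c; rewrite negbK.
  (* In a linear relation, the vector with the largest index would lie in the preceding subspace. *)
  have [c wc cmax] := @arg_maxnP _ c0 (fun c => w 0 c != 0) val wc0.
  have [vF /negP nW FW] := vW c; apply: nW.
  have := sum0; rewrite (bigD1 c) //= => /eqP; rewrite addrC addr_eq0 => /eqP e.
  rewrite -[v c](scalerK wc) -[w 0 c *: v c]opprK -gE.
  have -> : - (w 0 c *: col c g) = \sum_(j < n | j != c) w^T j 0 *: col j g.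
    by rewrite e mxE.
  apply: memvZ; rewrite memvN; apply: memv_suml => j jc.
  have [wj|wj] := eqVneq (w 0 j) 0; first by rewrite mxE wj scale0r mem0v.
  have jc' : (j < c)%N by rewrite ltn_neqAle jc; exact: cmax.
  by apply: memvZ; rewrite gE; apply: (subvP (FW j jc')); have [] := vW j.
exists g => // i; apply/esym/eqP; rewrite eqEdim flag_dim dim_span_cols // leqnn andbT.
apply/span_subvP => _ /mapP[j ji ->]; rewrite gE; rewrite mem_upto in ji.
by apply: (subvP (flag_sub F ji)); have [] := vW j.
Qed.

Lemma mem_flag_max F i v : i.+1 = n -> v \in F i.
Proof.
move=> i_n; suff -> : F i = fullv by exact: memvf.
by apply/eqP; rewrite eqEdim subvf dimvf flag_dim i_n dim_matrix mulr1 leqnn.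
Qed.

End Flags.

Section FlagTopology.
Variables (C : fieldType) (n : nat).

Lemma flag_closed0 : @flag_closed C n set0.
Proof.
exists [set 1] => g F _ _; split=> // /(_ 1 erefl) /eqP.
by rewrite meval1 oner_eq0.
Qed.

Lemma flag_closedU (X Y : set (flag C n)) :
  flag_closed X -> flag_closed Y -> flag_closed (X `|` Y).
Proof.
move=> [S XS] [T YT].
exists [set f | exists p q, [/\ S p, T q & f = p * q]] => g F gu gF; split.
  move=> XY f [p [q [Sp Tq ->]]]; rewrite mevalM.
  case: XY => [/(XS g F gu gF)/(_ p Sp)->|/(YT g F gu gF)/(_ q Tq)->].
    by rewrite mul0r.
  by rewrite mulr0.
move=> ST; apply: contrapT => nXY; apply: nXY.
have [Sg|nSg] := pselect (forall p, S p -> p.@[mxvec g 0] = 0).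
  by left; apply/(XS g F gu gF).
right; apply/(YT g F gu gF) => q Tq; apply/eqP.
have [p /not_implyP[Sp /eqP pg]] := (existsNP _).2 nSg.
have := ST _ (ex_intro _ p (ex_intro _ q (And3 Sp Tq erefl))).
by rewrite mevalM => /eqP; rewrite mulf_eq0 (negPf pg).
Qed.

(** Here [x v = a v + k phi(v) u], and [a v] lies in [F (h i)] already. So either [phi] vanishes on
    [F i] or [u] itself must lie in [F (h i)]. *)
Lemma hess_variety_rank1 (a k : C) (u : 'cV[C]_n) (phi : 'rV[C]_n) h F : k != 0 ->
  hessenberg h ->
  hess_variety (a%:M + k *: (u *m phi)) h F <->
  forall i, (forall v, v \in F i -> phi *m v = 0) \/ u \in F (h i).
Proof.
move=> k0 hess_h; set x := _ + _.
have xv v : x *m v = a *: v + (k * (phi *m v) 0 0) *: u.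
  rewrite mulmxDl mul_scalar_mx -scalemxAl -mulmxA {1}[phi *m v]mx11_scalar.
  by rewrite mul_mx_scalar scalerA.
have Fh i v : v \in F i -> v \in F (h i).
  exact: (subvP (flag_sub F (hess_h.2 i))).
split=> H i.
  have [uF|uF] := boolP (u \in F (h i)); [by right|left=> v vF].
  have : x *m v \in F (h i).
    by have := memv_img (linfun (mulmx x)) vF; rewrite lfunE; exact: (subvP (H i)).
  rewrite xv rpredDl => [kv|]; last by apply: memvZ; exact: Fh.
  rewrite [LHS]mx11_scalar.
  have [->|kp] := eqVneq ((phi *m v) 0 0) 0; first by rewrite raddf0.
  by case/negP: uF; rewrite -(scalerK (mulf_neq0 k0 kp) u); exact: memvZ.
apply/subvP => _ /memv_imgP[v vF ->]; rewrite lfunE /= xv.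
apply: memvD; first by apply: memvZ; exact: Fh.
by case: (H i) => [->//|uF]; [rewrite mxE mulr0 scale0r mem0v|exact: memvZ].
Qed.

End FlagTopology.

(** * Components of the Hessenberg variety of a conjugate, scaled and translated, of
    [tau s + E_1n] *)

Section FlagComponents.
Variables (C : fieldType) (n' : nat).
Local Notation n := n'.+2.
Variable h : 'I_n -> 'I_n.
Hypotheses (hess_h : hessenberg h) (indec_h : indecomposable h).
Variables (tau : C) (g0 : 'M[C]_n).
Hypothesis g0u : g0 \in unitmx.
Local Notation X := (generic_mx C n).
Local Notation R := {mpoly C[n * n]}.
Local Notation phi := (row 0 (sheet_mx n' tau) *m g0).
Local Notation u := (invmx g0 *m delta_mx 0 0 : 'cV[C]_n).
(** For invertible [Z], the combination of its columns equal to [e_1] has the first column of the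
    inverse as coefficients. *)
Local Notation pt Z i := (comp_point tau h Z i (fun c => invmx Z c 0)).

Lemma sheet_mx_rank1 :
  invmx g0 *m sheet_mx n' tau *m g0 = u *m phi.
Proof.
rewrite !mulmxA; congr (_ *m _); rewrite -!mulmxA; congr (_ *m _).
apply/matrixP => r c; rewrite [RHS]mxE big_ord1 !mxE eqxx andbT.
by case: eqP; rewrite ?mul1r ?mul0r.
Qed.

Lemma phi_col g j : phi *m col j g = (ell tau (g0 *m g) j)%:M.
Proof.
rewrite -mulmxA (_ : g0 *m _ = col j (g0 *m g)); last by rewrite !colE mulmxA.
set Z := g0 *m g; apply/rowP => k; rewrite ord1 !mxE /= mulr1n.
rewrite (bigD1 0) //= (bigD1 ord_max) //= big1 ?addr0 => [|c /andP[c0 cm]].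
  by rewrite /ell !mxE /= eqxx mulr0 mulr1 add0r addr0 mul1r.
by rewrite !mxE (negPf c0) (negPf cm) mulr0 addr0 mul0r.
Qed.

Lemma phi_flag0 g F j : g \in unitmx -> flag_of_mx g F ->
  (forall v, v \in F j -> phi *m v = 0) <->
  forall c : 'I_n, (c <= j)%N -> ell tau (g0 *m g) c = 0.
Proof.
move=> gu gF; split=> [F0 c cj|l0 v /(mem_flag_of_mx _ _ gu gF).1 v0].
  have /F0 : col c g \in F j.
    apply/(mem_flag_of_mx _ _ gu gF) => k jk; rewrite invmx_col //.
    by rewrite -val_eqE (gtn_eqF (leq_ltn_trans cj jk)).
  by rewrite phi_col => /matrixP/(_ 0 0); rewrite !mxE.
rewrite -[v](mulKVmx gu) [_ *m (_ *m v)]mulmx_col_sum mulmx_sumr big1 // => c _.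
rewrite -scalemxAr phi_col; have [cj|jc] := leqP c j.
  by rewrite l0 // raddf0 scaler0.
by rewrite v0 // scale0r.
Qed.

Lemma mul_unitmx g : g \in unitmx -> g0 *m g \in unitmx.
Proof. by move=> gu; rewrite unitmx_mul g0u. Qed.

(** In the basis of the columns of [g], the coordinates of [u] are the first column of the inverse
    of [g0 *m g]. *)
Lemma u_flag g F j : g \in unitmx -> flag_of_mx g F ->
  u \in F j <-> forall c : 'I_n, (j < c)%N -> invmx (g0 *m g) c 0 = 0.
Proof.
move=> gu gF; rewrite (mem_flag_of_mx _ _ gu gF) mulmxA.
have <- : invmx (g0 *m g) = invmx g *m invmx g0.
  by rewrite -[RHS](mulmxK (mul_unitmx gu)) -(mulmxA (invmx g)) mulKmx // mulVmx // mul1mx.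
by split=> H c /H; rewrite -colE mxE.
Qed.

Lemma invmx_row (Z : 'M[C]_n) (r k : 'I_n) : Z \in unitmx ->
  \sum_c invmx Z c k * Z r c = (r == k)%:R.
Proof.
move=> /mulmxV/matrixP/(_ r k); rewrite !mxE => e; rewrite -[RHS]e.
by apply: eq_bigr => c _; rewrite mulrC.
Qed.

(* A matrix of the sheet is [a + k u phi] with [k] nonzero, so that it maps [V_j]
   into [V_h(j)] iff [phi] vanishes on [V_j] or [u] lies in [V_h(j)]. *)
Definition flag_comp (i : 'I_n) : set (flag C n) := [set F : flag C n |
  (forall j : 'I_n, (j < i)%N -> forall v, v \in F j -> phi *m v = 0) /\
  u \in F (h i)].

Lemma flag_compP g F i : g \in unitmx -> flag_of_mx g F ->
  flag_comp i F <-> pt (g0 *m g) i.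
Proof.
move=> gu gF; split=> [[phi0 uF]|[l0 _ w0]].
  split; last exact/(u_flag _ gu gF).
    by move=> c ci; apply: (phi_flag0 _ gu gF).1 (phi0 c ci) c (leqnn c).
  by move=> r r0; rewrite invmx_row ?mul_unitmx // -val_eqE gtn_eqF.
split; last exact/(u_flag _ gu gF).
by move=> j ji; apply/(phi_flag0 _ gu gF) => c cj; apply: l0; exact: leq_ltn_trans ji.
Qed.

(** [Z] maps [w] to a multiple [lam] of [e_1], so [w] is [lam] times the first column of the
    inverse, and [lam] is nonzero as [w (h i)] is. *)
Lemma comp_point_inv Z i w : Z \in unitmx -> comp_point tau h Z i w ->
  w (h i) != 0 -> pt Z i.
Proof.
move=> Zu [l0 wZ w0] whi; pose W : 'cV[C]_n := \col_c w c.
have [lam ZW] : exists lam, Z *m W = lam *: delta_mx 0 0.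
  exists ((Z *m W) 0 0).
  apply/matrixP => r k; rewrite ord1 [RHS]mxE [delta_mx _ _ _ _]mxE andbT.
  have [->|r0] := eqVneq r 0; first by rewrite mulr1.
  rewrite mulr0 mxE -[RHS](wZ r); first by apply: eq_bigr => c _; rewrite mxE mulrC.
  by rewrite lt0n -val_eqE in r0 *.
have WE c : w c = lam * invmx Z c 0.
  have /(congr1 (fun A : 'cV_n => A c 0)) := mulKmx Zu W.
  by rewrite ZW -scalemxAr -colE !mxE => <-.
have nz : lam != 0 by apply: contraNneq whi => e; rewrite WE e mul0r.
split=> //.
  by move=> r r0; rewrite invmx_row // -val_eqE gtn_eqF.
by move=> c /w0/eqP; rewrite WE mulf_eq0 (negPf nz) => /eqP.
Qed.

Definition lmul (P : 'M[C]_n) : {rmorphism R -> R} :=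
  evmx (@mpolyC _ C) (map_mx (@mpolyC _ C) P *m X).

Lemma meval_generic (g : 'M[C]_n) : map_mx (meval (mxvec g 0)) X = g.
Proof. exact: (evmx_generic idfun). Qed.

Lemma meval_mpolyC (g P : 'M[C]_n) :
  map_mx (meval (mxvec g 0)) (map_mx (@mpolyC _ C) P) = P.
Proof. by apply/matrixP => r c; rewrite !mxE /= mevalC. Qed.

Lemma meval_lmul (P g : 'M[C]_n) f : (lmul P f).@[mxvec g 0] = f.@[mxvec (P *m g) 0].
Proof.
have ec : meval (mxvec g 0) \o @mpolyC _ C =1 idfun by move=> a /=; rewrite mevalC.
apply: etrans (evmx_comp _ f ec) _.
by rewrite map_mxM meval_generic meval_mpolyC evmx_meval.
Qed.

(* Up to the unit [det], the inverse of a matrix is polynomial in its entries. *)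
Lemma flag_comp_closed i : flag_closed (flag_comp i).
Proof.
pose Y := map_mx (@mpolyC _ C) g0 *m X.
have YE g : map_mx (meval (mxvec g 0)) Y = g0 *m g.
  by rewrite map_mxM meval_generic meval_mpolyC.
exists [set f | (exists2 c : 'I_n, (c < i)%N & f = ell tau%:MP Y c) \/
  (exists2 c : 'I_n, (h i < c)%N & f = (\adj Y) c 0)] => g F gu gF.
have Zu := mul_unitmx gu.
have lE c : (ell tau%:MP Y c).@[mxvec g 0] = ell tau (g0 *m g) c.
  by rewrite ell_map YE /= mevalC.
have aE c : ((\adj Y) c 0).@[mxvec g 0] = \det (g0 *m g) * invmx (g0 *m g) c 0.
  have -> : ((\adj Y) c 0).@[mxvec g 0] = (\adj (g0 *m g)) c 0.
    by rewrite -YE -map_mx_adj [RHS]mxE.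
  by rewrite /invmx Zu [X in _ * X]mxE mulrA divff ?mul1r // -unitfE -unitmxE.
have d0 : \det (g0 *m g) != 0 by rewrite -unitfE -unitmxE.
rewrite (flag_compP _ gu gF); split=> [[l0 _ w0] f [[c ci ->]|[c hc ->]]|S0].
- by rewrite lE l0.
- by rewrite aE w0 ?mulr0.
split=> [c ci|r r0|c hc].
- by rewrite -lE; apply: S0; left; exists c.
- by rewrite invmx_row // -val_eqE gtn_eqF.
have : ((\adj Y) c 0).@[mxvec g 0] = 0 by apply: S0; right; exists c.
by rewrite aE => /eqP; rewrite mulf_eq0 (negPf d0) => /eqP.
Qed.

Lemma invmx_neq0 (Z : 'M[C]_n) (k : 'I_n) : Z \in unitmx -> exists c, invmx Z c k != 0.
Proof.
move=> Zu; apply/existsP; apply: contraT; rewrite negb_exists => /forallP w0.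
have := invmx_row k k Zu; rewrite eqxx big1 => [/esym/eqP|c _]; first by rewrite oner_eq0.
by have := w0 c; rewrite negbK => /eqP->; rewrite mul0r.
Qed.

Section Dense.
Variable e : nat -> C.
Hypothesis e_inj : injective e.

Lemma comp_gens_pt Z i f : Z \in unitmx -> pt Z i ->
  gen_ideal (comp_gens (ell tau%:MP X) h X i) f -> f.@[mxvec Z 0] = 0.
Proof.
move=> Zu pZ If.
have le : ideal_le (gen_ideal (comp_gens (ell tau%:MP X) h X i))
    (comap (meval (mxvec Z 0)) (zero_ideal _)).
  apply: gen_ideal_le => x.
  move/(comp_gens_map (g := meval (mxvec Z 0)) (l' := ell tau Z)) => gx.
  apply: (comp_gens0 pZ (invmx_neq0 0 Zu)).
  have lE c : meval (mxvec Z 0) (ell tau%:MP X c) = ell tau Z c.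
    by rewrite ell_map meval_generic /= mevalC.
  by have := gx lE; rewrite meval_generic.
exact: le.
Qed.

Lemma flag_comp_param (i : 'I_n) F f g : (i.+1 < n)%N -> g \in unitmx -> flag_of_mx g F ->
  flag_comp i F -> f.@[mxvec g 0] != 0 -> param tau h i (lmul (invmx g0) f) != 0.
Proof.
move=> i_n gu gF /(flag_compP _ gu gF) pZ; apply: contraNneq => pf.
have If : comp_ideal tau h i (lmul (invmx g0) f).
  exact: ((comp_idealP tau hess_h indec_h i_n).1 _).2 pf.
by have := comp_gens_pt (mul_unitmx gu) pZ If; rewrite meval_lmul mulKmx // => ->.
Qed.

Lemma flag_comp_dense (i : 'I_n) f : (i.+1 < n)%N -> param tau h i f != 0 ->
  exists g F, [/\ g \in unitmx, flag_of_mx g F, flag_comp i F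
    & f.@[mxvec (g0 *m g) 0] != 0].
Proof.
move=> i_n /(comp_dense_point indec_h e_inj i_n)[Z [w [Zu pZ wh fZ]]].
pose g := invmx g0 *m Z; have gu : g \in unitmx by rewrite unitmx_mul unitmx_inv g0u.
have [F gF] := flag_of_unitmx gu; exists g, F; split=> //; last by rewrite mulKVmx.
by apply/(flag_compP _ gu gF); rewrite mulKVmx //; exact: comp_point_inv pZ wh.
Qed.

(** Two closed sets not containing the component give two polynomials outside the prime kernel.
    Their product does not vanish at some flag of the component, which then lies in neither set. *)
Lemma flag_comp_irreducible (i : 'I_n) : (i.+1 < n)%N ->
  irreducible (@flag_closed C n) (flag_comp i).
Proof.
move=> i_n; split.
  have [|g [F [_ _ FX _]]] := @flag_comp_dense i 1 i_n; last by exists F.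
  by rewrite rmorph1 oner_eq0.
move=> A B [S AS] [T BT] XAB; apply: contrapT => /not_orP[].
have get D U : (forall g F, g \in unitmx -> flag_of_mx g F ->
      D F <-> (forall f, U f -> f.@[mxvec g 0] = 0)) ->
    ~ flag_comp i `<=` D ->
    exists2 f, U f & param tau h i (lmul (invmx g0) f) != 0.
  move=> DU /existsNP[F /not_implyP[FX nD]].
  have [g gu gF] := flag_of_mx_exists F.
  have /existsNP[f /not_implyP[Uf /eqP fg]] : ~ forall f, U f -> f.@[mxvec g 0] = 0.
    by move/(DU _ _ gu gF).
  by exists f => //; exact: flag_comp_param FX fg.
move=> /(get _ _ AS)[f Sf pf] /(get _ _ BT)[f' Tf' pf'].
have := mulf_neq0 pf pf'; rewrite -rmorphM => /(flag_comp_dense i_n)[g [F [gu gF FX]]].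
rewrite mevalM !meval_lmul mulKmx // mulf_eq0 negb_or => /andP[fg fg'].
case: (XAB F FX) => [/(AS _ _ gu gF)/(_ f Sf)|/(BT _ _ gu gF)/(_ f' Tf')] /eqP; exact/negP.
Qed.

Lemma flag_comp_sub i j : comp_index h i -> comp_index h j ->
  flag_comp i `<=` flag_comp j -> i = j.
Proof.
move=> ii jj sub; have i_n := comp_index_lt ii.
apply: (comp_index_inj indec_h (tau := tau) ii jj) => x xj; apply/eqP.
apply: contraT => /(flag_comp_dense i_n)[g [F [gu gF /sub/(flag_compP _ gu gF) pj]]].
by rewrite (comp_gens_pt (mul_unitmx gu) pj) ?eqxx //; exact: gen_ideal_sub.
Qed.

End Dense.

(** As in [prime_comp], the relevant index is the least [i] such that [phi] does not vanish on
    [F i]; then [u] must lie in [F (h i)]. *)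
Lemma hess_variety_comp a k F : k != 0 ->
  hess_variety (a%:M + k *: (invmx g0 *m sheet_mx n' tau *m g0)) h F <->
  exists2 i, comp_index h i & flag_comp i F.
Proof.
move=> k0; rewrite sheet_mx_rank1 (hess_variety_rank1 _ _ _ _ k0 hess_h).
split=> [H|[i ii [phi0 uF]] j]; last first.
  have [ji|ij] := ltnP j i; [by left; exact: phi0|right].
  exact: (subvP (flag_sub F (hess_h.1 _ _ ij))).
suff [i [i_n phi0 uF]] : exists i : 'I_n, [/\ (i.+1 < n)%N,
    forall j : 'I_n, (j < i)%N -> forall v, v \in F j -> phi *m v = 0 & u \in F (h i)].
  have [j [jj ji hj]] := comp_index_below hess_h i_n; exists j => //; split; rewrite ?hj //.
  by move=> k' kj; apply: phi0; exact: leq_trans ji.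
pose bad (j : 'I_n) := ~~ `[< forall v, v \in F j -> phi *m v = 0 >].
have [/existsP[j0 /andP[j0n j0b]]|/existsPn good] :=
  boolP [exists j : 'I_n, (j.+1 < n)%N && bad j].
  have [i /andP[i_n ib] imin] := @arg_minnP _ j0
    (fun j : 'I_n => (j.+1 < n)%N && bad j) val (introT andP (conj j0n j0b)).
  exists i; split=> //; last by case: (H i) => // phi0; case/asboolPn: ib.
  move=> j ji; apply: contrapT => jb; have := imin j.
  rewrite (leq_ltn_trans ji (ltn_ord i)) /= leqNgt ji => /(_ _)/negP; apply=> //.
  exact/asboolPn.
have i_n : ((inord n' : 'I_n).+1 < n)%N by rewrite inordK.
exists (inord n'); split=> // [j|].
  rewrite inordK // => jn; have := good j; rewrite negb_and negbK.
  by rewrite ltnS ltnW //= => /asboolP.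
apply: mem_flag_max; apply/eqP; rewrite eqn_leq ltn_ord /=.
by have := indec_h i_n; rewrite inordK.
Qed.

Lemma irr_components_flag (e : nat -> C) a k : injective e -> k != 0 ->
  irr_components (@flag_closed C n)
    (hess_variety (a%:M + k *: (invmx g0 *m sheet_mx n' tau *m g0)) h)
  = flag_comp @` [set` comp_index h].
Proof.
move=> e_inj k0; apply: irr_components_cover.
- exact: flag_closed0.
- exact: flag_closedU.
- exact: flag_comp_closed.
- by move=> i /comp_index_lt i_n; exact: (flag_comp_irreducible e_inj i_n).
- by move=> F; exact: hess_variety_comp.
- by move=> i j ii jj; exact: (flag_comp_sub e_inj ii jj).
Qed.

End FlagComponents.

(** * The minimal sheet *)

Section MinimalSheet.
Variables (C : fieldType) (n' : nat).
Local Notation n := n'.+2.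
Implicit Types (x y : 'M[C]_n).

Lemma sheet_mx_delta (tau : C) : sheet_mx n' tau = tau *: delta_mx 0 0 + delta_mx 0 ord_max.
Proof.
apply/matrixP => r c; rewrite !mxE; case: (r == 0) => /=; first by [].
by rewrite mulr0 addr0.
Qed.

(** The unipotent matrix [1 - E_1n] conjugates [s + E_1n] to [s]. *)
Lemma sheet_mx1_conj : exists2 Q : 'M[C]_n, Q \in unitmx &
  delta_mx 0 0 = invmx Q *m sheet_mx n' 1 *m Q.
Proof.
pose E : 'M[C]_n := delta_mx 0 ord_max; pose D : 'M[C]_n := delta_mx 0 0.
have EE : E *m E = 0 by rewrite mul_delta_mx_0.
have ED : E *m D = 0 by rewrite mul_delta_mx_0.
have DE : D *m E = E by rewrite mul_delta_mx.
have Qu : 1%:M - E \in unitmx.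
  have /mulmx1_unit[] // : (1%:M - E) *m (1%:M + E) = 1%:M.
  by rewrite mulmxDr mulmx1 mulmxBl mul1mx EE subr0 subrK.
exists (1%:M - E) => //.
rewrite -[LHS](mulKmx Qu) -mulmxA; congr (_ *m _); rewrite sheet_mx_delta scale1r -/D -/E.
by rewrite mulmxBl mul1mx ED subr0 mulmxBr mulmx1 mulmxDl DE EE addr0 addrK.
Qed.

Local Notation m := (inord n' : 'I_n).

Lemma mx_unit_delta : mx_unit C n n'.+1 n = delta_mx m ord_max.
Proof. by apply/matrixP => r c; rewrite !mxE !eqSS -!val_eqE /= inordK. Qed.

(** The basis vectors 1 and [n - 1] are exchanged. *)
Lemma mx_unit_conj : exists2 Q : 'M[C]_n, Q \in unitmx &
  mx_unit C n n'.+1 n = invmx Q *m sheet_mx n' 0 *m Q.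
Proof.
pose Q : 'M[C]_n := perm_mx (tperm 0 m).
have Qu : Q \in unitmx by exact: unitmx_perm.
exists Q => //; rewrite -mulmxA mx_unit_delta sheet_mx_delta scale0r add0r.
rewrite -[LHS](mulKmx Qu); congr (_ *m _); rewrite -row_permE.
rewrite /Q -[X in _ *m perm_mx X]tpermV -col_permE; apply/matrixP => r c; rewrite !mxE.
have -> : (tperm 0 m r == m) = (r == 0).
  by rewrite -(inj_eq (@perm_inj _ (tperm 0 m))) tpermK tpermR.
have -> // : (tperm 0 m c == ord_max) = (c == ord_max).
have mD : tperm 0 m ord_max = ord_max.
  by rewrite tpermD // -val_eqE /= inordK // ltn_eqF.
by rewrite -{1}mD (inj_eq (@perm_inj _ _)).
Qed.

Lemma diag_firstE (c1 c2 : C) :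
  diag_first n c1 c2 = c2%:M + (c1 - c2) *: delta_mx 0 0.
Proof.
apply/matrixP => r c; rewrite !mxE -!val_eqE /=.
have [->|rc] := eqVneq (val r) (val c); last first.
  have -> : (val r == 0) && (val c == 0) = false.
    by apply: contraNF rc => /andP[/eqP-> /eqP->].
  by rewrite mulr0 addr0.
by rewrite andbb; case: (val c == 0); rewrite ?mulr1 ?mulr0 ?addr0 // addrC subrK.
Qed.

Lemma conj_affine (P Q A : 'M[C]_n) a k : P \in unitmx -> Q \in unitmx ->
  invmx P *m (a%:M + k *: (invmx Q *m A *m Q)) *m P =
  a%:M + k *: (invmx (Q *m P) *m A *m (Q *m P)).
Proof.
move=> Pu Qu.
have -> : invmx (Q *m P) = invmx P *m invmx Q.
  have QPu : Q *m P \in unitmx by rewrite unitmx_mul Qu.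
  by rewrite -[RHS](mulmxK QPu) -(mulmxA (invmx P)) mulKmx // mulVmx // mul1mx.
rewrite mulmxDr mulmxDl -scalemxAr -scalemxAl !mulmxA; congr (_ + _).
by rewrite scalar_mxC -mulmxA mulVmx // mulmx1.
Qed.

(** The second type is excluded: [x - c] would be similar to a diagonal matrix of square zero, hence
    zero. *)
Lemma diagonalizable_minimal_sheet x : minimal_sheet x -> diagonalizable x ->
  exists Q a k, [/\ Q \in unitmx, k != 0
    & x = a%:M + k *: (invmx Q *m sheet_mx n' 1 *m Q)].
Proof.
case=> [[c1 [c2 [c12 [P Pu /(simmxLR Pu)->]]]] _|[c [P Pu /(simmxP Pu) Px]]].
  have [Q Qu E] := sheet_mx1_conj.
  exists (Q *m P), c2, (c1 - c2); split; rewrite ?unitmx_mul ?Qu ?subr_eq0 //.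
  by rewrite mxpoly.conjVmx // diag_firstE E conj_affine.
case=> S Su /(diagonalizable_forLR Su)[d xE]; rewrite mxpoly.conjVmx // in xE.
pose N := mx_unit C n n.-1 n.
pose M := S *m invmx P.
have Mu : M \in unitmx by rewrite unitmx_mul Su unitmx_inv.
have NN : N *m N = 0.
  rewrite /N mx_unit_delta mul_delta_mx_0 // -val_eqE /= inordK //.
  by rewrite neq_ltn ltnSn orbT.
pose d' := d - const_mx c.
have MN : M *m N = diag_mx d' *m M.
  have : M *m (c%:M + N) = diag_mx d *m M.
    have -> : c%:M + N = P *m x *m invmx P by rewrite Px mulmxK.
    by rewrite /M -!mulmxA mulKmx // xE !mulmxA mulmxV // mul1mx.
  rewrite /d' raddfB /= mulmxBl => <-; rewrite mulmxDr diag_const_mx.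
  by rewrite scalar_mxC addrAC subrr add0r.
have d2 : diag_mx d' *m diag_mx d' = 0.
  apply: (can_inj (mulmxK Mu)); rewrite -mulmxA -MN mulmxA -MN -mulmxA NN.
  by rewrite mulmx0 mul0mx.
have d0 : d' = 0.
  apply/rowP => i; have /matrixP/(_ i i) := d2.
  rewrite mul_diag_mx !mxE eqxx mulr1n => /eqP; rewrite mulf_eq0 orbb.
  by move/eqP.
have /matrixP/(_ m ord_max)/eqP : N = 0.
  by apply: (can_inj (mulKmx Mu)); rewrite MN d0 raddf0 mul0mx mulmx0.
by rewrite /N mx_unit_delta !mxE !eqxx oner_eq0.
Qed.

Lemma nilpotent_eigen y (v : 'rV[C]_n) a :
  nilpotent_mx y -> v != 0 -> v *m y = a *: v -> a = 0.
Proof.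
move=> [k yk] v0 va.
have : v *m (y ^+ k) = a ^+ k *: v.
  elim: k {yk} => [|k IH]; first by rewrite !expr0 mulmx1 scale1r.
  by rewrite exprSr [v *m _]mulmxA IH -scalemxAl va scalerA -exprSr.
rewrite yk mulmx0 => /esym/eqP; rewrite scaler_eq0 (negPf v0) orbF.
by rewrite expf_eq0 => /andP[_ /eqP].
Qed.

(** For the first type [c1] and [c2] are both eigenvalues, so both vanish, against [c1 != c2]. *)
Lemma nilpotent_minimal_sheet y : minimal_sheet y -> nilpotent_mx y ->
  exists Q a k, [/\ Q \in unitmx, k != 0
    & y = a%:M + k *: (invmx Q *m sheet_mx n' 0 *m Q)].
Proof.
case=> [[c1 [c2 [c12 [P Pu /(simmxP Pu) Py]]]] ny|[c [P Pu /(simmxLR Pu)->]] _].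
  have eig (i : 'I_n) : (if i == 0 :> nat then c1 else c2) = 0.
    apply: (@nilpotent_eigen y (delta_mx 0 i *m P) _ ny).
      apply: contraNneq (oner_neq0 C) => /(congr1 (fun A => A *m invmx P)).
      by rewrite mulmxK // mul0mx => /rowP/(_ i); rewrite !mxE !eqxx => /eqP.
    rewrite -mulmxA Py mulmxA scalemxAl; congr (_ *m _).
    apply/rowP => j; rewrite -rowE !mxE /= [i == j]eq_sym.
    have [_|_] := eqVneq j i; first by rewrite mulr1.
    by rewrite mulr0.
  by case/eqP: c12; apply: etrans (eig 0) (esym (eig ord_max)).
have [Q Qu E] := mx_unit_conj.
exists (Q *m P), c, 1; split; rewrite ?unitmx_mul ?Qu ?oner_eq0 //.
by rewrite mxpoly.conjVmx // E -[X in _ + X]scale1r conj_affine.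
Qed.

End MinimalSheet.

Theorem theorem2 (R : realType) (n : nat) (h : 'I_n -> 'I_n)
    (n_ge2 : (2 <= n)%N) (hess_h : hessenberg h) (indec_h : indecomposable h) :
  let s : 'M[R[i]]_n := diag_first n 1 0 in
  let e : 'M[R[i]]_n := mx_unit R[i] n 1 n in
  let s_t : 'M[{poly R[i]}]_n := 'X *: map_mx polyC s + map_mx polyC e in
  [/\ flat_degeneration
        (hess_scheme s_t h) (hess_scheme s h) (hess_scheme e h),
      exists Phi : set (spec {mpoly R[i][n * n]}) ->
                   set (spec {mpoly R[i][n * n]}),
        set_bij
          (irr_components (@spec_closed _) (zero_locus (hess_scheme s h)))
          (irr_components (@spec_closed _) (zero_locus (hess_scheme e h))) Phi /\
        (forall Z, irr_components (@spec_closed _) (zero_locus (hess_scheme s h)) Z ->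
           exists2 W : ideal {mpoly {poly R[i]}[n * n]},
             ideal_le (hess_scheme s_t h) W
           & flat_degeneration W (vanishing Z) (vanishing (Phi Z)))
    & forall x y : 'M[R[i]]_n,
        minimal_sheet x -> diagonalizable x ->
        minimal_sheet y -> nilpotent_mx y ->
        exists f : set (flag R[i] n) -> set (flag R[i] n),
          set_bij
            (irr_components (@flag_closed R[i] n) (hess_variety x h))
            (irr_components (@flag_closed R[i] n) (hess_variety y h)) f].
Proof.
case: n h n_ge2 hess_h indec_h => [//|[//|n']] h _ hess_h indec_h s e s_t.
have eE : e = sheet_mx n' 0 by exact: sheet_mx0.
have s_tE : s_t = sheet_mx n' 'X by exact: sheet_mxX.
rewrite eE s_tE; split.
- exact: hess_scheme_degeneration.
- exact: scheme_components_bij.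
move=> x y mx dx my ny.
have [P [a [k [Pu k0 ->]]]] := diagonalizable_minimal_sheet mx dx.
have [Q [b [l [Qu l0 ->]]]] := nilpotent_minimal_sheet my ny.
(* The natural numbers provide the infinitely many scalars used for density. *)
have e_inj : injective (fun m : nat => m%:R : R[i]).
  by move=> m1 m2 /eqP; rewrite Num.Theory.eqr_nat => /eqP.
have Xinj tau g : g \in unitmx ->
    set_inj [set` comp_index h] (@flag_comp R[i] n' h tau g).
  move=> gu i j /set_mem ii /set_mem jj ij.
  by apply: (flag_comp_sub indec_h (tau := tau) gu e_inj ii jj); rewrite ij.
have ne : [set` comp_index h] !=set0.
  by have [i ii] := comp_index_exists hess_h; exists i; exact: ii.
have [Phi [bij _ _]] := image_set_bij
  (irr_components_flag hess_h indec_h 1 Pu a e_inj k0)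
  (irr_components_flag hess_h indec_h 0 Qu b e_inj l0)
  (Xinj 1 P Pu) (Xinj 0 Q Qu) ne.
by exists Phi.
Qed.
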